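(* Let $Q$ be a tame quiver without oriented cycles and $\mathbf{k}$ a finite field. Let $P,P'$ be indecomposable preprojective $\mathbf{k}Q$-modules of defect $-1$ and let $R,R',R''$ be indecomposable regular $\mathbf{k}Q$-modules (or zero modules). Then there exists a short exact sequence $$0\longrightarrow P\oplus R\longrightarrow P'\oplus R'\longrightarrow R''\longrightarrow 0$$ if and only if there are modules $R_1,R_2$ and short exact sequences $$0\to R\to R'\to R_1\to0,\qquad 0\to P\to P'\to R_2\to 0,\qquad 0\to R_1\to R''\to R_2\to0.$$ In this case, we have $$F_{R''\,P\oplus R}^{P'\oplus R'}=\begin{cases}|\mathrm{Hom}(P,R'')|,&\text{if }P\cong P';\\ a_{R'/R},&\text{if }P\not\cong P'.\end{cases}$$
   Context: A tame quiver is a (connected) quiver whose underlying graph is an extended Dynkin diagram of type $\widetilde{\mathbb{A}},\widetilde{\mathbb{D}},\widetilde{\mathbb{E}}_6,\widetilde{\mathbb{E}}_7$ or $\widetilde{\mathbb{E}}_8$. $\mathbf{k}Q$-modules are finite dimensional left modules over the path algebra; each indecomposable one is preprojective, regular or preinjective. The defect of $M$ is $\langle\delta,[M]\rangle$, where $\langle-,-\rangle$ is the Euler form and $\delta$ is the minimal positive imaginary root (so indecomposable preprojectives have negative defect). Hall number: $F_{MN}^{L}=|\{X\subseteq L\mid X\cong N,\ L/X\cong M\}|$. For a module $M$, $a_M=|\mathrm{Aut}(M)|$ (so $a_0=1$). $R'/R$ denotes the cokernel of the embedding $R\to R'$. *)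

(* Defs.v *)
From HB Require Import structures.
From mathcomp Require Import all_boot all_order all_algebra.

Set Implicit Arguments.
Unset Strict Implicit.
Unset Printing Implicit Defensive.

Import Order.TTheory GRing.Theory Num.Theory.
Local Open Scope ring_scope.

Record quiver := Quiver {
  nvert : nat;
  narr : nat;
  src : 'I_narr -> 'I_nvert;
  tgt : 'I_narr -> 'I_nvert }.

Definition qop (Q : quiver) : quiver := Quiver (@tgt Q) (@src Q).

(* A path is the list of its arrows in the order in which they are
   travelled; [::] is the trivial path e_i. *)
Fixpoint qpath (Q : quiver) (i : 'I_(nvert Q)) (p : seq 'I_(narr Q))
    (j : 'I_(nvert Q)) : bool :=
  if p is a :: p' then (src a == i) && qpath (tgt a) p' j else i == j.

Definition acyclic (Q : quiver) : Prop :=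
  forall (i : 'I_(nvert Q)) (p : seq 'I_(narr Q)), qpath i p i -> p = [::].

(* ext_dynkin N es: the multigraph with vertices 0, ..., N-1 and list of edges
   es is an extended Dynkin diagram. *)
Inductive ext_dynkin : nat -> seq (nat * nat) -> Prop :=
| ExtA n of (0 < n)%N :
    ext_dynkin n.+1 [seq (i, (i.+1 %% n.+1)%N) | i <- iota 0 n.+1]
| ExtD n of (4 <= n)%N :
    ext_dynkin n.+1 ([:: (0, 2); (1, 2); (n - 2, n - 1); (n - 2, n)]%N
                     ++ [seq (i, i.+1) | i <- iota 2 (n - 4)])
| ExtE6 : ext_dynkin 7
    [:: (0, 1); (1, 2); (0, 3); (3, 4); (0, 5); (5, 6)]%N
| ExtE7 : ext_dynkin 8
    [:: (0, 1); (0, 2); (2, 3); (3, 4); (0, 5); (5, 6); (6, 7)]%N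
| ExtE8 : ext_dynkin 9
    [:: (0, 1); (0, 2); (2, 3); (0, 4); (4, 5); (5, 6); (6, 7); (7, 8)]%N.

Definition uedge (e : nat * nat) : nat * nat := (minn e.1 e.2, maxn e.1 e.2).

Definition underlying_graph (Q : quiver) (N : nat) (es : seq (nat * nat)) : Prop :=
  exists2 sigma : 'I_(nvert Q) -> 'I_N, bijective sigma &
    perm_eq [seq uedge (val (sigma (src a)), val (sigma (tgt a)))
               | a <- enum 'I_(narr Q)]
            [seq uedge e | e <- es].

Definition tame (Q : quiver) : Prop :=
  exists N es, ext_dynkin N es /\ underlying_graph Q N es.

Definition euler (Q : quiver) (x y : 'I_(nvert Q) -> int) : int :=
  \sum_i x i * y i - \sum_a x (src a) * y (tgt a).

(* For a tame quiver the imaginary roots are the nonzero isotropic vectors of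
   the Tits form x |-> <x, x>. *)
Definition pos_imaginary_root (Q : quiver) (x : 'I_(nvert Q) -> int) : Prop :=
  [/\ forall i, 0 <= x i, exists i, x i != 0 & euler x x = 0].

Definition min_pos_imaginary_root (Q : quiver) (d : 'I_(nvert Q) -> int) : Prop :=
  pos_imaginary_root d /\
  forall x, pos_imaginary_root x -> (forall i, x i <= d i) -> x =1 d.

(* A finite dimensional left kQ-module M is given by the spaces
   e_i M = 'rV_(rdim M i) and the action of the arrows
   e_(src a) M -> e_(tgt a) M, v |-> v *m rmap M a.  Paths compose in kQ as
   maps do, so that kQ e_i is spanned by the paths starting at i. *)
Record rep (k : finFieldType) (Q : quiver) := Rep {
  rdim : 'I_(nvert Q) -> nat;
  rmap : forall a : 'I_(narr Q), 'M[k]_(rdim (src a), rdim (tgt a)) }.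

Section Reps.
Variables (k : finFieldType) (Q : quiver).
Implicit Types M N L : rep k Q.

Definition dimvec M (i : 'I_(nvert Q)) : int := (rdim M i)%:Z.

Definition defect (d : 'I_(nvert Q) -> int) M : int := euler d (dimvec M).

Definition rep_is0 M : Prop := forall i, rdim M i = 0%N.

Definition rsum M N : rep k Q :=
  @Rep k Q (fun i => (rdim M i + rdim N i)%N)
    (fun a => block_mx (rmap M a) 0 0 (rmap N a)).

Definition gmap M N := {dffun forall i, 'M[k]_(rdim M i, rdim N i)}.

Definition rhom M N : {set gmap M N} :=
  [set f : gmap M N |
    [forall a, rmap M a *m f (tgt a) == f (src a) *m rmap N a]].

Definition rmono M N (f : gmap M N) : bool :=
  (f \in rhom M N) && [forall i, row_free (f i)].

Definition repi M N (f : gmap M N) : bool :=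
  (f \in rhom M N) && [forall i, row_full (f i)].

Definition riso M N : bool := [exists f : gmap M N, rmono f && repi f].

Definition aut_card M : nat := #|[set f : gmap M M | rmono f && repi f]|.

Definition short_exact L M N : Prop :=
  exists (f : gmap L M) (g : gmap M N),
    [/\ rmono f, repi g & forall i, (f i == kermx (g i))%MS].

Definition indecomposable M : Prop :=
  ~ rep_is0 M /\
  forall N L, riso M (rsum N L) -> rep_is0 N \/ rep_is0 L.

Definition stable M (U : forall i, 'M[k]_(rdim M i)) : bool :=
  [forall a, (U (src a) *m rmap M a <= U (tgt a))%MS].

(* The submodule with components the row spaces of the U i, and the quotient
   by it, in chosen bases; both are meaningful only for stable U. *)
Definition subrep M (U : forall i, 'M[k]_(rdim M i)) : rep k Q :=
  @Rep k Q (fun i => \rank (U i))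
    (fun a => row_base (U (src a)) *m rmap M a
              *m pinvmx (row_base (U (tgt a)))).

Definition quorep M (U : forall i, 'M[k]_(rdim M i)) : rep k Q :=
  @Rep k Q (fun i => \rank (cokermx (U i)))
    (fun a => pinvmx (col_base (cokermx (U (src a)))) *m rmap M a
              *m col_base (cokermx (U (tgt a)))).

Definition coker M N (f : gmap M N) : rep k Q := quorep (fun i => <<f i>>%MS).

(* F_{MN}^L.  A subspace of 'rV_n is represented by the unique square matrix U
   with <<U>> = U spanning it, so that each submodule is counted once. *)
Definition hall M N L : nat :=
  #|[set U : {dffun forall i, 'M[k]_(rdim L i)} |
      [&& [forall i, <<U i>>%MS == U i], stable U,
          riso (subrep U) N & riso (quorep U) M]]|.

(* Ext^1(M, N) is the cokernel of
     prod_i Hom_k(M_i, N_i) -> prod_a Hom_k(M_(src a), N_(tgt a)),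
   the map Hom(X0, N) -> Hom(X1, N) coming from the standard projective
   resolution 0 -> X1 -> X0 -> M -> 0; cobound is the matrix of this map. *)
Definition c0dim M N := (\sum_(i < nvert Q) rdim M i * rdim N i)%N.
Definition c1dim M N := (\sum_(a < narr Q) rdim M (src a) * rdim N (tgt a))%N.

Definition comp0 M N (c : 'rV[k]_(c0dim M N)) i : 'M[k]_(rdim M i, rdim N i) :=
  vec_mx (submxrow c i).

Definition comp1 M N (c : 'rV[k]_(c1dim M N)) a :
    'M[k]_(rdim M (src a), rdim N (tgt a)) :=
  vec_mx (submxrow c a).

Definition cobound M N : 'M[k]_(c0dim M N, c1dim M N) :=
  lin1_mx (fun c => \mxrow_(a < narr Q)
    mxvec (comp0 c (src a) *m rmap N a - rmap M a *m comp0 c (tgt a))).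

Definition ext1_dim M N : nat := \rank (cokermx (cobound M N)).

Definition ext1_proj M N : 'M[k]_(c1dim M N, ext1_dim M N) :=
  col_base (cokermx (cobound M N)).

(* Ext^1(M, h) : Ext^1(M, N) -> Ext^1(M, N'). *)
Definition ext1_map M N N' (h : forall i, 'M[k]_(rdim N i, rdim N' i)) :
    'M[k]_(ext1_dim M N, ext1_dim M N') :=
  pinvmx (ext1_proj M N)
  *m lin1_mx (fun c : 'rV[k]_(c1dim M N) =>
       \mxrow_(a < narr Q) mxvec (comp1 c a *m h (tgt a)))
  *m ext1_proj M N'.

Fixpoint paths_len (n : nat) (i j : 'I_(nvert Q)) : seq (seq 'I_(narr Q)) :=
  if n is n'.+1 then
    flatten [seq [seq a :: p | p <- paths_len n' (tgt a) j]
               | a <- enum 'I_(narr Q) & src a == i]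
  else if i == j then [:: [::]] else [::].

(* In a quiver without oriented cycles all paths have length < nvert Q. *)
Definition paths (i j : 'I_(nvert Q)) : seq (seq 'I_(narr Q)) :=
  flatten [seq paths_len n i j | n <- iota 0 (nvert Q)].

Definition projrep (i : 'I_(nvert Q)) : rep k Q :=
  @Rep k Q (fun j => size (paths i j))
    (fun a => \matrix_(u, v)
      (nth [::] (paths i (tgt a)) v
         == rcons (nth [::] (paths i (src a)) u) a)%:R).

(* Right multiplication by a, kQ e_(tgt a) -> kQ e_(src a). *)
Definition projmap (a : 'I_(narr Q)) (j : 'I_(nvert Q)) :
    'M[k]_(rdim (projrep (tgt a)) j, rdim (projrep (src a)) j) :=
  \matrix_(u, v)
    (nth [::] (paths (src a) j) v == a :: nth [::] (paths (tgt a) j) u)%:R.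

(* tau M = D Ext^1(M, kQ), so that e_i (tau M) = D Ext^1(M, kQ e_i). *)
Definition tau M : rep k Q :=
  @Rep k Q (fun i => ext1_dim M (projrep i))
    (fun a => (ext1_map M (projmap a))^T).

End Reps.

(* The duality D = Hom_k(-, k) between left and right kQ-modules, the latter
   being the left modules over the opposite quiver. *)
Definition rdual (k : finFieldType) (Q : quiver) (M : rep k Q) : rep k (qop Q) :=
  @Rep k (qop Q) (rdim M) (fun a => (rmap M a)^T).

Definition rdual' (k : finFieldType) (Q : quiver) (M : rep k (qop Q)) : rep k Q :=
  @Rep k Q (rdim M) (fun a => (rmap M a)^T).

(* tau^- M = Ext^1(D M, kQ) = D (tau (D M)), with the inner tau taken over the
   opposite quiver. *)
Definition tauinv (k : finFieldType) (Q : quiver) (M : rep k Q) : rep k Q :=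
  rdual' (tau (rdual M)).

(* For indecomposable M: tau^n M = 0 for some n iff M is some tau^-m (kQ e_i),
   and dually; the regular modules are the remaining ones. *)
Definition preprojective (k : finFieldType) (Q : quiver) (M : rep k Q) : Prop :=
  exists n, rep_is0 (iter n (@tau k Q) M).

Definition preinjective (k : finFieldType) (Q : quiver) (M : rep k Q) : Prop :=
  exists n, rep_is0 (iter n (@tauinv k Q) M).

Definition regular (k : finFieldType) (Q : quiver) (M : rep k Q) : Prop :=
  ~ preprojective M /\ ~ preinjective M.

(* Main.v *)
Require Import Defs.
From Stdlib Require Import Classical FunctionalExtensionality.
From HB Require Import structures.
From mathcomp Require Import all_boot all_order all_algebra.
From mathcomp Require Import zify ring.

Set Implicit Arguments.
Unset Strict Implicit.
Unset Printing Implicit Defensive.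

Import Order.TTheory GRing.Theory Num.Theory.
Local Open Scope ring_scope.

(**
Work in the category of regular modules: defect zero and no submodule of
positive defect.  It is abelian, an indecomposable object is uniserial in it,
and a preprojective module [L] of defect -1 behaves like a line bundle: every
nonzero map from [L] to a torsion-free module is injective, Hom(R, L) = 0 and
Ext^1(L, R) = 0 for [R] regular.  Hence a sequence with middle term [P' + R'] is
block triangular, and its blocks [R -> R'], [P -> P'] and the induced map of
cokernels are the three sequences; conversely they are glued by lifting along
Ext^1(P, R) = Ext^1(P', R1) = 0.

For the Hall number, a submodule is the kernel of some [(g1, g2) : P' + R' -> R''],
and [ker g2] is the image of [R] because [R'] is uniserial.  If [P] and [P'] are
isomorphic, [g2] is onto and normalizes to a fixed map while [g1] is arbitrary.
Otherwise [g2] is not onto, so [g1] is nonzero on the top of [R''].  The point is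
then that every map [P' -> R''] factors uniquely through [g1]; so [g1] normalizes
to a fixed map, and [g2] varies by the automorphisms of [R'/R].  This
factorization rests on dim Hom(L, E) being 0 or dim End(E) for [L] of defect -1
and [E] regular simple.

Both the sign of the defect and uniseriality come from the Auslander-Reiten
formula dim Hom(N, tau M) = dim Ext^1(M, N): it makes a nonsplit extension of a
uniserial regular module by a regular simple one uniserial again, on either side,
so that a uniserial subquotient of maximal length is a direct summand.
*)

(** Most lifting and extension arguments are dimension counts. Ext^1 enters through its dimension
    only: the Euler form gives dim Hom - dim Ext^1, the Auslander-Reiten formula turns monotonicity
    of Hom into right exactness of Ext^1, and a map lifts or extends because the dimensions in a
    left exact sequence of Hom spaces add up. The obstacle is the equality dim Hom(L, E) = dim
    End(E), since over a finite field End(E) may exceed k. Its proof wants the maps L -> E to be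
    onto, while a given L may be too small for that. The remedy is that dim Hom(L, R) with R regular
    depends on the dimension vector of L only modulo delta, and that the quadratic form supplies
    modules of defect -1 of arbitrarily large dimension. When the dimension vector of E is a
    multiple of delta, no count decides; there all the defects involved are multiples of some r, and
    a power L^r of defect -r leaves no room between 0 and -r. *)

Section LinearAlgebra.
Variable k : fieldType.

(** Lets [lin1_mx] be applied to a bare function whose linearity is a hypothesis, so that the maps
    below need not be declared linear. *)
Lemma mul_rV_linear n m (f : 'rV[k]_n -> 'rV[k]_m) (u : 'rV[k]_n) :
  linear f -> u *m lin1_mx f = f u.
Proof.
move=> lf.
pose F : {linear 'rV[k]_n -> 'rV[k]_m} :=
  HB.pack_for {linear 'rV[k]_n -> 'rV[k]_m} f (GRing.isLinear.Build _ _ _ _ f lf).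
exact: (mul_rV_lin1 F).
Qed.

Lemma rank_le_inj n m p q (A : 'M[k]_(p, n)) (B : 'M[k]_(q, m))
    (f : 'rV[k]_n -> 'rV[k]_m) :
  linear f -> (forall u : 'rV_n, (u <= A)%MS -> (f u <= B)%MS) ->
  (forall u : 'rV_n, (u <= A)%MS -> f u = 0 -> u = 0) ->
  (\rank A <= \rank B)%N.
Proof.
move=> lf fAB finj.
have <- : \rank (A *m lin1_mx f) = \rank A.
  apply/(mxrank_injP _); rewrite -submx0; apply/rV_subP=> v; rewrite sub_capmx => /andP[vA /sub_kermxP].
  by rewrite mul_rV_linear // => /(finj _ vA) ->; rewrite sub0mx.
apply/mxrankS/rV_subP=> v /submxP[w ->]; rewrite mulmxA mul_rV_linear //.
by apply: fAB; rewrite submxMl.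
Qed.

(** Rank-nullity for [g] on [K2], where its kernel is the image of [K1]. The equivalence is what
    later turns a dimension count into surjectivity. *)
Lemma rank_exact n1 n2 n3 p1 p2 p3 (K1 : 'M[k]_(p1, n1)) (K2 : 'M[k]_(p2, n2))
    (K3 : 'M[k]_(p3, n3)) (f : 'rV[k]_n1 -> 'rV[k]_n2)
    (g : 'rV[k]_n2 -> 'rV[k]_n3) :
  linear f -> linear g ->
  (forall u : 'rV_n1, (u <= K1)%MS -> f u = 0 -> u = 0) ->
  (forall v : 'rV_n2, (v <= K2)%MS -> (g v <= K3)%MS) ->
  (forall u : 'rV_n1, (u <= K1)%MS -> (f u <= K2)%MS /\ g (f u) = 0) ->
  (forall v : 'rV_n2, (v <= K2)%MS -> g v = 0 ->
     exists2 u : 'rV_n1, (u <= K1)%MS & v = f u) ->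
  (\rank K2 <= \rank K1 + \rank K3)%N /\
  ((\rank K1 + \rank K3 <= \rank K2)%N <->
   forall w : 'rV_n3, (w <= K3)%MS -> exists2 v : 'rV_n2, (v <= K2)%MS & g v = w).
Proof.
move=> lf lg finj gK fK ex; set G := lin1_mx g.
have GE u : u *m G = g u by rewrite mul_rV_linear.
have r1 : \rank (K2 :&: kermx G)%MS = \rank K1.
  apply/eqP; rewrite eqn_leq; apply/andP; split.
    have sub : (K2 :&: kermx G <= K1 *m lin1_mx f)%MS.
      apply/rV_subP=> v; rewrite sub_capmx => /andP[vK /sub_kermxP].
      rewrite GE => /(ex _ vK)[u uK ->]; rewrite -(mul_rV_linear _ lf).
      exact: submxMr.
    by rewrite (leq_trans (mxrankS sub)) // mxrankM_maxl.
  apply: (@rank_le_inj _ _ _ _ _ _ f) => // u uK; have [h1 h2] := fK _ uK.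
  by rewrite sub_capmx h1; apply/sub_kermxP; rewrite GE.
have r2 : (K2 *m G <= K3)%MS.
  by apply/rV_subP=> v /submxP[w ->]; rewrite mulmxA GE; apply: gK; rewrite submxMl.
rewrite -(mxrank_mul_ker K2 G) r1 addnC leq_add2l (mxrankS r2) leq_add2l.
split=> //; have [_ e] := mxrank_leqif_sup r2; split=> [h w wK|h].
  have : (K3 <= K2 *m G)%MS by rewrite -e eqn_leq mxrankS.
  move/(submx_trans wK)/submxP=> [x ->]; exists (x *m K2); first exact: submxMl.
  by rewrite -GE mulmxA.
apply: mxrankS; apply/rV_subP=> w /h[v vK <-]; rewrite -GE; exact: submxMr.
Qed.

End LinearAlgebra.

(** * Homomorphisms and the dimensions of Hom and Ext *)

Section Hom.
Variables (k : finFieldType) (Q : quiver).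
Implicit Types M N L X Y : rep k Q.

(** Plain functions rather than the finite functions [gmap], so that composites are written
    pointwise; [fam] and [unfam] convert. *)
Definition gm M N := forall i, 'M[k]_(rdim M i, rdim N i).

Definition hom M N (f : gm M N) : Prop :=
  forall a, rmap M a *m f (tgt a) = f (src a) *m rmap N a.
Definition mono M N (f : gm M N) : Prop := hom f /\ forall i, row_free (f i).
Definition epi M N (f : gm M N) : Prop := hom f /\ forall i, row_full (f i).

Definition gcomp M N L (f : gm M N) (g : gm N L) : gm M L := fun i => f i *m g i.
Definition gid M : gm M M := fun i => 1%:M.
Definition gadd M N (f g : gm M N) : gm M N := fun i => f i + g i.
Definition gscale M N c (f : gm M N) : gm M N := fun i => c *: f i.

Lemma hom_comp M N L (f : gm M N) (g : gm N L) : hom f -> hom g -> hom (gcomp f g).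
Proof. by move=> hf hg a; rewrite /gcomp mulmxA hf -!mulmxA hg. Qed.
Lemma hom_id M : hom (@gid M).
Proof. by move=> a; rewrite mulmx1 mul1mx. Qed.
Lemma hom_add M N (f g : gm M N) : hom f -> hom g -> hom (gadd f g).
Proof. by move=> hf hg a; rewrite mulmxDr mulmxDl hf hg. Qed.
Lemma hom_scale M N c (f : gm M N) : hom f -> hom (gscale c f).
Proof. by move=> hf a; rewrite -scalemxAr -scalemxAl hf. Qed.
Lemma hom0 M N : hom (fun i => 0 : 'M[k]_(rdim M i, rdim N i)).
Proof. by move=> a; rewrite mulmx0 mul0mx. Qed.

Lemma mono_comp M N L (f : gm M N) (g : gm N L) : mono f -> mono g -> mono (gcomp f g).
Proof.
move=> [hf rf] [hg rg]; split; first exact: hom_comp.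
by move=> i; rewrite /gcomp /row_free mxrankMfree //; apply: rf.
Qed.
Lemma epi_comp M N L (f : gm M N) (g : gm N L) : epi f -> epi g -> epi (gcomp f g).
Proof.
move=> [hf rf] [hg rg]; split; first exact: hom_comp.
by move=> i; rewrite /gcomp /row_full (eqmxMfull _ (rf i)); apply: rg.
Qed.
Lemma mono_id M : mono (@gid M).
Proof. by split; [exact: hom_id | move=> i; rewrite row_free_unit unitmx1]. Qed.
Lemma epi_id M : epi (@gid M).
Proof. by split; [exact: hom_id | move=> i; rewrite row_full_unit unitmx1]. Qed.

(** Inverse of [comp0]: a family becomes a single vector, and the homomorphisms become the kernel of
    [cobound]. *)
Definition pk M N (f : gm M N) : 'rV[k]_(c0dim M N) := \mxrow_i mxvec (f i).

Lemma pkK M N (f : gm M N) i : comp0 (pk f) i = f i.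
Proof. by rewrite /comp0 /pk mxrowK mxvecK. Qed.
Lemma comp0K M N (c : 'rV[k]_(c0dim M N)) : pk (comp0 c) = c.
Proof.
rewrite /pk -[RHS]submxrowK; apply: eq_mxrow => i; by rewrite /comp0 vec_mxK.
Qed.
Lemma comp0_inj M N (c c' : 'rV[k]_(c0dim M N)) :
  (forall i, comp0 c i = comp0 c' i) -> c = c'.
Proof.
move=> h; rewrite -[c]comp0K -[c']comp0K; apply: eq_mxrow => i; by rewrite h.
Qed.
Lemma comp0_lin M N c (u v : 'rV[k]_(c0dim M N)) i :
  comp0 (c *: u + v) i = c *: comp0 u i + comp0 v i.
Proof.
rewrite /comp0 -linearP; congr vec_mx.
by apply/rowP=> j; rewrite !mxE.
Qed.
Lemma pk_linear M N M' N' (F : gm M N -> gm M' N') :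
  (forall c f g h, (forall i, h i = c *: f i + g i) ->
     forall i, F h i = c *: F f i + F g i) ->
  linear (fun c => pk (F (comp0 c))).
Proof.
move=> Flin c u v; apply: comp0_inj => i; rewrite comp0_lin !pkK.
by apply: Flin => j; rewrite comp0_lin.
Qed.

Definition pk1 M N (f : forall a, 'M[k]_(rdim M (src a), rdim N (tgt a))) :
  'rV[k]_(c1dim M N) := \mxrow_a mxvec (f a).
Lemma pk1K M N f a : comp1 (@pk1 M N f) a = f a.
Proof. by rewrite /comp1 /pk1 mxrowK mxvecK. Qed.
Lemma comp1K M N (c : 'rV[k]_(c1dim M N)) : pk1 (comp1 c) = c.
Proof.
rewrite /pk1 -[RHS]submxrowK; apply: eq_mxrow => i; by rewrite /comp1 vec_mxK.
Qed.
Lemma comp1_inj M N (c c' : 'rV[k]_(c1dim M N)) :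
  (forall i, comp1 c i = comp1 c' i) -> c = c'.
Proof.
move=> h; rewrite -[c]comp1K -[c']comp1K; apply: eq_mxrow => i; by rewrite h.
Qed.
Lemma comp1_lin M N c (u v : 'rV[k]_(c1dim M N)) i :
  comp1 (c *: u + v) i = c *: comp1 u i + comp1 v i.
Proof.
rewrite /comp1 -linearP; congr vec_mx.
by apply/rowP=> j; rewrite !mxE.
Qed.

Lemma mul_cobound M N (c : 'rV[k]_(c0dim M N)) :
  c *m cobound M N =
  pk1 (fun a => comp0 c (src a) *m rmap N a - rmap M a *m comp0 c (tgt a)).
Proof.
apply: (@mul_rV_linear _ _ _ (fun c => pk1 (fun a =>
  comp0 c (src a) *m rmap N a - rmap M a *m comp0 c (tgt a)))) => b u v.
apply: comp1_inj => a; rewrite comp1_lin !pk1K.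
rewrite !comp0_lin mulmxDl mulmxDr -scalemxAl -scalemxAr scalerBr.
by rewrite opprD addrACA.
Qed.

(* dim Hom(M, N); below [ed] is dim Ext^1(M, N). *)
Definition hd M N : nat := \rank (kermx (cobound M N)).
Notation ed := ext1_dim.

Lemma comp1_0 M N a : comp1 (0 : 'rV[k]_(c1dim M N)) a = 0.
Proof. by rewrite /comp1 submxrow0 linear0. Qed.

Lemma hom_kermx M N (f : gm M N) : (pk f <= kermx (cobound M N))%MS <-> hom f.
Proof.
split=> [/sub_kermxP|hf].
  rewrite mul_cobound => h a; have := comp1_0 M N a.
  by rewrite -h pk1K !pkK => /eqP; rewrite subr_eq0 => /eqP.
apply/sub_kermxP; rewrite mul_cobound; apply: comp1_inj => a.
by rewrite pk1K !pkK hf subrr comp1_0.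
Qed.

Lemma hom_comp0 M N (c : 'rV[k]_(c0dim M N)) :
  (c <= kermx (cobound M N))%MS <-> hom (comp0 c).
Proof. by rewrite -{1}[c]comp0K hom_kermx. Qed.

Lemma pk_eq0 M N (f : gm M N) : pk f = 0 <-> forall i, f i = 0.
Proof.
split=> [h i|h]; first by rewrite -(pkK f) h /comp0 submxrow0 linear0.
by apply: comp0_inj => i; rewrite pkK h /comp0 submxrow0 linear0.
Qed.

Lemma hd_le_inj M N M' N' (F : gm M N -> gm M' N') :
  (forall c f g h, (forall i, h i = c *: f i + g i) ->
     forall i, F h i = c *: F f i + F g i) ->
  (forall f, hom f -> hom (F f)) ->
  (forall f, hom f -> (forall i, F f i = 0) -> forall i, f i = 0) ->
  (hd M N <= hd M' N')%N.
Proof.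
move=> Flin Fhom Finj.
apply: (@rank_le_inj _ _ _ _ _ _ _ (fun c => pk (F (comp0 c)))).
- exact: pk_linear.
- by move=> u /hom_comp0 hu; apply/hom_kermx/Fhom.
by move=> u /hom_comp0 hu /pk_eq0 /(Finj _ hu) e; rewrite -[u]comp0K; apply/pk_eq0.
Qed.

Lemma hd_exact M1 N1 M2 N2 M3 N3 (F : gm M1 N1 -> gm M2 N2) (G : gm M2 N2 -> gm M3 N3) :
  (forall c f g h, (forall i, h i = c *: f i + g i) ->
     forall i, F h i = c *: F f i + F g i) ->
  (forall c f g h, (forall i, h i = c *: f i + g i) ->
     forall i, G h i = c *: G f i + G g i) ->
  (forall f, hom f -> (forall i, F f i = 0) -> forall i, f i = 0) ->
  (forall f, hom f -> hom (F f)) ->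
  (forall f, hom f -> hom (G f)) ->
  (forall f i, hom f -> G (F f) i = 0) ->
  (forall g, hom g -> (forall i, G g i = 0) ->
     exists2 f, hom f & forall i, g i = F f i) ->
  (hd M2 N2 <= hd M1 N1 + hd M3 N3)%N /\
  ((hd M1 N1 + hd M3 N3 <= hd M2 N2)%N <->
    forall h, hom h -> exists2 g, hom g & forall i, G g i = h i).
Proof.
move=> Flin Glin Finj Fhom Ghom GF ex.
have Fext f g : (forall i, f i = g i) -> forall i, F f i = F g i.
  move=> e i; rewrite (Flin 0 f g f); first by rewrite scale0r add0r.
  by move=> j; rewrite scale0r add0r e.
have Gext f g : (forall i, f i = g i) -> forall i, G f i = G g i.
  move=> e i; rewrite (Glin 0 f g f); first by rewrite scale0r add0r.
  by move=> j; rewrite scale0r add0r e.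
have [||||||h1 h2] := @rank_exact _ _ _ _ _ _ _ (kermx (cobound M1 N1)) (kermx (cobound M2 N2))
  (kermx (cobound M3 N3)) (fun c => pk (F (comp0 c))) (fun c => pk (G (comp0 c))).
- exact: pk_linear.
- exact: pk_linear.
- by move=> u /hom_comp0 hu /pk_eq0 /(Finj _ hu) e; rewrite -[u]comp0K; apply/pk_eq0.
- by move=> v /hom_comp0 hv; apply/hom_kermx/Ghom.
- move=> u /hom_comp0 hu; split; first exact/hom_kermx/Fhom.
  apply/pk_eq0 => i; rewrite -[RHS](GF _ i hu); apply: Gext => j; exact: pkK.
- move=> v /hom_comp0 hv /pk_eq0 /(ex _ hv)[f hf e]; exists (pk f); first exact/hom_kermx.
  apply: comp0_inj => i; rewrite pkK e; apply: Fext => j; by rewrite pkK.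
split=> //; rewrite h2; split=> [h w hw|h w /hom_comp0 hw].
  have [v vK e] := h _ (proj2 (hom_kermx w) hw).
  by exists (comp0 v); [exact/hom_comp0 | move=> i; rewrite -(pkK w) -e pkK].
have [g hg e] := h _ hw; exists (pk g); first exact/hom_kermx.
apply: comp0_inj => i; rewrite pkK -e; apply: Gext => j; by rewrite pkK.
Qed.

(** Both sides are the index of [cobound]: kernel minus cokernel, or source minus target. *)
Lemma hd_ed M N : (hd M N)%:Z - (ed M N)%:Z = euler (dimvec M) (dimvec N).
Proof.
rewrite /hd /ext1_dim mxrank_ker mxrank_coker.
have r0 := rank_leq_row (cobound M N); have r1 := rank_leq_col (cobound M N).
rewrite /euler /dimvec.
have -> : \sum_i (rdim M i)%:Z * (rdim N i)%:Z = (c0dim M N)%:Z.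
  by rewrite /c0dim (big_morph Posz PoszD (erefl _)).
have -> : \sum_a (rdim M (src a))%:Z * (rdim N (tgt a))%:Z = (c1dim M N)%:Z.
  by rewrite /c1dim (big_morph Posz PoszD (erefl _)).
lia.
Qed.

End Hom.
Notation ed := ext1_dim.

(** * Kernels, cokernels, short exact sequences, indecomposables *)

Section Abelian.
Variables (k : finFieldType) (Q : quiver).
Implicit Types M N L X Y A B C K : rep k Q.

(** [pinvmx (p i)] is a linear section of [p i]. The inclusion of kernels makes the result
    independent of the section, and cancelling the epimorphism [p] makes it a homomorphism. *)
Lemma fac_epi B C X (p : gm B C) (h : gm B X) :
  epi p -> hom h -> (forall i, (kermx (p i) <= kermx (h i))%MS) ->
  exists2 h' : gm C X, hom h' & forall i, h i = p i *m h' i.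
Proof.
move=> [hp fp] hh sub; pose h' : gm C X := fun i => pinvmx (p i) *m h i.
have e i : h i = p i *m h' i.
  apply/eqP; rewrite -subr_eq0 /h' mulmxA -{1}[h i]mul1mx -mulmxBl; apply/eqP.
  apply/sub_kermxP; apply: submx_trans (sub i); apply/sub_kermxP.
  by rewrite mulmxBl mul1mx -mulmxA mulVpmx // mulmx1 subrr.
exists h' => // a; apply: (row_full_inj (fp (src a))).
by rewrite mulmxA -hp -mulmxA -e mulmxA -e hh.
Qed.

Lemma fac_mono A B X (j : gm A B) (h : gm X B) :
  mono j -> hom h -> (forall i, (h i <= j i)%MS) ->
  exists2 h' : gm X A, hom h' & forall i, h i = h' i *m j i.
Proof.
move=> [hj fj] hh sub; pose h' : gm X A := fun i => h i *m pinvmx (j i).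
have e i : h i = h' i *m j i by rewrite /h' mulmxKpV.
exists h' => // a; apply: (row_free_inj (fj (tgt a))).
by rewrite /= -mulmxA -e hh -mulmxA hj mulmxA -e.
Qed.

Definition stab M (U : forall i, 'M[k]_(rdim M i)) : Prop :=
  forall a, (U (src a) *m rmap M a <= U (tgt a))%MS.

Definition sub_inc M (U : forall i, 'M[k]_(rdim M i)) : gm (subrep U) M :=
  fun i => row_base (U i).
Definition quo_proj M (U : forall i, 'M[k]_(rdim M i)) : gm M (quorep U) :=
  fun i => col_base (cokermx (U i)).

Lemma sub_inc_mono M (U : forall i, 'M[k]_(rdim M i)) : stab U -> mono (sub_inc U).
Proof.
move=> sU; split=> [a|i]; last exact: row_base_free.
rewrite /= /sub_inc mulmxKpV // (eqmxMr _ (eq_row_base _)).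
by apply: submx_trans (sU a) _; rewrite eq_row_base.
Qed.

Lemma quo_projK M (U : forall i, 'M[k]_(rdim M i)) i :
  (kermx (quo_proj U i) :=: U i)%MS.
Proof.
apply/eqmxP/andP; split.
  rewrite submxE -[cokermx _]mulmx_base mulmxA.
  by have /sub_kermxP -> := submx_refl (kermx (quo_proj U i)); rewrite mul0mx.
apply/sub_kermxP; apply: (row_free_inj (row_base_free (cokermx (U i)))) => /=.
by rewrite -mulmxA mulmx_base mulmx_coker mul0mx.
Qed.

Lemma quo_proj_epi M (U : forall i, 'M[k]_(rdim M i)) : stab U -> epi (quo_proj U).
Proof.
move=> sU; split=> [a|i]; last exact: col_base_full.
pose D := 1%:M - quo_proj U (src a) *m pinvmx (quo_proj U (src a)).
have DU : (D <= U (src a))%MS.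
  rewrite -(quo_projK U (src a)); apply/sub_kermxP.
  by rewrite mulmxBl mul1mx -mulmxA mulVpmx ?col_base_full // mulmx1 subrr.
have /sub_kermxP : (D *m rmap M a <= kermx (quo_proj U (tgt a)))%MS.
  by rewrite quo_projK; apply: submx_trans (submxMr _ DU) (sU a).
by rewrite /D !mulmxBl mul1mx => /eqP; rewrite subr_eq0 => /eqP ->; rewrite /= !mulmxA.
Qed.

Lemma stab_ker M N (f : gm M N) : hom f -> stab (fun i => kermx (f i)).
Proof. by move=> hf a; apply/sub_kermxP; rewrite -mulmxA hf mulmxA mulmx_ker mul0mx. Qed.

Lemma stab_img M N (f : gm M N) : hom f -> stab (fun i => <<f i>>%MS).
Proof.
move=> hf a; rewrite (eqmxMr _ (genmxE _)) genmxE -hf; exact: submxMl.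
Qed.

Lemma ker_ex M N (f : gm M N) : hom f ->
  exists K (j : gm K M), mono j /\ forall i, (j i :=: kermx (f i))%MS.
Proof.
move=> hf; exists (subrep (fun i => kermx (f i))), (sub_inc _); split.
  exact/sub_inc_mono/stab_ker.
by move=> i; apply: eq_row_base.
Qed.

Lemma cok_ex M N (f : gm M N) : hom f ->
  exists C (p : gm N C), epi p /\ forall i, (f i :=: kermx (p i))%MS.
Proof.
move=> hf; exists (quorep (fun i => <<f i>>%MS)), (quo_proj _); split; first exact/quo_proj_epi/stab_img.
move=> i; apply: eqmx_sym; exact: eqmx_trans (quo_projK _ _) (genmxE _).
Qed.

Lemma img_ex M N (f : gm M N) : hom f ->
  exists I (p : gm M I) (j : gm I N),
    [/\ epi p, mono j & forall i, f i = p i *m j i].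
Proof.
move=> hf; set U := fun i => <<f i>>%MS.
have mj := sub_inc_mono (stab_img hf).
have [|p hp e] := fac_mono mj hf.
  by move=> i; rewrite eq_row_base genmxE.
exists (subrep U), p, (sub_inc U); split=> //; split=> // i.
by rewrite /row_full -(mxrankMfree _ (mj.2 i)) -e /= genmxE.
Qed.

Definition ses A B C (f : gm A B) (g : gm B C) : Prop :=
  [/\ mono f, epi g & forall i, (f i :=: kermx (g i))%MS].

Lemma ses_comp0 A B C (f : gm A B) (g : gm B C) i : ses f g -> f i *m g i = 0.
Proof. by case=> _ _ e; apply/sub_kermxP; rewrite e. Qed.

Lemma ses_dim A B C (f : gm A B) (g : gm B C) i : ses f g ->
  rdim B i = (rdim A i + rdim C i)%N.
Proof.
case=> [[_ /(_ i) /eqP mf] [_ /(_ i) /eqP eg] e].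
rewrite -mf (e i) mxrank_ker eg subnK // -eg; exact: rank_leq_row.
Qed.

Lemma ker_epi_ses M N (p : gm M N) : epi p -> exists K (j : gm K M), ses j p.
Proof. by move=> ep; have [K [j [mj e]]] := ker_ex ep.1; exists K, j. Qed.

Lemma cok_mono_ses M N (j : gm M N) : mono j -> exists C (p : gm N C), ses j p.
Proof. by move=> mj; have [C [p [ep e]]] := cok_ex mj.1; exists C, p. Qed.

(** Left exactness of Hom(X, -). It is stated for any homomorphism [g], since [bongartz] applies it
    to a map not known to be onto. *)
Lemma hd_lift X K B M (j : gm K B) (g : gm B M) :
  mono j -> hom g -> (forall i, (j i :=: kermx (g i))%MS) ->
  (hd X B <= hd X K + hd X M)%N /\
  ((hd X K + hd X M <= hd X B)%N <->
    forall h : gm X M, hom h -> exists2 h' : gm X B, hom h' & forall i, h' i *m g i = h i).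
Proof.
move=> mj hg e; apply: (@hd_exact _ _ _ _ _ _ _ _ (fun f => gcomp f j) (fun f => gcomp f g)).
- by move=> c f f' h eh i; rewrite /gcomp eh mulmxDl scalemxAl.
- by move=> c f f' h eh i; rewrite /gcomp eh mulmxDl scalemxAl.
- move=> f hf f0 i; apply: (row_free_inj (mj.2 i)); by rewrite /= -/(gcomp f j i) f0 mul0mx.
- by move=> f hf; apply: hom_comp mj.1.
- by move=> f hf; apply: hom_comp hg.
- move=> f i hf; rewrite /gcomp -mulmxA; have /sub_kermxP -> : (j i <= kermx (g i))%MS by rewrite e.
  by rewrite mulmx0.
move=> f hf f0; have [|h hh eh] := fac_mono mj hf; last by exists h.
by move=> i; rewrite e; apply/sub_kermxP/f0.
Qed.

Lemma hd_extend X A B C (f : gm A B) (p : gm B C) :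
  hom f -> epi p -> (forall i, (f i :=: kermx (p i))%MS) ->
  (hd B X <= hd C X + hd A X)%N /\
  ((hd C X + hd A X <= hd B X)%N <->
    forall h : gm A X, hom h -> exists2 h' : gm B X, hom h' & forall i, f i *m h' i = h i).
Proof.
move=> hf ep e; apply: (@hd_exact _ _ _ _ _ _ _ _ (fun g => gcomp p g) (fun g => gcomp f g)).
- by move=> c g g' h eh i; rewrite /gcomp eh mulmxDr -scalemxAr.
- by move=> c g g' h eh i; rewrite /gcomp eh mulmxDr -scalemxAr.
- move=> g hg g0 i; apply: (row_full_inj (ep.2 i)); by rewrite /= -/(gcomp p g i) g0 mulmx0.
- by move=> g hg; apply: hom_comp ep.1 hg.
- by move=> g hg; apply: hom_comp hf hg.
- move=> g i hg; rewrite /gcomp mulmxA; have /sub_kermxP -> : (f i <= kermx (p i))%MS by rewrite e.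
  by rewrite mul0mx.
move=> g hg g0; have [|h hh eh] := fac_epi ep hg; last by exists h.
by move=> i; rewrite -e; apply/sub_kermxP/g0.
Qed.

Lemma hd_mono X A B (j : gm A B) : mono j -> (hd X A <= hd X B)%N.
Proof.
move=> mj; apply: (@hd_le_inj _ _ _ _ _ _ (fun f => gcomp f j)).
- by move=> c f f' h eh i; rewrite /gcomp eh mulmxDl scalemxAl.
- by move=> f hf; apply: hom_comp mj.1.
- move=> f hf f0 i; apply: (row_free_inj (mj.2 i)); by rewrite /= -/(gcomp f j i) f0 mul0mx.
Qed.

Lemma hd_epi X B C (p : gm B C) : epi p -> (hd C X <= hd B X)%N.
Proof.
move=> ep; apply: (@hd_le_inj _ _ _ _ _ _ (fun f => gcomp p f)).
- by move=> c g g' h eh i; rewrite /gcomp eh mulmxDr -scalemxAr.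
- by move=> g hg; apply: hom_comp ep.1 hg.
- move=> g hg g0 i; apply: (row_full_inj (ep.2 i)); by rewrite /= -/(gcomp p g i) g0 mulmx0.
Qed.

Lemma hd_eq0 M N : hd M N = 0%N <-> forall f : gm M N, hom f -> forall i, f i = 0.
Proof.
rewrite /hd; split=> [/eqP|h].
  rewrite mxrank_eq0 => /eqP e f /hom_kermx; rewrite e submx0 => /eqP; exact: (pk_eq0 f).1.
apply/eqP; rewrite mxrank_eq0 -submx0; apply/rV_subP=> v /hom_comp0 /h e.
by rewrite -[v]comp0K (pk_eq0 _).2 // sub0mx.
Qed.

Lemma hd_neq0 M N : hd M N <> 0%N ->
  exists2 f : gm M N, hom f & exists i, f i <> 0.
Proof.
move=> h; apply: NNPP => n; apply/h/hd_eq0 => f hf i; apply: NNPP => fi.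
by apply: n; exists f => //; exists i.
Qed.

Lemma hd_pos M N (f : gm M N) i : hom f -> f i <> 0 -> hd M N <> 0%N.
Proof. by move=> hf fi /hd_eq0 /(_ f hf i). Qed.

Lemma is0_mx M N (f : gm M N) i : rep_is0 M -> f i = 0.
Proof. by move=> z; apply/matrixP=> -[x hx]; exfalso; move: hx; rewrite z. Qed.
Lemma is0_mxr M N (f : gm M N) i : rep_is0 N -> f i = 0.
Proof. by move=> z; apply/matrixP=> x -[y hy]; exfalso; move: hy; rewrite z. Qed.

Lemma hd_is0r M N : rep_is0 N -> hd M N = 0%N.
Proof. by move=> z; apply/hd_eq0 => f _ i; apply: is0_mxr. Qed.

Lemma one_eq0 n : (1%:M : 'M[k]_n) = 0 -> n = 0%N.
Proof.
case: n => // n /matrixP /(_ 0 0); rewrite !mxE eqxx => /eqP.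
by rewrite oner_eq0.
Qed.

Lemma hd_id_eq0 M : hd M M = 0%N -> rep_is0 M.
Proof. by move/hd_eq0=> /(_ _ (@hom_id _ _ M)) h i; apply: one_eq0 (h i). Qed.

Lemma not_is0 M : ~ rep_is0 M -> exists i, rdim M i <> 0%N.
Proof. by move=> h; apply: NNPP => n; apply: h => i; apply: NNPP => m; apply: n; exists i. Qed.

Definition iso M N := exists f : gm M N, mono f /\ epi f.

Lemma inv_ex M N (f : gm M N) : mono f -> epi f ->
  exists2 g : gm N M, hom g &
    (forall i, f i *m g i = 1%:M) /\ (forall i, g i *m f i = 1%:M).
Proof.
move=> mf ef; have [|g hg e] := fac_mono mf (@hom_id _ _ N).
  by move=> i; apply: submx_full; apply: ef.2.
exists g => //; split=> i; last by rewrite -e.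
by apply: (row_free_inj (mf.2 i)); rewrite /= -mulmxA -e mul1mx mulmx1.
Qed.

Lemma inv_mono_epi M N (f : gm M N) (g : gm N M) : hom f ->
    (forall i, f i *m g i = 1%:M) -> (forall i, g i *m f i = 1%:M) -> mono f /\ epi f.
Proof.
move=> hf e1 e2; split; split=> // i; first by apply/row_freeP; exists (g i).
by apply/row_fullP; exists (g i).
Qed.

Lemma iso_sym M N : iso M N -> iso N M.
Proof.
case=> f [mf ef]; have [g hg [e1 e2]] := inv_ex mf ef.
exists g; exact: inv_mono_epi hg e2 e1.
Qed.
Lemma iso_trans M N L : iso M N -> iso N L -> iso M L.
Proof.
case=> f [mf ef] [g [mg eg]]; exists (gcomp f g).
by split; [exact: mono_comp | exact: epi_comp].
Qed.
Lemma iso_dim M N : iso M N -> rdim M =1 rdim N.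
Proof.
case=> f [[_ mf] [_ ef]] i; have /eqP e1 := mf i; have /eqP e2 := ef i.
exact: etrans (esym e1) e2.
Qed.
Lemma iso_hdl M N X : iso M N -> hd M X = hd N X.
Proof.
move=> i; apply/eqP; rewrite eqn_leq; have [f [mf ef]] := i.
have [g [mg eg]] := iso_sym i; by rewrite (hd_epi _ ef) (hd_epi _ eg).
Qed.
Lemma iso_hdr M N X : iso M N -> hd X M = hd X N.
Proof.
move=> i; apply/eqP; rewrite eqn_leq; have [f [mf ef]] := i.
have [g [mg eg]] := iso_sym i; by rewrite (hd_mono _ mf) (hd_mono _ mg).
Qed.

Lemma mono_dim M N (f : gm M N) i : mono f -> (rdim M i <= rdim N i)%N.
Proof. by case=> _ /(_ i) /eqP <-; apply: rank_leq_col. Qed.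
Lemma epi_dim M N (f : gm M N) i : epi f -> (rdim N i <= rdim M i)%N.
Proof. by case=> _ /(_ i) /eqP <-; apply: rank_leq_row. Qed.
Lemma mono_dim_epi M N (f : gm M N) : mono f -> (forall i, rdim N i <= rdim M i)%N -> epi f.
Proof.
move=> [hf mf] h; split=> // i; rewrite /row_full; have /eqP -> := mf i.
by rewrite eqn_leq h (mono_dim _ (conj hf mf)).
Qed.
Lemma epi_dim_mono M N (f : gm M N) : epi f -> (forall i, rdim M i <= rdim N i)%N -> mono f.
Proof.
move=> [hf mf] h; split=> // i; rewrite /row_free; have /eqP -> := mf i.
by rewrite eqn_leq h (epi_dim _ (conj hf mf)).
Qed.

Lemma ext_iso M N (f g : gm M N) : (forall i, f i = g i) -> hom f -> hom g.
Proof. by move=> e hf a; rewrite -!e. Qed.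

Definition fam M N (f : gmap M N) : gm M N := fun i => f i.
Definition unfam M N (f : gm M N) : gmap M N := [ffun i => f i].
Lemma unfamE M N (f : gm M N) i : unfam f i = f i.
Proof. exact: ffunE. Qed.

Lemma rhomP M N (f : gmap M N) : reflect (hom (fam f)) (f \in rhom M N).
Proof.
rewrite inE; apply: (iffP forallP) => h a; first exact/eqP/h.
exact/eqP/h.
Qed.
Lemma rmonoP M N (f : gmap M N) : reflect (mono (fam f)) (rmono f).
Proof.
apply: (iffP andP) => [[/rhomP hf /forallP rf]|[hf rf]] //.
by split; [exact/rhomP | exact/forallP].
Qed.
Lemma repiP M N (f : gmap M N) : reflect (epi (fam f)) (repi f).
Proof.
apply: (iffP andP) => [[/rhomP hf /forallP rf]|[hf rf]] //.
by split; [exact/rhomP | exact/forallP].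
Qed.
Lemma unfam_hom M N (f : gm M N) : hom f -> hom (fam (unfam f)).
Proof. by apply: ext_iso => i; rewrite /fam unfamE. Qed.
Lemma unfam_mono M N (f : gm M N) : mono f -> mono (fam (unfam f)).
Proof. by case=> hf rf; split=> [|i]; [exact: unfam_hom | rewrite /fam unfamE]. Qed.
Lemma unfam_epi M N (f : gm M N) : epi f -> epi (fam (unfam f)).
Proof. by case=> hf rf; split=> [|i]; [exact: unfam_hom | rewrite /fam unfamE]. Qed.

Lemma risoP M N : reflect (iso M N) (riso M N).
Proof.
apply: (iffP existsP) => [[f /andP[/rmonoP mf /repiP ef]]|[f [mf ef]]].
  by exists (fam f).
exists (unfam f); apply/andP; split; first exact/rmonoP/unfam_mono.
exact/repiP/unfam_epi.
Qed.

Lemma short_exactP L M N : short_exact L M N <-> exists f g, @ses L M N f g.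
Proof.
split=> [[f [g [/rmonoP mf /repiP eg e]]]|[f [g [mf eg e]]]].
  by exists (fam f), (fam g); split=> // i; apply/eqmxP.
exists (unfam f), (unfam g); split; [exact/rmonoP/unfam_mono | exact/repiP/unfam_epi |].
by move=> i; rewrite !unfamE; apply/eqmxP.
Qed.

Definition inl M N : gm M (rsum M N) := fun i => row_mx 1%:M 0.
Definition inr M N : gm N (rsum M N) := fun i => row_mx 0 1%:M.
Definition prl M N : gm (rsum M N) M := fun i => col_mx 1%:M 0.
Definition prr M N : gm (rsum M N) N := fun i => col_mx 0 1%:M.
Definition rin X M N (f : gm X M) (g : gm X N) : gm X (rsum M N) :=
  fun i => row_mx (f i) (g i).
Definition rout X M N (f : gm M X) (g : gm N X) : gm (rsum M N) X :=
  fun i => col_mx (f i) (g i).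

Lemma hom_rin X M N (f : gm X M) (g : gm X N) : hom f -> hom g -> hom (rin f g).
Proof.
move=> hf hg a; rewrite /rin /= mul_mx_row mul_row_block !mulmx0 addr0 add0r.
by rewrite hf hg.
Qed.
Lemma hom_rout X M N (f : gm M X) (g : gm N X) : hom f -> hom g -> hom (rout f g).
Proof.
move=> hf hg a; rewrite /rout /= mul_block_col mul_col_mx !mul0mx addr0 add0r.
by rewrite hf hg.
Qed.
Lemma hom_inl M N : hom (@inl M N).
Proof. exact: (hom_rin (@hom_id _ _ M) (@hom0 _ _ M N)). Qed.
Lemma hom_inr M N : hom (@inr M N).
Proof. exact: (hom_rin (@hom0 _ _ N M) (@hom_id _ _ N)). Qed.
Lemma hom_prl M N : hom (@prl M N).
Proof. exact: (hom_rout (@hom_id _ _ M) (@hom0 _ _ N M)). Qed.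
Lemma hom_prr M N : hom (@prr M N).
Proof. exact: (hom_rout (@hom0 _ _ M N) (@hom_id _ _ N)). Qed.
Lemma inl_prl M N i : @inl M N i *m @prl M N i = 1%:M.
Proof. by rewrite mul_row_col mul1mx mul0mx addr0. Qed.
Lemma inr_prr M N i : @inr M N i *m @prr M N i = 1%:M.
Proof. by rewrite mul_row_col mul1mx mul0mx add0r. Qed.
Lemma inl_prr M N i : @inl M N i *m @prr M N i = 0.
Proof. by rewrite mul_row_col mul0mx mulmx0 addr0. Qed.
Lemma inr_prl M N i : @inr M N i *m @prl M N i = 0.
Proof. by rewrite mul_row_col mul0mx mulmx0 addr0. Qed.
Lemma pr_in M N i : @prl M N i *m @inl M N i + @prr M N i *m @inr M N i = 1%:M.
Proof.
rewrite !mul_col_row !mul0mx !mulmx0 !mul1mx add_block_mx !addr0 !add0r.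
by rewrite -scalar_mx_block.
Qed.
Lemma mono_inl M N : mono (@inl M N).
Proof. split; [exact: hom_inl | move=> i; apply/row_freeP; exists (@prl M N i); exact: inl_prl]. Qed.
Lemma mono_inr M N : mono (@inr M N).
Proof. split; [exact: hom_inr | move=> i; apply/row_freeP; exists (@prr M N i); exact: inr_prr]. Qed.
Lemma epi_prl M N : epi (@prl M N).
Proof. split; [exact: hom_prl | move=> i; apply/row_fullP; exists (@inl M N i); exact: inl_prl]. Qed.
Lemma epi_prr M N : epi (@prr M N).
Proof. split; [exact: hom_prr | move=> i; apply/row_fullP; exists (@inr M N i); exact: inr_prr]. Qed.

Lemma ses_inl M N : ses (@inl M N) (@prr M N).
Proof.
split; [exact: mono_inl | exact: epi_prr | move=> i; apply/eqmxP/andP; split].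
  by apply/sub_kermxP; rewrite inl_prr.
rewrite -[X in (X <= _)%MS]mulmx1 -(pr_in M N i) mulmxDr !mulmxA mulmx_ker mul0mx addr0.
exact: submxMl.
Qed.
Lemma ses_inr M N : ses (@inr M N) (@prl M N).
Proof.
split; [exact: mono_inr | exact: epi_prl | move=> i; apply/eqmxP/andP; split].
  by apply/sub_kermxP; rewrite inr_prl.
rewrite -[X in (X <= _)%MS]mulmx1 -(pr_in M N i) mulmxDr !mulmxA mulmx_ker mul0mx add0r.
exact: submxMl.
Qed.

Lemma rin_ex X M N (t : gm X (rsum M N)) : hom t ->
  exists (f : gm X M) (g : gm X N), [/\ hom f, hom g & forall i, t i = row_mx (f i) (g i)].
Proof.
move=> ht; exists (gcomp t (@prl M N)), (gcomp t (@prr M N)); split.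
- exact: hom_comp ht (hom_prl _ _).
- exact: hom_comp ht (hom_prr _ _).
move=> i; rewrite /gcomp -(hsubmxK (t i)).
by rewrite !mul_row_col !mulmx1 !mulmx0 addr0 add0r.
Qed.
Lemma rout_ex X M N (t : gm (rsum M N) X) : hom t ->
  exists (f : gm M X) (g : gm N X), [/\ hom f, hom g & forall i, t i = col_mx (f i) (g i)].
Proof.
move=> ht; exists (gcomp (@inl M N) t), (gcomp (@inr M N) t); split.
- exact: hom_comp (hom_inl _ _) ht.
- exact: hom_comp (hom_inr _ _) ht.
move=> i; rewrite /gcomp -(vsubmxK (t i)).
by rewrite !mul_row_col !mul1mx !mul0mx addr0 add0r.
Qed.

Lemma hd_rsumr X M N : hd X (rsum M N) = (hd X M + hd X N)%N.
Proof.
have [m e z] := ses_inl M N; have [h1 h2] := hd_lift X m e.1 z.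
apply/eqP; rewrite eqn_leq h1; apply/h2 => h hh; exists (gcomp h (@inr M N)).
  exact: hom_comp hh (hom_inr _ _).
by move=> i; rewrite /gcomp -mulmxA inr_prr mulmx1.
Qed.
Lemma hd_rsuml X M N : hd (rsum M N) X = (hd M X + hd N X)%N.
Proof.
have [m e z] := ses_inl M N; have [h1 h2] := hd_extend X m.1 e z.
apply/eqP; rewrite addnC eqn_leq h1; apply/h2 => h hh; exists (gcomp (@prl M N) h).
  exact: hom_comp (hom_prl _ _) hh.
by move=> i; rewrite /gcomp mulmxA inl_prl mul1mx.
Qed.

Lemma split_retract A B C (f : gm A B) (g : gm B C) (r : gm B A) :
  ses f g -> hom r -> (forall i, f i *m r i = 1%:M) -> iso B (rsum A C).
Proof.
move=> s hr e; have [mf eg ez] := s; exists (rin r g).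
have hh : hom (rin r g) by apply: hom_rin eg.1.
have m : mono (rin r g).
  split=> // i; rewrite -kermx_eq0 -submx0; apply/rV_subP=> v /sub_kermxP.
  rewrite mul_mx_row => /eqP; rewrite row_mx_eq0 => /andP[/eqP v1 /eqP v2].
  have : (v <= f i)%MS by rewrite ez; apply/sub_kermxP.
  by case/submxP=> w ew; move: v1; rewrite ew -mulmxA e mulmx1 => ->; rewrite mul0mx sub0mx.
by split=> //; apply: mono_dim_epi => // i; rewrite (ses_dim i s).
Qed.

Lemma split_section A B C (f : gm A B) (g : gm B C) (s : gm C B) :
  ses f g -> hom s -> (forall i, s i *m g i = 1%:M) -> iso B (rsum A C).
Proof.
move=> z hs e; have [mf eg ez] := z; apply: iso_sym; exists (rout f s).
have hh : hom (rout f s) by apply: hom_rout mf.1 _.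
have m : mono (rout f s).
  split=> // i; rewrite -kermx_eq0 -submx0; apply/rV_subP=> v /sub_kermxP.
  rewrite -[v]hsubmxK mul_row_col => h.
  have : (lsubmx v *m f i + rsubmx v *m s i) *m g i = 0 by rewrite h mul0mx.
  rewrite mulmxDl -!mulmxA e mulmx1 (ses_comp0 i z) mulmx0 add0r => r0.
  have : lsubmx v *m f i = 0 *m f i by move: h; rewrite r0 !mul0mx addr0.
  by move/(row_free_inj (mf.2 i)) => ->; rewrite r0 row_mx0 sub0mx.
by split=> //; apply: mono_dim_epi => // i; rewrite (ses_dim i z).
Qed.

Lemma rsumC M N : iso (rsum M N) (rsum N M).
Proof. exact: split_retract (ses_inr M N) (hom_prr M N) (@inr_prr M N). Qed.

(** An idempotent splits [M] into its kernel and its image, and one of these summands vanishes. *)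
Lemma indec_idem M (e : gm M M) : indecomposable M -> hom e ->
  (forall i, e i *m e i = e i) -> (forall i, e i = 0) \/ (forall i, e i = 1%:M).
Proof.
move=> [_ ind] he ee.
have [I [p [j [ep mj E]]]] := img_ex he.
have [K [j' [mj' E']]] := ker_ex he.
have z : ses j' p.
  split=> // i; apply: eqmx_trans (E' i) _; apply/eqmxP/andP; split; apply/sub_kermxP.
    apply: (row_free_inj (mj.2 i)); rewrite /= mul0mx -mulmxA -E; exact: mulmx_ker.
  by rewrite E mulmxA mulmx_ker mul0mx.
have jp i : j i *m p i = 1%:M.
  apply: (row_full_inj (ep.2 i)); apply: (row_free_inj (mj.2 i)).
  by rewrite /= mulmx1 -!mulmxA -E mulmxA -E.
have /risoP/ind[z0|z0] := split_section z mj.1 jp.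
  right=> i; have e' : e i *m (e i - 1%:M) = 0 by rewrite mulmxBr ee mulmx1 subrr.
  have : row_free (e i).
    rewrite -kermx_eq0 -submx0 -(E' i); by rewrite (is0_mx _ _ z0) sub0mx.
  rewrite row_free_unit => ue; apply: (can_inj (mulKmx ue)); by rewrite ee mulmx1.
by left=> i; rewrite E (is0_mxr _ _ z0) mul0mx.
Qed.

Lemma indec_rsum M N L : indecomposable M -> iso M (rsum N L) -> rep_is0 N \/ rep_is0 L.
Proof. by move=> [_ h] /risoP/h. Qed.

Lemma not_indec M : ~ rep_is0 M -> ~ indecomposable M ->
  exists N L, [/\ iso M (rsum N L), ~ rep_is0 N & ~ rep_is0 L].
Proof.
move=> nz h; apply: NNPP => n; apply: h; split=> // N L /risoP i.
by apply: NNPP => /not_or_and[a b]; apply: n; exists N, L.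
Qed.

(** [x] stands for the powers of an element of a finite semigroup; such a sequence is eventually
    periodic. *)
Lemma pow_idem (T : finType) (x : nat -> T) (m : T -> T -> T) :
  (forall i j, x (i + j)%N = m (x i) (x j)) ->
  exists2 n, (0 < n)%N & m (x n) (x n) = x n.
Proof.
move=> xm.
have [n [p [p0 e]]] : exists n p, (0 < p)%N /\ x (n + p)%N = x n.
  have : ~~ injectiveb (fun i : 'I_#|T|.+1 => x i).
    by apply/injectiveP => /leq_card; rewrite card_ord ltnn.
  case/injectivePn=> i [j nij e]; have := neq_ltn i j; rewrite -val_eqE in nij *.
  rewrite nij => /esym/orP[l|l].
    by exists i, (j - i)%N; rewrite subn_gt0 l subnKC // ltnW.
  by exists j, (i - j)%N; rewrite subn_gt0 l subnKC // ltnW.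
have per t u : (n <= u)%N -> x (u + t * p)%N = x u.
  elim: t u => [|t IH] u h; first by rewrite mul0n addn0.
  rewrite mulSn addnA IH; last by rewrite (leq_trans h) // leq_addr.
  by rewrite -(subnK h) -addnA xm e -xm.
(* A positive multiple of the period [p] that is at least [n]. *)
exists (n.+1 * p)%N; first by rewrite muln_gt0.
rewrite -xm per // (leq_trans (leqnSn _)) // leq_pmulr //.
Qed.

(** As [k] is finite, some power of [f] is idempotent, hence 0 or 1. If it is 1, [f] is invertible;
    if it is 0, a geometric series inverts [g = 1 - f]. *)
Lemma indec_local M (f g : gm M M) : indecomposable M -> hom f -> hom g ->
  (forall i, f i + g i = 1%:M) ->
  (forall i, f i \in unitmx) \/ (forall i, g i \in unitmx).
Proof.
move=> ind hf hg fg.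
pose pw n : gm M M := fun i => iter n (mulmx (f i)) 1%:M.
have pwD m n i : pw (m + n)%N i = pw m i *m pw n i.
  by elim: m => [|m IH]; rewrite /pw ?mul1mx // addSn /= -/(pw (m + n)%N i) IH mulmxA.
have pwh n : hom (pw n).
  elim: n => [|n IH]; first exact: hom_id.
  by apply: (@hom_comp _ _ _ _ _ f (pw n)).
have [|n n0 e] := @pow_idem _ (fun n => unfam (pw n))
   (fun a b => unfam (gcomp (fam a) (fam b))).
  by move=> i j; apply/ffunP=> l; rewrite !unfamE pwD /gcomp /fam !unfamE.
have ee i : pw n i *m pw n i = pw n i.
  by have /ffunP/(_ i) := e; rewrite !unfamE /gcomp /fam !unfamE.
have [z|o] := indec_idem ind (pwh n) ee.
  right=> i; suff h m : exists b, b *m g i = 1%:M - pw m i.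
    have [b eB] := h n; rewrite z subr0 in eB.
    by rewrite -row_full_unit; apply/row_fullP; exists b.
  elim: m => [|m [b eB]]; first by exists 0; rewrite mul0mx subrr.
  exists (b + pw m i); rewrite mulmxDl eB.
  have -> : g i = 1%:M - f i by rewrite -(fg i) addrC addKr.
  rewrite mulmxBr mulmx1 addrA subrK; congr (_ - _).
  by rewrite -addn1 pwD /pw /= mulmx1.
left=> i; rewrite -row_full_unit; apply/row_fullP; exists (pw n.-1 i).
by rewrite -(o i) -{2}(prednK n0) -addn1 pwD /pw /= mulmx1.
Qed.

End Abelian.

(** * Paths in an acyclic quiver *)

Section Paths.
Variables (Q : quiver).
Implicit Types (i j l : 'I_(nvert Q)) (a b : 'I_(narr Q)) (p q : seq 'I_(narr Q)).

Lemma qpath_cat i p q j :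
  reflect (exists2 l, qpath i p l & qpath l q j) (qpath i (p ++ q) j).
Proof.
elim: p i => [|a p IH] i /=.
  apply: (iffP idP) => [h|[l /eqP ->]] //; by exists i.
apply: (iffP andP) => [[e /IH[l h1 h2]]|[l /andP[e h1] h2]].
  by exists l => //; rewrite e.
by split=> //; apply/IH; exists l.
Qed.

Lemma qpath_rcons i p a j : qpath i (rcons p a) j = qpath i p (src a) && (tgt a == j).
Proof.
rewrite -cats1; apply/qpath_cat/andP => [[l h /= /andP[/eqP e1 e2]]|[h1 h2]].
  by rewrite e1.
by exists (src a) => //=; rewrite eqxx.
Qed.

Lemma qpath_mem_tgt i p j a : qpath i p j -> a \in p ->
  exists2 q, q <> [::] & qpath i q (tgt a).
Proof.
elim: p i => //= b p IH i /andP[e h]; rewrite inE => /predU1P[->|ap].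
  by exists [:: b] => //=; rewrite e eqxx.
by have [q _ hq] := IH _ h ap; exists (b :: q) => //=; rewrite e.
Qed.

Hypothesis acy : acyclic Q.

Lemma qpath_uniq i p j : qpath i p j -> uniq (i :: map (@tgt Q) p).
Proof.
elim: p i => [|a p IH] i h; first by [].
have ap := h; rewrite cons_uniq; apply/andP; split.
  apply/negP => /mapP[b bp e]; have [q nq hq] := qpath_mem_tgt h bp.
  by rewrite -e in hq; apply/nq/(acy hq).
by move: h => /= /andP[_ /IH].
Qed.

Lemma qpath_size i p j : qpath i p j -> (size p < nvert Q)%N.
Proof.
move/qpath_uniq/card_uniqP; rewrite /= size_map => <-.
by apply: leq_trans (max_card _) _; rewrite card_ord.
Qed.

Lemma mem_paths_len n i j p : (p \in paths_len n i j) = (size p == n) && qpath i p j.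
Proof.
elim: n i p => [|n IH] i p /=.
  case: (i =P j) => [->|/eqP/negPf e]; first by case: p => [|a p]; rewrite inE /= ?eqxx.
  by case: p => [|a p] //=; rewrite e.
apply/allpairsPdep/andP => [[a [q [ha hq ->]]]|].
  move: ha hq; rewrite mem_filter IH => /andP[/eqP <- _] /andP[/eqP <- hq] /=.
  by rewrite !eqxx.
case: p => [|a p] [] //= /eqP[sp] /andP[e h]; exists a, p; split=> //.
  by rewrite mem_filter e mem_enum.
by rewrite IH sp eqxx.
Qed.

Lemma uniq_paths_len n i j : uniq (paths_len n i j).
Proof.
elim: n i => [|n IH] i /=; first by case: eqP.
apply: allpairs_uniq_dep => [|a _|[a p] [b q] _ _ /= [-> ->]] //.
by rewrite filter_uniq // enum_uniq.
Qed.

Lemma mem_paths i j p : (p \in paths i j) = qpath i p j.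
Proof.
apply/flatten_mapP/idP => [[n _]|h]; first by rewrite mem_paths_len => /andP[].
exists (size p); last by rewrite mem_paths_len eqxx.
by rewrite mem_iota add0n; apply: qpath_size h.
Qed.

Lemma uniq_paths i j : uniq (paths i j).
Proof.
rewrite /paths; elim: (iota 0 (nvert Q)) (iota_uniq 0 (nvert Q)) => //= n s IH /andP[ns us].
rewrite cat_uniq uniq_paths_len IH // andbT; apply/hasPn => p /flatten_mapP[m ms].
rewrite !mem_paths_len => /andP[/eqP sp _]; apply/negP => /andP[/eqP e _].
by rewrite -e sp ms in ns.
Qed.

(** Paths sorted by their first arrow: in dimensions this is the radical sequence of [projrep i],
    used in [euler_cox]. The count by the last arrow is used in [euler_projrep]. *)
Lemma size_paths_first i j :
  size (paths i j) = ((i == j) + \sum_(a | src a == i) size (paths (tgt a) j))%N.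
Proof.
set s2 := [seq a :: p | a <- [seq a <- enum 'I_(narr Q) | src a == i], p <- paths (tgt a) j].
have /perm_size -> : perm_eq (paths i j) ((if i == j then [:: [::]] else [::]) ++ s2).
  apply: uniq_perm; first exact: uniq_paths.
    rewrite cat_uniq; apply/and3P; split; first by case: eqP.
      apply/hasPn => p /allpairsPdep[a [q [_ _ ->]]]; by case: eqP; rewrite ?inE.
    apply: allpairs_uniq_dep => [|a _|[a p] [b q] _ _ /= [-> ->]] //.
      by rewrite filter_uniq // enum_uniq.
    exact: uniq_paths.
  move=> p; rewrite mem_paths mem_cat; case: p => [|a p] /=.
    rewrite -[LHS]orbF; congr orb; first by case: eqP.
    by apply/esym/negP => /allpairsPdep[a [q [_ _]]].
  have -> : a :: p \in (if i == j then [:: [::]] else [::]) = false.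
    by case: eqP; rewrite ?inE.
  apply/andP/allpairsPdep => [[e h]|[b [q [hb hq [-> ->]]]]].
    by exists a, p; rewrite mem_filter e mem_enum mem_paths.
  by move: hb hq; rewrite mem_filter mem_paths => /andP[->].
rewrite size_cat size_allpairs_dep sumnE big_map big_filter big_enum_cond /=.
by case: eqP.
Qed.

Lemma size_paths_last i j :
  size (paths i j) = ((i == j) + \sum_(a | tgt a == j) size (paths i (src a)))%N.
Proof.
set s2 := [seq rcons p a | a <- [seq a <- enum 'I_(narr Q) | tgt a == j], p <- paths i (src a)].
have /perm_size -> : perm_eq (paths i j) ((if i == j then [:: [::]] else [::]) ++ s2).
  apply: uniq_perm; first exact: uniq_paths.
    rewrite cat_uniq; apply/and3P; split; first by case: eqP.
      apply/hasPn => p /allpairsPdep[a [q [_ _ ->]]]; case: eqP; rewrite ?inE //.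
      by case: q.
    apply: allpairs_uniq_dep => [|a _|[a p] [b q] _ _ /= /rcons_inj[-> ->]] //.
      by rewrite filter_uniq // enum_uniq.
    exact: uniq_paths.
  move=> p; rewrite mem_paths mem_cat; case/lastP: p => [|p a] /=.
    rewrite -[LHS]orbF; congr orb; first by case: eqP.
    by apply/esym/negP => /allpairsPdep[a [[|? ?] [_ _]]].
  rewrite qpath_rcons.
  have -> : rcons p a \in (if i == j then [:: [::]] else [::]) = false.
    by case: eqP; rewrite ?inE //; case: p.
  apply/andP/allpairsPdep => [[h e]|[b [q [hb hq /rcons_inj[-> ->]]]]].
    by exists a, p; rewrite mem_filter e mem_enum mem_paths.
  by move: hb hq; rewrite mem_filter mem_paths => /andP[->].
rewrite size_cat size_allpairs_dep sumnE big_map big_filter big_enum_cond /=.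
by case: eqP.
Qed.

End Paths.

Lemma qpath_op (Q : quiver) i p j : @qpath (qop Q) i p j = @qpath Q j (rev p) i.
Proof.
elim: p i => [|a p IH] i /=; first by rewrite eq_sym.
by rewrite IH rev_cons qpath_rcons andbC.
Qed.

Lemma acyclic_op (Q : quiver) : acyclic Q -> acyclic (qop Q).
Proof. by move=> h i p; rewrite qpath_op => /h /(congr1 rev); rewrite revK. Qed.

Section DeltaMatrices.
Variables (k : fieldType) (T : eqType) (x0 : T).

(** The matrix of a map [f] between bases. [projrep] and [projmap] have this form, with [f]
    appending or prepending an arrow, so that their identities become identities of functions on
    paths. *)
Definition dmx (s s' : seq T) (f : T -> T) : 'M[k]_(size s, size s') :=
  \matrix_(u, v) (nth x0 s' v == f (nth x0 s u))%:R.

Lemma dmx_row (s s' : seq T) f n (A : 'M[k]_(size s', n))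
    (u : 'I_(size s)) (v : 'I_(size s')) :
  uniq s' -> nth x0 s' v = f (nth x0 s u) -> row u (dmx s s' f *m A) = row v A.
Proof.
move=> us e; apply/rowP=> y; rewrite !mxE (bigD1 v) //= mxE e eqxx mul1r big1 ?addr0 //.
move=> w nw; rewrite mxE -e nth_uniq // ; have /negPf := nw; rewrite -val_eqE => -> .
by rewrite mul0r.
Qed.

Lemma nth_ord_ex (s : seq T) w : w \in s -> exists u : 'I_(size s), nth x0 s u = w.
Proof. by move=> ws; have ls := ws; rewrite -index_mem in ls; exists (Ordinal ls); rewrite nth_index. Qed.

Lemma dmx_mul (s s' s'' : seq T) f g : uniq s' ->
  (forall w, w \in s -> f w \in s') ->
  dmx s s' f *m dmx s' s'' g = dmx s s'' (g \o f).
Proof.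
move=> us h; apply/row_matrixP=> u.
have [v ev] := nth_ord_ex (h _ (mem_nth x0 (ltn_ord u))).
by rewrite (dmx_row _ us ev); apply/rowP=> y; rewrite !mxE ev.
Qed.

End DeltaMatrices.

(** * The Auslander-Reiten formula *)

Section AuslanderReiten.
Variables (k : finFieldType) (Q : quiver).
Implicit Types M N X : rep k Q.

(** The dot product of vectorized matrices is the trace form. It identifies 1-cochains with their
    dual, so that D Ext^1(M, N) is realized as a space of cochains. *)
Lemma mxvec_pair m n (A B : 'M[k]_(m, n)) :
  (mxvec A *m (mxvec B)^T) 0 0 = \tr (A *m B^T).
Proof.
rewrite mxE (reindex (uncurry (@mxvec_index m n))) /=; last exact: curry_mxvec_bij.
rewrite /mxtrace; under [RHS]eq_bigr do rewrite mxE.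
by rewrite pair_bigA /=; apply: eq_bigr => -[i j] _ /=; rewrite !mxE !mxvecE.
Qed.

Lemma pair1 M N (u w : 'rV[k]_(c1dim M N)) :
  (u *m w^T) 0 0 = \sum_a \tr (comp1 u a *m (comp1 w a)^T).
Proof.
rewrite -{1}[u]comp1K -{1}[w]comp1K /pk1 tr_mxrow mul_mxrow_mxcol summxE.
by apply: eq_bigr => a _; rewrite -mxvec_pair.
Qed.

Lemma pair_inj n (x y : 'rV[k]_n) :
  (forall c : 'rV_n, (c *m x^T) 0 0 = (c *m y^T) 0 0) -> x = y.
Proof.
move=> h; apply/rowP=> j; have := h (delta_mx 0 j).
by rewrite -!rowE !mxE.
Qed.

(* [w], as a functional on 1-cochains, kills the coboundaries, i.e. lies in
   D Ext^1(M, N). *)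
Definition ann M N (w : forall a, 'M[k]_(rdim M (src a), rdim N (tgt a))) : Prop :=
  forall c : gm M N,
    \sum_a \tr ((c (src a) *m rmap N a - rmap M a *m c (tgt a)) *m (w a)^T) = 0.

Lemma eq_ann M N (w w' : forall a, 'M[k]_(rdim M (src a), rdim N (tgt a))) :
  (forall a, w a = w' a) -> ann w -> ann w'.
Proof. by move=> e h c; rewrite -[RHS](h c); apply: eq_bigr => a _; rewrite e. Qed.

Lemma annP M N (w : 'rV[k]_(c1dim M N)) :
  (w <= kermx (cobound M N)^T)%MS <-> ann (comp1 w).
Proof.
split=> [/sub_kermxP h c|h].
  have := congr1 (fun x => pk c *m x^T) h.
  rewrite trmx_mul trmxK trmx0 mulmx0 mulmxA => /matrixP/(_ 0 0).
  rewrite [in RHS]mxE pair1 => {}h; rewrite -[RHS]h; apply: eq_bigr => a _.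
  by rewrite mul_cobound pk1K !pkK.
apply/sub_kermxP; apply: pair_inj => c.
rewrite trmx0 mulmx0 [in RHS]mxE trmx_mul trmxK mulmxA pair1 -[RHS](h (comp0 c)).
by apply: eq_bigr => a _; rewrite mul_cobound pk1K.
Qed.

Lemma rank_ann M N : \rank (kermx (cobound M N)^T) = ed M N.
Proof. by rewrite mxrank_ker mxrank_tr /ext1_dim mxrank_coker. Qed.

(** The map on 1-cochains that induces [ext1_map]. *)
Definition lam M N N' (h : gm N N') : 'M[k]_(c1dim M N, c1dim M N') :=
  lin1_mx (fun c : 'rV[k]_(c1dim M N) => \mxrow_(a < narr Q) mxvec (comp1 c a *m h (tgt a))).

Lemma mul_lam M N N' (h : gm N N') (c : 'rV[k]_(c1dim M N)) :
  c *m lam M h = pk1 (fun a => comp1 c a *m h (tgt a)).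
Proof.
apply: (@mul_rV_linear _ _ _ (fun c => pk1 (fun a => comp1 c a *m h (tgt a)))) => b u v.
by apply: comp1_inj => a; rewrite comp1_lin !pk1K comp1_lin mulmxDl scalemxAl.
Qed.

Lemma mul_lamT M N N' (h : gm N N') (w : 'rV[k]_(c1dim M N')) :
  w *m (lam M h)^T = pk1 (fun a => comp1 w a *m (h (tgt a))^T).
Proof.
apply: pair_inj => c; rewrite trmx_mul trmxK mulmxA !pair1; apply: eq_bigr => a _.
by rewrite mul_lam !pk1K trmx_mul trmxK mulmxA.
Qed.

(** [pi *m pinvmx pi] is the identity modulo the row space of [A], and [Z] vanishes on that row
    space. *)
Lemma coker_ann m n p (A : 'M[k]_(m, n)) (Z : 'M[k]_(n, p)) (pi := col_base (cokermx A)) :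
  A *m Z = 0 -> Z = pi *m pinvmx pi *m Z.
Proof.
move=> AZ; apply/eqP; rewrite -subr_eq0 -{1}[Z]mul1mx -mulmxBl; apply/eqP.
have : (1%:M - pi *m pinvmx pi <= A)%MS.
  have D0 : (1%:M - pi *m pinvmx pi) *m pi = 0.
    by rewrite mulmxBl mul1mx -mulmxA mulVpmx ?col_base_full // mulmx1 subrr.
  rewrite submxE -(congr1 (mulmx _) (mulmx_base (cokermx A))) mulmxA.
  by rewrite [X in X *m _]D0 mul0mx.
by case/submxP=> D ->; rewrite -mulmxA AZ mulmx0.
Qed.

Lemma mul_cob_proj M N : cobound M N *m ext1_proj M N = 0.
Proof.
apply: (row_free_inj (row_base_free (cokermx (cobound M N)))) => /=.
by rewrite -mulmxA mulmx_base mulmx_coker mul0mx.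
Qed.

Lemma proj_full M N : row_full (ext1_proj M N).
Proof. exact: col_base_full. Qed.

Lemma projT_free M N : row_free (ext1_proj M N)^T.
Proof. by rewrite /row_free mxrank_tr; exact: proj_full. Qed.

(** [ext1_map] is defined with a chosen section of [ext1_proj]. It is well defined on classes
    because composition with a homomorphism takes coboundaries to coboundaries. *)
Lemma proj_ext1_map M N N' (h : gm N N') : hom h ->
  ext1_proj M N *m ext1_map M h = lam M h *m ext1_proj M N'.
Proof.
move=> hh; have e : cobound M N *m (lam M h *m ext1_proj M N') = 0; last first.
  by rewrite [RHS](coker_ann e) /ext1_map -/(lam M h) !mulmxA.
apply/row_matrixP=> x; rewrite row0 rowE mulmxA mulmxA.
set c := delta_mx 0 x.
have -> : c *m cobound M N *m lam M h = pk (gcomp (comp0 c) h) *m cobound M N'.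
  apply: comp1_inj => a; rewrite mul_lam mul_cobound mul_cobound !pk1K !pkK.
  by rewrite mulmxBl /gcomp -!mulmxA hh !mulmxA.
by rewrite -mulmxA mul_cob_proj mulmx0.
Qed.

Section PathAction.
Hypothesis acy : acyclic Q.
Variable N : rep k Q.

(* The identity for [i = j]; a cast that allows [pmat] to be defined on all
   lists of arrows. *)
Definition trv i j : 'M[k]_(rdim N i, rdim N j) :=
  \matrix_(x, y) ((i == j) && (val x == val y))%:R.
Lemma trv1 i : trv i i = 1%:M.
Proof. by apply/matrixP=> x y; rewrite !mxE eqxx. Qed.

Fixpoint pmat i j (p : seq 'I_(narr Q)) : 'M[k]_(rdim N i, rdim N j) :=
  if p is a :: p' then trv i (src a) *m rmap N a *m pmat (tgt a) j p' else trv i j.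

Lemma pmat_rcons i p a : qpath i p (src a) ->
  pmat i (tgt a) (rcons p a) = pmat i (src a) p *m rmap N a.
Proof.
elim: p i => [|b p IH] i /=; first by move/eqP->; rewrite !trv1 mulmx1.
by move=> /andP[_ /IH ->]; rewrite !mulmxA.
Qed.

Lemma pmat_cons a p j : pmat (src a) j (a :: p) = rmap N a *m pmat (tgt a) j p.
Proof. by rewrite /= trv1 mul1mx. Qed.

(* The morphism [P_i -> N] sending the trivial path at [i] to [n]. *)
Definition psi i (n : 'rV[k]_(rdim N i)) : gm (projrep k i) N :=
  fun j => \matrix_(u < size (paths i j)) (n *m pmat i j (nth [::] (paths i j) u)).

Lemma row_psi i n j u : row u (@psi i n j) = n *m pmat i j (nth [::] (paths i j) u).
Proof. exact: rowK. Qed.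

Lemma psi_hom i n : hom (@psi i n).
Proof.
move=> a; apply/row_matrixP=> u; rewrite [in RHS]row_mul row_psi.
have qu : qpath i (nth [::] (paths i (src a)) u) (src a).
  by rewrite -(mem_paths acy) mem_nth.
have [v ev] : exists v : 'I_(size (paths i (tgt a))), nth [::] (paths i (tgt a)) v =
    rcons (nth [::] (paths i (src a)) u) a.
  by apply: nth_ord_ex; rewrite mem_paths // qpath_rcons qu eqxx.
rewrite -mulmxA -pmat_rcons // -ev -row_psi.
exact: (@dmx_row k _ [::] (paths i (src a)) (paths i (tgt a)) (rcons^~ a) _ (psi n (tgt a)) u v (uniq_paths _ _) ev).
Qed.

(** Naturality in [i] of the Yoneda isomorphism Hom(P_i, N) = N_i. *)
Lemma projmap_psi a n j :
  projmap k a j *m @psi (src a) n j = @psi (tgt a) (n *m rmap N a) j.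
Proof.
apply/row_matrixP=> u; rewrite row_psi.
have [v ev] : exists v : 'I_(size (paths (src a) j)), nth [::] (paths (src a) j) v =
    a :: nth [::] (paths (tgt a) j) u.
  apply: nth_ord_ex; rewrite mem_paths //= eqxx -mem_paths //; exact: mem_nth.
rewrite -mulmxA -pmat_cons -ev -row_psi.
exact: (@dmx_row k _ [::] (paths (tgt a) j) (paths (src a) j) (cons a) _ (psi n j) u v (uniq_paths _ _) ev).
Qed.

Lemma psi_lin i c n n' j : @psi i (c *: n + n') j = c *: psi n j + psi n' j.
Proof.
by apply/row_matrixP=> u; rewrite linearP /= !row_psi mulmxDl scalemxAl.
Qed.

Lemma psi_nil i n : exists u, row u (@psi i n i) = n /\ nth [::] (paths i i) u = [::].
Proof.
have [u eu] : exists u : 'I_(size (paths i i)), nth [::] (paths i i) u = [::].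
  by apply: nth_ord_ex; rewrite mem_paths //=.
by exists u; rewrite row_psi eu /= trv1 mulmx1.
Qed.

End PathAction.

Lemma projmap_hom (acy : acyclic Q) (a : 'I_(narr Q)) :
  @hom k Q (projrep k (tgt a)) (projrep k (src a)) (projmap k a).
Proof.
move=> b; set s := paths (tgt a) (src b).
change (dmx k [::] s (paths (tgt a) (tgt b)) (rcons^~ b)
    *m dmx k [::] (paths (tgt a) (tgt b)) (paths (src a) (tgt b)) (cons a)
  = dmx k [::] s (paths (src a) (src b)) (cons a)
    *m dmx k [::] (paths (src a) (src b)) (paths (src a) (tgt b)) (rcons^~ b)).
rewrite !dmx_mul ?uniq_paths //.
  by move=> w; rewrite !mem_paths //= eqxx.
by move=> w; rewrite !mem_paths // qpath_rcons eqxx andbT.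
Qed.

End AuslanderReiten.

Section ARFormula.
Variables (k : finFieldType) (Q : quiver).
Hypothesis acy : acyclic Q.
Implicit Types M N X : rep k Q.
Notation P := (@projrep k Q).

(** The transpose of [ext1_proj] embeds D Ext^1(M, N) into the cochains with image the annihilator
    of the coboundaries, so a matrix with rows in that annihilator factors through it. *)
Lemma ann_proj M N m (Y : 'M[k]_(m, c1dim M N)) :
  (forall n, ann (comp1 (n *m Y))) ->
  Y *m (pinvmx (ext1_proj M N))^T *m (ext1_proj M N)^T = Y.
Proof.
move=> h; have e : cobound M N *m Y^T = 0.
  apply/trmx_inj; rewrite trmx_mul trmxK trmx0; apply/row_matrixP=> x.
  by rewrite row0 row_mul rowE; apply/sub_kermxP/annP/h.
by have /(congr1 trmx) := coker_ann e; rewrite !trmx_mul trmxK mulmxA => /esym.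
Qed.

Lemma ann_mul_proj M N m (f : 'M[k]_(m, ed M N)) n :
  ann (comp1 (n *m (f *m (ext1_proj M N)^T))).
Proof.
apply/annP/sub_kermxP; apply/trmx_inj.
by rewrite -mulmxA -mulmxA -trmx_mul mul_cob_proj !trmx0 !mulmx0 trmx0.
Qed.

(** For [z] in D Ext^1(M, N) and [n] in N_i, the product [n *m ar_mx z i] is the pullback of [z]
    along Ext^1(M, psi n): a functional on Ext^1(M, P_i), that is, an element of (tau M)_i. *)
Definition ar_mx M N (z : 'rV[k]_(c1dim M N)) i : 'M[k]_(rdim N i, c1dim M (P i)) :=
  lin1_mx (fun n => pk1 (fun b => comp1 z b *m (psi n (tgt b))^T)).

Lemma mul_ar_mx M N (z : 'rV[k]_(c1dim M N)) i n :
  n *m ar_mx z i = pk1 (fun b => comp1 z b *m (psi n (tgt b))^T).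
Proof.
apply: (@mul_rV_linear _ _ _ (fun n : 'rV_(rdim N i) =>
  @pk1 _ _ M (P i) (fun b => comp1 z b *m (psi n (tgt b))^T))) => c u v.
by apply: comp1_inj => b; rewrite comp1_lin !pk1K psi_lin linearP /= mulmxDr scalemxAr.
Qed.

Lemma ar_mx_ann M N (z : 'rV[k]_(c1dim M N)) i n :
  ann (comp1 z) -> ann (comp1 (n *m ar_mx z i)).
Proof.
move=> az c; rewrite -[RHS](az (gcomp c (psi n))); apply: eq_bigr => a _.
rewrite mul_ar_mx pk1K trmx_mul trmxK mulmxA /gcomp; congr (\tr (_ *m _)).
by rewrite mulmxBl -!mulmxA psi_hom.
Qed.

(** [F z] is a homomorphism by [projmap_psi], and it determines [z]: at the trivial path of the
    target of [b], the pulled back functional is the component of [z] at [b]. *)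
Lemma ar_le M N : (ed M N <= hd N (tau M))%N.
Proof.
rewrite -rank_ann.
pose F (z : 'rV[k]_(c1dim M N)) : gm N (tau M) :=
  fun i => ar_mx z i *m (pinvmx (ext1_proj M (P i)))^T.
have FY z i : ann (comp1 z) -> F z i *m (ext1_proj M (P i))^T = ar_mx z i.
  by move=> az; apply: ann_proj => n; apply: ar_mx_ann.
apply: (@rank_le_inj _ _ _ _ _ _ _ (fun z => pk (F z))).
- move=> c u v; apply: comp0_inj => i; rewrite comp0_lin !pkK /F scalemxAl -mulmxDl.
  congr (_ *m _); apply/row_matrixP=> x; rewrite linearP /= !rowE !mul_ar_mx.
  by apply: comp1_inj => b; rewrite comp1_lin !pk1K comp1_lin mulmxDl scalemxAl.
- move=> z /annP az; apply/hom_kermx => a.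
  apply: (row_free_inj (projT_free M (P (tgt a)))); rewrite /= -mulmxA FY //.
  rewrite -mulmxA -trmx_mul (proj_ext1_map M (projmap_hom k acy a)) trmx_mul mulmxA FY //.
  apply/row_matrixP=> x; rewrite !rowE !mulmxA !mul_ar_mx mul_lamT.
  apply: comp1_inj => b; rewrite !pk1K -mulmxA -trmx_mul; congr (_ *m _^T).
  by rewrite projmap_psi.
move=> z /annP az /pk_eq0 F0; apply: comp1_inj => b; rewrite comp1_0.
apply/trmx_inj; rewrite trmx0; apply/row_matrixP=> x; rewrite row0 rowE.
set n := delta_mx 0 x.
have : comp1 (n *m ar_mx z (tgt b)) b = 0 by rewrite -FY // F0 mul0mx mulmx0 comp1_0.
rewrite mul_ar_mx pk1K; have [u [eu _]] := psi_nil acy n.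
by move/(congr1 trmx); rewrite trmx_mul trmxK trmx0 -{2}eu -row_mul => ->; rewrite row0.
Qed.

Lemma mulT_inj m n (A B : 'M[k]_(m, n)) :
  (forall u : 'rV_n, A *m u^T = B *m u^T) -> A = B.
Proof.
move=> h; apply/trmx_inj/row_matrixP=> x; rewrite !rowE.
by have /(congr1 trmx) := h (delta_mx 0 x); rewrite !trmx_mul trmxK.
Qed.

(** Coordinate vector of the path [p]; multiplying by it reads off the coefficient at [p]. *)
Definition eps i j (p : seq 'I_(narr Q)) : 'cV[k]_(size (paths i j)) :=
  \col_u (nth [::] (paths i j) u == p)%:R.

Lemma mul_eps n i j (A : 'M[k]_(n, size (paths i j))) (u : 'I_(size (paths i j))) :
  A *m eps i j (nth [::] (paths i j) u) = col u A.
Proof.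
apply/colP=> x; rewrite !mxE (bigD1 u) //= mxE eqxx mulr1 big1 ?addr0 // => v nv.
by rewrite mxE nth_uniq ?uniq_paths // val_eqE (negPf nv) mulr0.
Qed.

Lemma projmap_eps a j p : qpath (tgt a) p j ->
  (projmap k a j)^T *m eps (tgt a) j p = eps (src a) j (a :: p).
Proof.
rewrite -mem_paths // => /(nth_ord_ex [::])[u <-]; rewrite mul_eps.
by apply/colP=> x; rewrite !mxE.
Qed.

Section Converse.
Variables M N : rep k Q.
Variable f : gm N (tau M).

Definition fY i : 'M[k]_(rdim N i, c1dim M (P i)) := f i *m (ext1_proj M (P i))^T.
(* Over each arrow the cocycle is read off [f] at the trivial paths. *)
Definition fz b : 'M[k]_(rdim M (src b), rdim N (tgt b)) :=
  (lin1_mx (fun n => (comp1 (n *m fY (tgt b)) b *m eps (tgt b) (tgt b) [::])^T))^T.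

Lemma mul_fz b n : fz b *m n^T = comp1 (n *m fY (tgt b)) b *m eps (tgt b) (tgt b) [::].
Proof.
apply/trmx_inj; rewrite trmx_mul !trmxK.
apply: (@mul_rV_linear _ _ _ (fun n =>
   (comp1 (n *m fY (tgt b)) b *m eps (tgt b) (tgt b) [::])^T)) => c u v.
by rewrite mulmxDl -scalemxAl comp1_lin mulmxDl -scalemxAl linearP.
Qed.

Hypothesis hf : hom f.

Lemma fY_arrow a : rmap N a *m fY (tgt a) = fY (src a) *m (lam M (projmap k a))^T.
Proof.
rewrite /fY mulmxA hf /= -!mulmxA -!trmx_mul.
by rewrite (proj_ext1_map M (projmap_hom k acy a)).
Qed.

(** Moving [n] along [p] before applying [f] amounts to precomposing with right multiplication by
    [p], so the coefficient at the trivial path becomes the one at [p]. *)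
Lemma fY_path b i p n : qpath i p (tgt b) ->
  comp1 (n *m pmat N i (tgt b) p *m fY (tgt b)) b *m eps (tgt b) (tgt b) [::]
  = comp1 (n *m fY i) b *m eps i (tgt b) p.
Proof.
elim: p i n => [|a p IH] i n /=; first by move=> /eqP e; subst i; rewrite trv1 mulmx1.
move=> /andP[/eqP e h]; subst i; rewrite trv1 mul1mx mulmxA IH //.
rewrite -mulmxA fY_arrow mulmxA mul_lamT pk1K -mulmxA; congr (_ *m _).
exact: projmap_eps.
Qed.

Lemma fz_psi b i n : fz b *m (psi n (tgt b))^T = comp1 (n *m fY i) b.
Proof.
apply/trmx_inj/row_matrixP=> u; rewrite -!tr_col; congr trmx; rewrite -!mul_eps.
have qu : qpath i (nth [::] (paths i (tgt b)) u) (tgt b) by rewrite -mem_paths // mem_nth.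
by rewrite -fY_path // -mul_fz -mulmxA mul_eps -tr_row row_psi.
Qed.

(** Each row of [fY] annihilates coboundaries. An arbitrary family [c] reduces to this case because
    it factors, vertex by vertex, through projectives. *)
Lemma fz_ann : ann fz.
Proof.
move=> c.
(* [d v l] sends the [l]-th basis vector of M_v to the trivial path of P_v and all other basis
   vectors to 0. It is not a homomorphism in general, but [ann] ranges over all families. *)
pose d v (l : 'I_(rdim M v)) : gm M (P v) := fun j => \matrix_(m, u)
  [&& j == v, val m == val l & nth [::] (paths v j) u == [::]]%:R.
have dc j : c j = \sum_v \sum_(l < rdim M v) d v l j *m psi (row l (c v)) j.
  rewrite (bigD1 j) //= [X in _ + X]big1 ?addr0 => [|v nv]; last first.
    rewrite big1 // => l _; rewrite (_ : d v l j = 0) ?mul0mx //.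
    by apply/matrixP=> m u; rewrite !mxE eq_sym (negPf nv).
  apply/row_matrixP=> m; rewrite linear_sum /= (bigD1 m) //= [X in _ + X]big1 ?addr0.
    have [u0 [e0 e1]] := psi_nil acy (row m (c j)).
    rewrite -{1}e0 row_mul (_ : row m (d j m j) = delta_mx 0 u0) -?rowE //.
    by apply/rowP=> u; rewrite !mxE !eqxx /= -[X in _ == X]e1 nth_uniq ?uniq_paths.
  move=> l nl; rewrite row_mul (_ : row m (d j l j) = 0) ?mul0mx //.
  by apply/rowP=> u; rewrite !mxE eqxx val_eqE eq_sym (negPf nl).
under eq_bigr => a _.
  rewrite (dc (src a)) (dc (tgt a)) mulmx_suml mulmx_sumr -sumrB mulmx_suml linear_sum /=.
  under eq_bigr => v _.
    rewrite mulmx_suml mulmx_sumr -sumrB mulmx_suml linear_sum /=.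
    over.
  over.
rewrite exchange_big /= big1 // => v _; rewrite exchange_big /= big1 // => l _.
rewrite -[RHS](ann_mul_proj (f v) (row l (c v)) (d v l)); apply: eq_bigr => a _.
have -> : (comp1 (row l (c v) *m (f v *m (ext1_proj M (P v))^T)) a)^T
  = psi (row l (c v)) (tgt a) *m (fz a)^T.
  by rewrite -/(fY v) -fz_psi trmx_mul trmxK.
rewrite [in RHS]mulmxA; congr (\tr (_ *m _)).
by rewrite mulmxBl -!mulmxA psi_hom.
Qed.

End Converse.

(** The inverse construction: by [fz_psi] the cochain [fz f] determines [f]. *)
Lemma ar_ge M N : (hd N (tau M) <= ed M N)%N.
Proof.
rewrite -rank_ann.
apply: (@rank_le_inj _ _ _ _ _ _ _ (fun c => pk1 (fz (comp0 c)))).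
- move=> c u v; apply: comp1_inj => b; rewrite [LHS]pk1K [RHS]comp1_lin.
  rewrite [X in _ = _ *: X + _]pk1K [X in _ = _ + X]pk1K; apply: mulT_inj => n; rewrite mulmxDl -scalemxAl !mul_fz /fY comp0_lin.
  by rewrite mulmxDl mulmxDr -!scalemxAl -scalemxAr comp1_lin mulmxDl -scalemxAl.
- move=> c /hom_comp0 hc; apply/annP; apply: eq_ann (fz_ann hc) => a; by rewrite pk1K.
move=> c /hom_comp0 hc e; rewrite -[c]comp0K; apply/pk_eq0 => i.
apply: (row_free_inj (projT_free M (P i))); rewrite /= mul0mx -/(fY _ i).
apply/row_matrixP=> x; rewrite row0 rowE; apply: comp1_inj => b.
rewrite -fz_psi // comp1_0; have := comp1_0 M N b; rewrite -e pk1K => ->.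
by rewrite mul0mx.
Qed.

Theorem auslander_reiten M N : hd N (tau M) = ed M N.
Proof. by apply/eqP; rewrite eqn_leq ar_le ar_ge. Qed.

End ARFormula.

(** * The Euler form *)

Section Euler.
Variable Q : quiver.
Implicit Types x y z : 'I_(nvert Q) -> int.

Lemma euler_op x y : @euler (qop Q) x y = @euler Q y x.
Proof.
rewrite /euler; congr (_ - _); apply: eq_bigr => i _; exact: mulrC.
Qed.

Lemma euler_ext x x' y y' : x =1 x' -> y =1 y' -> euler x y = euler x' y'.
Proof.
by move=> ex ey; congr (_ - _); apply: eq_bigr => i _; rewrite ex ey.
Qed.

Lemma euler_linr c x y z : euler x (fun i => c * y i + z i) = c * euler x y + euler x z.
Proof.
rewrite /euler mulrBr !mulr_sumr [in RHS]addrACA -opprD -!big_split /=.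
by congr (_ - _); apply: eq_bigr => i _; ring.
Qed.

End Euler.

Section EulerLinear.
Variable Q : quiver.
Implicit Types x y z : 'I_(nvert Q) -> int.

Lemma euler_linl c x y z : euler (fun i => c * y i + z i) x = c * euler y x + euler z x.
Proof. by rewrite -(euler_op _ (fun i => _)) euler_linr !euler_op. Qed.

Lemma euler_addr x y z : euler x (fun i => y i + z i) = euler x y + euler x z.
Proof.
rewrite -[euler x y]mul1r -euler_linr; apply: euler_ext => // i; by rewrite mul1r.
Qed.
Lemma euler_addl x y z : euler (fun i => y i + z i) x = euler y x + euler z x.
Proof.
rewrite -[euler y x]mul1r -euler_linl; apply: euler_ext => // i; by rewrite mul1r.
Qed.
Lemma euler0r x : euler x (fun=> 0) = 0.
Proof. by rewrite /euler !big1 ?subr0 // => i _; rewrite mulr0. Qed.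
Lemma euler0l x : euler (fun=> 0) x = 0.
Proof. by rewrite /euler !big1 ?subr0 // => i _; rewrite mul0r. Qed.
Lemma euler_scaler c x y : euler x (fun i => c * y i) = c * euler x y.
Proof.
rewrite -[RHS]addr0 -[X in _ + X](euler0r x) -euler_linr; apply: euler_ext => // i.
by rewrite addr0.
Qed.
Lemma euler_scalel c x y : euler (fun i => c * x i) y = c * euler x y.
Proof.
rewrite -[RHS]addr0 -[X in _ + X](euler0l y) -euler_linl; apply: euler_ext => // i.
by rewrite addr0.
Qed.
Lemma euler_sumr x (I : finType) (y : I -> 'I_(nvert Q) -> int) :
  euler x (fun i => \sum_t y t i) = \sum_t euler x (y t).
Proof.
rewrite /euler sumrB; congr (_ - _); rewrite exchange_big; apply: eq_bigr => i _;
  by rewrite mulr_sumr.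
Qed.

End EulerLinear.

(** * Duality with the opposite quiver *)

Section Duality.
Variables (k : finFieldType) (Q : quiver).
Implicit Types M N X : rep k Q.

Lemma hd_dual M N : hd (rdual N) (rdual M) = hd M N.
Proof.
apply/eqP; rewrite eqn_leq; apply/andP; split.
  apply: (@rank_le_inj _ _ _ _ _ _ _ (fun c => @pk k Q M N (fun i => (comp0 c i)^T))).
  - by move=> c u v; apply: comp0_inj => i; rewrite comp0_lin !pkK comp0_lin linearP.
  - move=> u /hom_comp0 h; apply/hom_kermx => a; apply/trmx_inj.
    by rewrite !trmx_mul !trmxK -(h a).
  move=> u /hom_comp0 h /pk_eq0 e; rewrite -[u]comp0K; apply/pk_eq0 => i.
  by apply/trmx_inj; rewrite e trmx0.
apply: (@rank_le_inj _ _ _ _ _ _ _ (fun c => @pk k (qop Q) (rdual N) (rdual M) (fun i => (comp0 c i)^T))).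
- by move=> c u v; apply: comp0_inj => i; rewrite comp0_lin !pkK comp0_lin linearP.
- move=> u /hom_comp0 h; apply/hom_kermx => a; apply/trmx_inj.
  by rewrite !trmx_mul !trmxK -(h a).
move=> u /hom_comp0 h /pk_eq0 e; rewrite -[u]comp0K; apply/pk_eq0 => i.
by apply/trmx_inj; rewrite e trmx0.
Qed.

(** An equality of representations, not merely an isomorphism, so that it can be rewritten under
    [tau]. *)
Lemma rdual'K (X : rep k (qop Q)) : rdual (rdual' X) = X.
Proof.
case: X => d m; rewrite /rdual /rdual' /=; congr Rep.
by apply: functional_extensionality_dep => a; rewrite trmxK.
Qed.

Lemma rdualK M : rdual' (rdual M) = M.
Proof.
case: M => d m; rewrite /rdual /rdual' /=; congr Rep.
by apply: functional_extensionality_dep => a; rewrite trmxK.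
Qed.

Lemma ed_dual M N : ed (rdual N) (rdual M) = ed M N.
Proof.
have := hd_ed (rdual N) (rdual M); rewrite euler_op hd_dual -(hd_ed M N).
lia.
Qed.

Lemma iso_dual M N : iso M N -> iso (rdual N) (rdual M).
Proof.
case=> f [[hf mf] [_ ef]]; exists (fun i => (f i)^T).
have h : @hom k (qop Q) (rdual N) (rdual M) (fun i => (f i)^T).
  by move=> a; rewrite /= -!trmx_mul -(hf a).
split; split=> // i.
  by rewrite /row_free mxrank_tr; exact: ef.
by rewrite /row_full mxrank_tr; exact: mf.
Qed.

Lemma rsum_dual M N : rdual (rsum M N) = rsum (rdual M) (rdual N).
Proof.
rewrite /rdual /rsum /=; congr Rep.
by apply: functional_extensionality_dep => a; rewrite tr_block_mx !trmx0.
Qed.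

Lemma iso_dual' (M N : rep k (qop Q)) : iso M N -> iso (rdual' N) (rdual' M).
Proof.
case=> f [[hf mf] [_ ef]]; exists (fun i => (f i)^T).
have h : @hom k Q (rdual' N) (rdual' M) (fun i => (f i)^T).
  by move=> a; rewrite /= -!trmx_mul -(hf a).
split; split=> // i.
  by rewrite /row_free mxrank_tr; exact: ef.
by rewrite /row_full mxrank_tr; exact: mf.
Qed.

Lemma rsum_dual' (M N : rep k (qop Q)) : rdual' (rsum M N) = rsum (rdual' M) (rdual' N).
Proof.
rewrite /rdual' /rsum /=; congr Rep.
by apply: functional_extensionality_dep => a; rewrite tr_block_mx !trmx0.
Qed.

Lemma indec_dual M : indecomposable M -> indecomposable (rdual M).
Proof.
case=> nz h; split=> // N L /risoP/iso_dual'; rewrite rdualK rsum_dual' => /iso_sym/risoP.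
by move/h.
Qed.

Lemma iter_tauinv M n : rdual (iter n (@tauinv k Q) M) = iter n (@tau k (qop Q)) (rdual M).
Proof. by elim: n => //= n <-; rewrite /tauinv rdual'K. Qed.

Lemma preinjective_dual M : preinjective M <-> preprojective (rdual M).
Proof. by split=> -[n h]; exists n => i; have := h i; rewrite -iter_tauinv. Qed.

End Duality.

Section ARdual.
Variables (k : finFieldType) (Q : quiver).
Hypothesis acy : acyclic Q.
Implicit Types M N X Y : rep k Q.
Notation P := (@projrep k Q).

Lemma hd_tauinv M N : hd (tauinv N) M = ed M N.
Proof.
rewrite -hd_dual /tauinv rdual'K auslander_reiten; last exact: acyclic_op.
exact: ed_dual.
Qed.

(** Right exactness of Ext^1(X, -), obtained from left exactness of Hom(-, tau X). *)
Lemma ed_epi X M N (p : gm M N) : epi p -> (ed X N <= ed X M)%N.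
Proof. by move=> ep; rewrite -!auslander_reiten //; apply: hd_epi ep. Qed.

Lemma ed_mono X M N (j : gm M N) : mono j -> (ed M X <= ed N X)%N.
Proof. by move=> ep; rewrite -!hd_tauinv //; apply: hd_mono ep. Qed.

Lemma ed_rsumr X M N : ed X (rsum M N) = (ed X M + ed X N)%N.
Proof. by rewrite -!auslander_reiten // hd_rsuml. Qed.
Lemma iso_edl M N X : iso M N -> ed M X = ed N X.
Proof. by move=> i; rewrite -!hd_tauinv (iso_hdr _ i). Qed.
Lemma iso_edr M N X : iso M N -> ed X M = ed X N.
Proof. by move=> i; rewrite -!auslander_reiten // (iso_hdl _ i). Qed.

End ARdual.

(** * The Coxeter transformation and tau on indecomposables *)

Section Coxeter.
Variables (k : finFieldType) (Q : quiver).
Hypothesis acy : acyclic Q.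
Implicit Types M N X Y A B C K I : rep k Q.
Notation P := (@projrep k Q).

Lemma ses_dimvec A B C (f : gm A B) (g : gm B C) : ses f g ->
  dimvec B =1 (fun i => dimvec A i + dimvec C i).
Proof. by move=> s i; rewrite /dimvec (ses_dim i s). Qed.

(** The Euler characteristic of the long exact sequence for Hom(X, -). *)
Lemma ses_eulr X A B C (f : gm A B) (g : gm B C) : ses f g ->
  (hd X B + ed X A + ed X C = ed X B + hd X A + hd X C)%N.
Proof.
move=> s; have := hd_ed X B.
rewrite (euler_ext (frefl _) (ses_dimvec s)) euler_addr -!hd_ed; lia.
Qed.

Lemma ses_eull X A B C (f : gm A B) (g : gm B C) : ses f g ->
  (hd B X + ed A X + ed C X = ed B X + hd A X + hd C X)%N.
Proof.
move=> s; have := hd_ed B X.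
rewrite (euler_ext (ses_dimvec s) (frefl _)) euler_addl -!hd_ed; lia.
Qed.

(** When [ed X A = 0], the Euler characteristic together with [ed X C <= ed X B] makes the
    dimensions of Hom(X, -) add up. *)
Lemma lift_ed X A B C (f : gm A B) (g : gm B C) (h : gm X C) :
  ses f g -> ed X A = 0%N -> hom h ->
  exists2 h' : gm X B, hom h' & forall i, h' i *m g i = h i.
Proof.
move=> s e0; have [mf eg z] := s; have [_ [l _]] := hd_lift X mf eg.1 z.
apply: l; have := ses_eulr X s; have := ed_epi acy X eg; lia.
Qed.

Lemma ed_split A B C (f : gm A B) (g : gm B C) : ses f g -> ed C A = 0%N ->
  iso B (rsum A C).
Proof.
move=> s e0; have [h hh e] := lift_ed s e0 (@hom_id _ _ C).
exact: split_section s hh e.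
Qed.

(** Grouping the paths by their last arrow cancels the sum over arrows. *)
Lemma euler_projrep i (x : 'I_(nvert Q) -> int) : euler (dimvec (P i)) x = x i.
Proof.
rewrite /euler /dimvec /=.
under eq_bigr => j _ do rewrite (size_paths_last acy) PoszD mulrDl.
rewrite big_split /= (bigD1 i) //= eqxx mul1r [X in _ + X + _]big1 ?addr0; last first.
  by move=> j; rewrite eq_sym => /negPf ->; rewrite mul0r.
rewrite -[RHS]addr0 -addrA; congr (_ + _); apply/eqP; rewrite subr_eq0; apply/eqP.
under eq_bigr => j _ do rewrite (big_morph Posz PoszD (erefl _)) mulr_suml big_mkcond /=.
rewrite exchange_big /=; apply: eq_bigr => a _.
rewrite (bigD1 (tgt a)) //= eqxx big1 ?addr0 // => j nj.
by rewrite eq_sym (negPf nj).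
Qed.

Lemma proj_hom_eq0 i X (f : gm (P i) X) (u0 : 'I_(size (paths i i))) : hom f ->
  nth [::] (paths i i) u0 = [::] -> row u0 (f i) = 0 -> forall j, f j = 0.
Proof.
move=> hf e0 r0 j; apply/row_matrixP=> u; rewrite row0.
move: {2}(nth [::] (paths i j) u) (erefl (nth [::] (paths i j) u)) => p.
have : qpath i (nth [::] (paths i j) u) j by rewrite -mem_paths // mem_nth.
elim/last_ind: p j u => [|p a IH] j u q ep.
  move: q; rewrite ep /= => /eqP ej; subst j.
  suff -> : u = u0 by [].
  by apply/val_inj/eqP; rewrite -(nth_uniq [::] (ltn_ord u) (ltn_ord u0) (uniq_paths i i)) ep e0.
move: q; rewrite ep qpath_rcons => /andP[qp /eqP ej]; subst j.
have [v ev] : exists v : 'I_(size (paths i (src a))), nth [::] (paths i (src a)) v = p.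
  by apply: nth_ord_ex; rewrite mem_paths.
have e : nth [::] (paths i (tgt a)) u = rcons (nth [::] (paths i (src a)) v) a by rewrite ev.
have <- := @dmx_row k _ [::] _ _ (rcons^~ a) _ (f (tgt a)) v u (uniq_paths _ _) e.
have -> : dmx k [::] (paths i (src a)) (paths i (tgt a)) (rcons^~ a) *m f (tgt a)
   = f (src a) *m rmap X a by exact: hf.
by rewrite row_mul IH // ?mul0mx // ev.
Qed.

(** A map out of [P i] is determined by the image of the trivial path, so dim Hom is at most
    [rdim X i], which is already the value of the Euler form. *)
Lemma ed_projrep i X : ed (P i) X = 0%N.
Proof.
have := hd_ed (P i) X; rewrite euler_projrep /dimvec.
suff : (hd (P i) X <= rdim X i)%N by lia.
have [u0 e0] : exists u : 'I_(size (paths i i)), nth [::] (paths i i) u = [::].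
  by apply: nth_ord_ex; rewrite mem_paths //=.
suff : (hd (P i) X <= \rank (1%:M : 'M[k]_(rdim X i)))%N by rewrite mxrank1.
apply: (@rank_le_inj _ _ _ _ _ _ _ (fun c : 'rV[k]_(c0dim (P i) X) => row u0 (comp0 c i))).
- by move=> c u v; rewrite comp0_lin linearP.
- by move=> u _; rewrite submx1.
move=> u /hom_comp0 hu r0; rewrite -[u]comp0K; apply/pk_eq0.
exact: (proj_hom_eq0 hu e0 r0).
Qed.

(* The Coxeter transformation: [tau M] has dimension vector [cox (dimvec M)]
   if [M] has no projective summand. *)
Definition cox (x : 'I_(nvert Q) -> int) : 'I_(nvert Q) -> int :=
  fun i => - euler x (dimvec (P i)).

(** The radical sequence of [P i] expresses the unit vector at [i] by dimension vectors of
    projectives. This gives [e], which is then summed against [y]. *)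
Lemma euler_cox x y : euler y (cox x) = - euler x y.
Proof.
have e i : cox x i - \sum_(a | src a == i) cox x (tgt a)
   = - euler x (fun j => (i == j)%:Z).
  have pe : dimvec (P i) =1 (fun j => (i == j)%:Z +
     \sum_a (if src a == i then dimvec (P (tgt a)) j else 0)).
    by move=> j; rewrite /dimvec /= size_paths_first // PoszD
       (big_morph Posz PoszD (erefl _)) -big_mkcond.
  rewrite /cox (euler_ext (frefl _) pe) euler_addr euler_sumr sumrN opprK opprD.
  rewrite [in X in _ + X]big_mkcond -addrA -[RHS]addr0; congr (_ + _).
  rewrite addrC -sumrB big1 // => a _; case: eqP => _; rewrite ?euler0r subrr //.
have -> : euler y (cox x) = \sum_i y i * (cox x i - \sum_(a | src a == i) cox x (tgt a)).
  rewrite /euler; under [RHS]eq_bigr do rewrite mulrBr mulr_sumr big_mkcond.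
  rewrite sumrB; congr (_ - _); rewrite exchange_big; apply: eq_bigr => a _ /=.
  rewrite (bigD1 (src a)) //= eqxx big1 ?addr0 // => j nj.
  by rewrite eq_sym (negPf nj).
under eq_bigr do rewrite e mulrN -euler_scaler.
rewrite sumrN -euler_sumr; congr (- _); apply: euler_ext => // j.
rewrite (bigD1 j) //= eqxx mulr1 big1 ?addr0 // => i ni.
by rewrite (negPf ni) mulr0.
Qed.

Lemma cox_ext x y : x =1 y -> cox x =1 cox y.
Proof. by move=> e i; rewrite /cox (euler_ext e (frefl _)). Qed.
Lemma cox_add x y : cox (fun i => x i + y i) =1 (fun i => cox x i + cox y i).
Proof. by move=> i; rewrite /cox euler_addl opprD. Qed.
Lemma cox_scale c x : cox (fun i => c * x i) =1 (fun i => c * cox x i).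
Proof. by move=> i; rewrite /cox euler_scalel mulrN. Qed.
Lemma euler_cox2 x y : euler (cox x) (cox y) = euler x y.
Proof. by rewrite !euler_cox opprK. Qed.

(** Hom(M, kQ) = 0; then the Euler form alone gives the dimension of Ext^1(M, P_i), as [dim_tau]
    needs. *)
Definition noproj M := forall i, hd M (P i) = 0%N.

Lemma dim_tau M : noproj M -> dimvec (tau M) =1 cox (dimvec M).
Proof. by move=> h i; rewrite /cox -hd_ed h /dimvec /=; lia. Qed.

(** The second Auslander-Reiten formula, from the first by comparing Euler forms. *)
Lemma hd_ed_tau M X : noproj M -> hd M X = ed X (tau M).
Proof.
move=> h; have := hd_ed X (tau M).
rewrite (euler_ext (frefl _) (dim_tau h)) euler_cox -hd_ed auslander_reiten //; lia.
Qed.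

Lemma hd_tau M X : noproj M -> hd M X = hd (tau M) (tau X).
Proof. by move=> h; rewrite hd_ed_tau // auslander_reiten. Qed.

Lemma tau_is0 M : rep_is0 (tau M) <-> forall X, ed M X = 0%N.
Proof.
split=> [z X|h i]; last exact: h.
by rewrite -auslander_reiten // hd_is0r.
Qed.

(** The image of [M] in a projective is projective, hence splits off. Were it nonzero, [M] would be
    projective and [tau M] zero. *)
Lemma indec_noproj M : indecomposable M -> ~ rep_is0 (tau M) -> noproj M.
Proof.
move=> ind nz i; apply/hd_eq0 => f hf j.
have [I [p [m [ep mm e]]]] := img_ex hf; have [K [κ s]] := ker_epi_ses ep.
have edI X : ed I X = 0%N by apply/eqP; rewrite -leqn0 -(ed_projrep i X) (ed_mono acy X mm).
case: (indec_rsum ind (ed_split s (edI K))) => z; last first.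
  by rewrite e (is0_mxr (p : gm M I)) // mul0mx.
exfalso; apply/nz/tau_is0 => X; rewrite -(edI X); apply: iso_edl => //.
exists p; split=> //; apply: epi_dim_mono => // l; by rewrite (ses_dim l s) z.
Qed.

Lemma unit_inv M (u : gm M M) : hom u -> (forall i, u i \in unitmx) ->
  exists2 v : gm M M, hom v & (forall i, u i *m v i = 1%:M) /\ (forall i, v i *m u i = 1%:M).
Proof.
by move=> hu uu; apply: inv_ex; split=> // i; rewrite ?row_free_unit ?row_full_unit.
Qed.

(* If [hd M] and [hd B] agree on all modules, the identity of [M] factors
   through a power of [B]; for [M] indecomposable [M] is then a summand of [B]. *)
Lemma power_approx M B (s : seq (gmap B M)) : indecomposable M ->
  exists Z (ev : gm Z M), [/\ hom ev,
    forall b, b \in s -> hom (fam b) ->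
      exists2 j : gm B Z, hom j & forall i, j i *m ev i = b i
    & forall t : gm M Z, hom t -> (forall i, t i *m ev i = 1%:M) ->
      exists (f : gm M B) (g : gm B M),
        [/\ hom f, hom g & forall i, f i *m g i \in unitmx]].
Proof.
move=> ind; elim: s => [|b s [Z [ev [hev fac loc]]]].
  (* The empty power, represented by the zero map: it has no section because [M] is nonzero. *)
  exists M, (fun i => 0); split=> //; first exact: hom0.
  move=> t _ h; exfalso; apply: ind.1 => i; apply: (@one_eq0 k); by rewrite -(h i) mulmx0.
have [hb|nhb] := classic (hom (fam b)); last first.
  exists Z, ev; split=> // b'; rewrite inE => /predU1P[->|] //; exact: fac.
exists (rsum B Z), (rout (fam b) ev); split; first exact: hom_rout.
  move=> b'; rewrite inE => /predU1P[-> _|bs hb'].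
    exists (@inl _ _ B Z); first exact: hom_inl.
    by move=> i; rewrite mul_row_col mul1mx mul0mx addr0.
  have [j hj e] := fac _ bs hb'; exists (gcomp j (@inr _ _ B Z)).
    exact: hom_comp hj (hom_inr _ _).
  by move=> i; rewrite /gcomp -mulmxA mul_row_col mul1mx mul0mx add0r.
move=> t ht e.
have [t1 [t2 [h1 h2 tE]]] := rin_ex ht.
have e12 i : t1 i *m b i + t2 i *m ev i = 1%:M by rewrite -(e i) tE mul_row_col.
case: (@indec_local _ _ _ (gcomp t1 (fam b)) (gcomp t2 ev) ind) => //.
- exact: hom_comp.
- exact: hom_comp.
- by move=> u1; exists t1, (fam b).
move=> u2; have [|v hv [_ vu]] := unit_inv _ u2; first exact: hom_comp.
apply: (loc (gcomp v t2)); first exact: hom_comp.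
by move=> i; rewrite /gcomp -mulmxA vu.
Qed.

(** Hom(B, Z) -> Hom(B, M) is onto by the construction of [Z]. This is a statement about dimensions,
    so it transfers from [B] to [M], and the identity of [M] lifts to [Z]. *)
Lemma bongartz M B : indecomposable M -> (forall X, hd M X = hd B X) ->
  exists (f : gm M B) (g : gm B M), [/\ hom f, hom g & forall i, f i *m g i \in unitmx].
Proof.
move=> ind e; have [Z [ev [hev fac loc]]] := power_approx (enum (rhom B M)) ind.
have [K [j [mj ez]]] := ker_ex hev.
have [_ [_ lB]] := hd_lift B mj hev ez; have [_ [lM _]] := hd_lift M mj hev ez.
have [|t ht et] := lM _ _ (@hom_id _ _ M).
  rewrite !e; apply: lB => h hh; have hu := unfam_hom hh.
  have [|l hl el] := fac (unfam h) _ hu; first by rewrite mem_enum; apply/rhomP.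
  by exists l => // i; rewrite el unfamE.
exact: loc ht et.
Qed.

Lemma summand_hd M A (f : gm M A) (g : gm A M) X : hom g ->
  (forall i, f i *m g i \in unitmx) -> (hd M X <= hd A X)%N.
Proof.
move=> hg u; apply: (@hd_epi _ _ _ _ _ g); split=> // i; rewrite -sub1mx.
by apply: submx_trans (submxMl (f i) (g i)); rewrite sub1mx row_full_unit.
Qed.

(** If [tau M] is [A] plus [B], then [M] has the same Hom dimensions as [tauinv A] plus [tauinv B].
    Hence it is a summand of this sum and, by locality, of one of the two terms; nothing is then
    left for Hom out of the other term, so the corresponding summand of [tau M] is zero. *)
Lemma tau_indec M : indecomposable M -> ~ rep_is0 (tau M) -> indecomposable (tau M).
Proof.
move=> ind nz; have np := indec_noproj ind nz; split=> // A B /risoP iAB.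
have hB X : hd M X = hd (rsum (tauinv A) (tauinv B)) X.
  by rewrite hd_rsuml !hd_tauinv // -ed_rsumr // hd_ed_tau // (iso_edr _ _ iAB).
have [f [g [hf hg u]]] := bongartz ind hB.
have [f1 [f2 [hf1 hf2 fE]]] := rin_ex hf; have [g1 [g2 [hg1 hg2 gE]]] := rout_ex hg.
have [|v hv [uv _]] := unit_inv _ u; first exact: hom_comp.
have emb A' B' : iso (tau M) (rsum A' B') ->
   (forall X, hd (tauinv A') X + hd (tauinv B') X = hd M X)%N ->
   (forall X, hd M X <= hd (tauinv A') X)%N -> rep_is0 B'.
  move=> i e l; apply: hd_id_eq0; apply/eqP; rewrite -leqn0.
  apply: leq_trans (_ : hd B' (tau M) <= 0)%N.
    rewrite (iso_hdr _ i) hd_rsumr; lia.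
  rewrite auslander_reiten // -hd_tauinv //; have := e M; have := l M; lia.
have e12 i : f1 i *m g1 i *m v i + f2 i *m g2 i *m v i = 1%:M.
  by rewrite -mulmxDl -mul_row_col -fE -gE uv.
case: (@indec_local _ _ _ (gcomp (gcomp f1 g1) v) (gcomp (gcomp f2 g2) v) ind) => //.
- by do 2! [apply: hom_comp => //].
- by do 2! [apply: hom_comp => //].
- move=> u1; right; apply: (emb A B iAB).
    by move=> X; rewrite hB hd_rsuml.
  move=> X; apply: (@summand_hd _ _ f1 g1) => // i.
  by have := u1 i; rewrite /gcomp unitmx_mul => /andP[].
move=> u2; left; apply: (emb B A).
- by apply: iso_trans iAB _; apply: rsumC.
- by move=> X; rewrite hB hd_rsuml addnC.
move=> X; apply: (@summand_hd _ _ f2 g2) => // i.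
by have := u2 i; rewrite /gcomp unitmx_mul => /andP[].
Qed.

End Coxeter.

(* [d] is a sincere radical vector of the Tits form with an entry 1; the last
   clause expresses the connectedness of [Q]. *)
Definition tame_data (Q : quiver) (d : 'I_(nvert Q) -> int) : Prop :=
  [/\ forall i, 0 < d i, exists i, d i = 1,
      forall i, 2 * d i =
        \sum_a ((src a == i)%:Z * d (tgt a) + (tgt a == i)%:Z * d (src a))
    & forall z : 'I_(nvert Q) -> int,
        (forall a, d (tgt a) * z (src a) = d (src a) * z (tgt a)) ->
        forall i j, d j * z i = d i * z j].

Lemma tame_data_op (Q : quiver) (d : 'I_(nvert Q) -> int) :
  tame_data d -> @tame_data (qop Q) d.
Proof.
case=> h1 h2 h3 h4; split=> // [i|z hz]; last by apply: h4 => a; rewrite (hz a).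
by rewrite h3; apply: eq_bigr => a _; rewrite addrC.
Qed.

(** * The Tits form *)

Section TitsForm.
Variables (Q : quiver) (d : 'I_(nvert Q) -> int).
Hypothesis td : tame_data d.
Implicit Types x y z : 'I_(nvert Q) -> int.

Lemma d_gt0 i : 0 < d i. Proof. by case: td. Qed.

Lemma sum_ends (R : comNzRingType) (F G : 'I_(nvert Q) -> R) (u v : 'I_(narr Q) -> R) :
  \sum_a (F (src a) * u a + G (tgt a) * v a) =
  \sum_i \sum_a ((src a == i)%:R * (F i * u a) + (tgt a == i)%:R * (G i * v a)).
Proof.
rewrite exchange_big /=; apply: eq_bigr => a _; rewrite big_split /=; congr (_ + _).
  rewrite (bigD1 (src a)) //= eqxx mul1r big1 ?addr0 // => j nj.
  by rewrite eq_sym (negPf nj) mul0r.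
rewrite (bigD1 (tgt a)) //= eqxx mul1r big1 ?addr0 // => j nj.
by rewrite eq_sym (negPf nj) mul0r.
Qed.

Lemma euler_rad x : euler d x = - euler x d.
Proof.
apply/eqP; rewrite -addr_eq0 /euler addrACA -opprD -!big_split /= subr_eq0; apply/eqP.
transitivity (\sum_a (x (src a) * d (tgt a) + x (tgt a) * d (src a))); last first.
  by apply: eq_bigr => a _; ring.
rewrite sum_ends; apply: eq_bigr => i _.
transitivity (x i * (2 * d i)); first by ring.
case: td => _ _ -> _; rewrite mulr_sumr; apply: eq_bigr => a _; ring.
Qed.

Lemma euler_dd : euler d d = 0.
Proof. by have := euler_rad d; lia. Qed.

(** Completing squares with the null vector: the neighbours of [i] sum to [2 * d i], so the diagonal
    terms at [i] add up to [2 * x i ^+ 2]. *)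
Lemma tits_squares x : (2 * euler x x)%:~R =
  \sum_a (d (tgt a) * x (src a) - d (src a) * x (tgt a))%:~R ^+ 2
          / (d (src a) * d (tgt a))%:~R :> rat.
Proof.
have dn i : (d i)%:~R != 0 :> rat by rewrite intr_eq0; have := d_gt0 i; lia.
have e a : (d (tgt a) * x (src a) - d (src a) * x (tgt a))%:~R ^+ 2
          / (d (src a) * d (tgt a))%:~R =
   ((x (src a))%:~R ^+ 2 / (d (src a))%:~R * (d (tgt a))%:~R
   + (x (tgt a))%:~R ^+ 2 / (d (tgt a))%:~R * (d (src a))%:~R)
   - 2 * (x (src a) * x (tgt a))%:~R :> rat.
  rewrite !rmorphB !rmorphM /=; field; by rewrite !dn.
under [RHS]eq_bigr => a _ do rewrite e.
rewrite sumrB (sum_ends (fun i => (x i)%:~R ^+ 2 / (d i)%:~R) (fun i => (x i)%:~R ^+ 2 / (d i)%:~R)).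
rewrite /euler mulrBr rmorphB /= !rmorphM /= !rmorph_sum /= !mulr_sumr; congr (_ - _).
apply: eq_bigr => i _.
transitivity ((x i)%:~R ^+ 2 / (d i)%:~R * (2 * d i)%:~R : rat).
  by rewrite !rmorphM /=; field.
case: td => _ _ -> _; rewrite rmorph_sum mulr_sumr; apply: eq_bigr => a _.
by rewrite rmorphD !rmorphM /=; case: (src a == i); case: (tgt a == i); rewrite /=; ring.
Qed.

Lemma tits_term_ge0 x a : 0 <= (d (tgt a) * x (src a) - d (src a) * x (tgt a))%:~R ^+ 2
          / (d (src a) * d (tgt a))%:~R :> rat.
Proof.
apply: divr_ge0; first exact: sqr_ge0.
by rewrite ler0z; have := d_gt0 (src a); have := d_gt0 (tgt a); nia.
Qed.

Lemma tits_ge0 x : 0 <= euler x x.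
Proof.
have : 0 <= (2 * euler x x)%:~R :> rat.
  by rewrite tits_squares; apply: sumr_ge0 => a _; apply: tits_term_ge0.
rewrite ler0z; lia.
Qed.

Lemma tits_bound x a : (d (tgt a) * x (src a) - d (src a) * x (tgt a)) ^+ 2
  <= 2 * euler x x * (d (src a) * d (tgt a)).
Proof.
have dd : 0 < d (src a) * d (tgt a) by rewrite mulr_gt0 // d_gt0.
rewrite -(ler_int rat) [X in _ <= X]rmorphM rmorphXn /= -ler_pdivrMr ?ltr0z //.
rewrite tits_squares (bigD1 a) //= lerDl; apply: sumr_ge0 => b _.
exact: tits_term_ge0.
Qed.

Lemma tits_eq0 x : euler x x = 0 -> exists t, forall i, x i = t * d i.
Proof.
move=> q0; case: (td) => _ [i0 e0] _ con; exists (x i0) => i.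
rewrite mulrC -con ?e0 ?mul1r // => a.
have := tits_bound x a; rewrite q0 mulr0 mul0r => h.
by apply/eqP; rewrite -subr_eq0 -sqrf_eq0 eq_le h sqr_ge0.
Qed.

(** For a fixed Tits value the integers [D n a] are bounded by [tits_bound], so two members of the
    sequence share all of them; by connectedness these members differ by a multiple of [d]. *)
Lemma orbit_periodic (x : nat -> 'I_(nvert Q) -> int) v :
  (forall n, euler (x n) (x n) = v) ->
  exists n p t, (0 < p)%N /\ forall i, x (n + p)%N i = x n i + t * d i.
Proof.
move=> xv.
pose D n a : int := d (tgt a) * x n (src a) - d (src a) * x n (tgt a).
(* A crude bound: [tits_bound] bounds squares, and an integer is at most its square in absolute
   value. *)
pose B := (\sum_a `|(2 * v * (d (src a) * d (tgt a)))%R|)%N.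
have Db n a : - (B%:Z) <= D n a <= B%:Z.
  have := tits_bound (x n) a; rewrite -/(D n a) xv => h.
  have lB : (`|(2 * v * (d (src a) * d (tgt a)))%R| <= B)%N.
    by rewrite /B (bigD1 a) //= leq_addr.
  nia.
pose F (n : 'I_#|{ffun 'I_(narr Q) -> 'I_(B + B).+1}|.+1) : {ffun 'I_(narr Q) -> 'I_(B + B).+1} :=
  [ffun a => inord (absz (D n a + B%:Z))].
have /injectivePn[m [n nmn e]] : ~~ injectiveb F.
  by apply/injectiveP => /leq_card; rewrite card_ord ltnn.
have {}e a : D m a = D n a.
  have /ffunP/(_ a) := e; rewrite !ffunE => /(congr1 val) /=.
  have := Db m a; have := Db n a => h1 h2; rewrite !inordK; lia.
wlog l : m n nmn e / (m < n)%N.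
  move=> h; have := neq_ltn m n; rewrite -val_eqE in nmn; rewrite nmn => /esym/orP[l|l].
    exact: (h m n).
  by apply: (h n m) => //; rewrite eq_sym.
case: (td) => _ [i0 e0] _ con.
exists m, (n - m)%N, (x n i0 - x m i0); rewrite subn_gt0 l; split=> // i.
rewrite subnKC ?(ltnW l) //.
have := con (fun i => x n i - x m i) _ i i0; rewrite e0 mul1r => h.
apply/eqP; rewrite addrC -subr_eq mulrC; apply/eqP/h => a.
have := e a; rewrite /D; nia.
Qed.

End TitsForm.

(** * The sign of the defect *)

Section Defect.
Variables (k : finFieldType) (Q : quiver) (d : 'I_(nvert Q) -> int).
Hypotheses (acy : acyclic Q) (td : tame_data d).
Implicit Types M N X Y A B C K L R S : rep k Q.

Lemma cox_d : cox k d =1 d.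
Proof. by move=> i; rewrite /cox (euler_rad td) euler_projrep // opprK. Qed.

Lemma euler_d_cox x : euler d (cox k x) = euler d x.
Proof. by rewrite euler_cox // (euler_rad td). Qed.

Lemma nonpreproj_tau M : indecomposable M -> ~ preprojective M ->
  [/\ noproj M, indecomposable (tau M) & ~ preprojective (tau M)].
Proof.
move=> ind np; have nz : ~ rep_is0 (tau M) by move=> z; apply: np; exists 1%N.
split; [exact: indec_noproj | exact: tau_indec |].
by case=> n z; apply: np; exists n.+1; rewrite iterSr.
Qed.

Lemma defect_tau M : noproj M -> defect d (tau M) = defect d M.
Proof. by move=> np; rewrite /defect (euler_ext (frefl _) (dim_tau np)) euler_d_cox. Qed.

(** Sum the dimension vectors of the tau-orbit over a period modulo [d]: the sum [z] satisfies
    [cox z = z + t * d], with [t >= 0] because dimensions are nonnegative. Pairing with [z] gives 2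
    <z, z> = t * p * defect M. If [t > 0], semidefiniteness gives the sign; if [t = 0], [z] is a
    multiple of [d] and the defect is 0. *)
Lemma defect_nonpreproj M : indecomposable M -> ~ preprojective M -> 0 <= defect d M.
Proof.
move=> ind np; pose T n := iter n (@tau k Q) M.
have T1 n : [/\ noproj (T n), indecomposable (T n) & ~ preprojective (T n)].
  elim: n => [|n [a b c]] /=; first by case: (nonpreproj_tau ind np).
  by have [a' b' c'] := nonpreproj_tau b c; case: (nonpreproj_tau b' c').
pose x n := dimvec (T n).
have xS n : x n.+1 =1 cox k (x n) by apply: dim_tau; case: (T1 n).
have xq n : euler (x n) (x n) = euler (x 0%N) (x 0%N).
  by elim: n => // n <-; rewrite (euler_ext (xS n) (xS n)) euler_cox2.
have xd n : euler d (x n) = defect d M.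
  by elim: n => // n <-; rewrite (euler_ext (frefl _) (xS n)) euler_d_cox.
have [n [p [t [p0 per]]]] := orbit_periodic td xq.
have per' m i : x (n + m + p)%N i = x (n + m)%N i + t * d i.
  elim: m i => [|m IH] i; first by rewrite addn0.
  rewrite addnS addSn (xS _ i) (xS _ i) (cox_ext k IH) cox_add.
  by rewrite (cox_scale k t d i) cox_d.
have perj j i : x (n + j * p)%N i = x n i + j%:Z * t * d i.
  elim: j => [|j IH]; first by rewrite mul0n addn0 mul0r mul0r addr0.
  by rewrite mulSn [(p + _)%N]addnC addnA per' IH; lia.
have t0 : 0 <= t.
  have [i0 _] : exists i, d i = 1 by case: td.
  rewrite leNgt; apply/negP => tn.
  have := perj (`|x n i0|.+1)%N i0; have : 0 <= x (n + `|x n i0|.+1 * p)%N i0 by [].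
  have : 0 <= x n i0 by []; have := d_gt0 td i0; nia.
pose z : 'I_(nvert Q) -> int := fun i => \sum_(j < p) x (n + j)%N i.
have zc : cox k z =1 (fun i => z i + t * d i).
  move=> i; have -> : cox k z i = \sum_(j < p) x (n + j.+1)%N i.
    rewrite /cox /z -(euler_op _ (fun i => _)) euler_sumr -sumrN; apply: eq_bigr => j _.
    by rewrite euler_op addnS xS.
  have := per i; rewrite /z; move: p0; case: (p) => // p' _ e.
  rewrite big_ord_recr /= e [\sum_(j < p'.+1) _]big_ord_recl /= addn0.
  under [in RHS]eq_bigr do rewrite /bump add1n.
  ring.
have e : euler z (cox k z) = euler z z + t * euler z d.
  by rewrite (euler_ext (frefl _) zc) euler_addr euler_scaler.
rewrite euler_cox // in e; have zd : euler d z = p%:Z * defect d M.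
  rewrite euler_sumr; under eq_bigr do rewrite xd.
  by rewrite sumr_const card_ord -mulr_natl; congr (_ * _); rewrite natz.
have q0 := tits_ge0 td z; have r := euler_rad td z.
have [t1|t1] : t = 0 \/ 0 < t by lia.
  have [s zs] := tits_eq0 td (x := z) ltac:(nia).
  have : euler d z = 0 by rewrite (euler_ext (frefl _) zs) euler_scaler (euler_dd td) mulr0.
  nia.
nia.
Qed.

(** Otherwise each vertex of the support receives an arrow from the support, and walking backwards
    gives arbitrarily long paths. *)
Lemma source_ex M : ~ rep_is0 M ->
  exists2 i, rdim M i <> 0%N & forall a, tgt a = i -> rdim M (src a) = 0%N.
Proof.
move=> /not_is0[i0 h0]; apply: NNPP => n.
have st i : rdim M i <> 0%N -> exists2 a, tgt a = i & rdim M (src a) <> 0%N.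
  move=> hi; apply: NNPP => m; apply: n; exists i => // a ea.
  by apply: NNPP => l; apply: m; exists a.
have long m : exists p j, [/\ size p = m, qpath j p i0 & rdim M j <> 0%N].
  elim: m => [|m [p [j [sp qp hj]]]]; first by exists [::], i0; rewrite /= eqxx.
  have [a ea ha] := st j hj; exists (a :: p), (src a).
  by rewrite /= sp eqxx ea.
have [p [j [sp /(qpath_size acy)]]] := long (nvert Q).
by rewrite sp ltnn.
Qed.

Definition zero_rep (e : 'I_(nvert Q) -> nat) : rep k Q := @Rep k Q e (fun=> 0).

(** At the vertex given by [source_ex] nothing acts into [M], so a linear map there, extended by 0,
    is a homomorphism. *)
Lemma hd_zero_rep M e : ~ rep_is0 M -> (forall i, 0 < e i)%N -> hd M (zero_rep e) <> 0%N.
Proof.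
move=> /source_ex[i hi hs] e0.
pose f : gm M (zero_rep e) := fun j => \matrix_(x, y) (j == i)%:R.
apply: (@hd_pos _ _ _ _ f i).
  move=> a; rewrite mulmx0; have [ea|na] := eqVneq (tgt a) i.
    by apply/matrixP=> -[x hx]; exfalso; move: hx; rewrite (hs a ea).
  have -> : f (tgt a) = 0 by apply/matrixP=> x y; rewrite !mxE (negPf na).
  by rewrite mulmx0.
have x0 : (0 < rdim M i)%N by lia.
move/matrixP=> /(_ (Ordinal x0) (Ordinal (e0 i))); rewrite !mxE eqxx => /eqP.
by rewrite oner_eq0.
Qed.

(** The semisimple module of dimension vector [d]; Hom into it measures the defect of a
    projective. *)
Definition d_rep := zero_rep (fun i => `|d i|%N).
Lemma dimvec_d_rep : dimvec d_rep =1 d.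
Proof. by move=> i; rewrite /dimvec /=; have := d_gt0 td i; lia. Qed.

Lemma hd_proj_d M : rep_is0 (tau M) -> (hd M d_rep)%:Z = - defect d M.
Proof.
move/(tau_is0 acy)=> e0; have := hd_ed M d_rep; rewrite e0.
rewrite (euler_ext (frefl _) dimvec_d_rep) /defect (euler_rad td); lia.
Qed.

Lemma defect_proj M : ~ rep_is0 M -> rep_is0 (tau M) -> defect d M < 0.
Proof.
move=> nz z; have := hd_proj_d z; have : hd M d_rep <> 0%N.
  by apply: hd_zero_rep => // i; have := d_gt0 td i; lia.
lia.
Qed.

Lemma preproj_ind (Pr : rep k Q -> Prop) :
  (forall M, indecomposable M -> rep_is0 (tau M) -> Pr M) ->
  (forall M, indecomposable M -> noproj M -> indecomposable (tau M) ->
     preprojective (tau M) -> Pr (tau M) -> Pr M) ->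
  forall M, indecomposable M -> preprojective M -> Pr M.
Proof.
move=> h0 hS M ind [n]; elim: n M ind => [|n IH] M ind; first by move=> z; case: ind.
rewrite iterSr => z; have [z1|nz] := classic (rep_is0 (tau M)); first exact: h0.
have ti := tau_indec acy ind nz.
by apply: hS => //; [exact: indec_noproj | exists n | exact: IH].
Qed.

Lemma defect_preproj M : indecomposable M -> preprojective M -> defect d M < 0.
Proof.
move: M; apply: preproj_ind => [M ind z|M ind np ti _]; first by apply: defect_proj ind.1 z.
by rewrite defect_tau.
Qed.

(** Applying [tau] to both modules preserves Hom out of [X] and eventually kills [M]. *)
Lemma hd_nonpreproj_preproj X M : indecomposable X -> ~ preprojective X ->
  preprojective M -> hd X M = 0%N.
Proof.
move=> ind np [n]; elim: n X M ind np => [|n IH] X M ind np; first exact: hd_is0r.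
rewrite iterSr => z; have [nX ti tn] := nonpreproj_tau ind np.
by rewrite (hd_tau acy _ nX); apply: IH.
Qed.

End Defect.

(** * Preprojective, regular and preinjective modules by defect *)

Section Trichotomy.
Variables (k : finFieldType) (Q : quiver) (d : 'I_(nvert Q) -> int).
Hypotheses (acy : acyclic Q) (td : tame_data d).
Implicit Types M N X Y A B C K L R S : rep k Q.
Let acy' := acyclic_op acy.
Let td' := tame_data_op td.

Lemma defect_dual M : @defect k (qop Q) d (rdual M) = - defect d M.
Proof. by rewrite /defect euler_op (euler_rad td) opprK. Qed.

Lemma defect_nonpreinj M : indecomposable M -> ~ preinjective M -> defect d M <= 0.
Proof.
move=> ind /preinjective_dual np; have := defect_nonpreproj acy' td' (indec_dual ind) np.
by rewrite defect_dual; lia.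
Qed.

Lemma defect_preinj M : indecomposable M -> preinjective M -> 0 < defect d M.
Proof.
move=> ind /preinjective_dual np; have := defect_preproj acy' td' (indec_dual ind) np.
by rewrite defect_dual; lia.
Qed.

Lemma hd_preinj_nonpreinj M X : preinjective M -> indecomposable X -> ~ preinjective X ->
  hd M X = 0%N.
Proof.
move=> /preinjective_dual pM ind /preinjective_dual nX; rewrite -hd_dual.
exact: hd_nonpreproj_preproj (indec_dual ind) nX pM.
Qed.

Lemma regular_defect M : indecomposable M -> regular M <-> defect d M = 0.
Proof.
move=> ind; split=> [[a b]|e].
  have := defect_nonpreproj acy td ind a; have := defect_nonpreinj ind b; lia.
split=> p; first by have := defect_preproj acy td ind p; rewrite e.
by have := defect_preinj ind p; rewrite e.
Qed.

Lemma preproj_defect M : indecomposable M -> defect d M < 0 -> preprojective M.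
Proof.
move=> ind e; apply: NNPP => np; have := defect_nonpreproj acy td ind np; lia.
Qed.

(* [tf] and [rg] describe preprojective and regular modules through the defects
   of their submodules, which is all that is needed of the two classes below. *)
Definition tf M := forall N (f : gm N M), mono f -> ~ rep_is0 N -> defect d N < 0.
Definition rg M := defect d M = 0 /\ forall N (f : gm N M), mono f -> defect d N <= 0.

Lemma ses_defect A B C (f : gm A B) (g : gm B C) : ses f g ->
  defect d B = defect d A + defect d C.
Proof. by move=> s; rewrite /defect (euler_ext (frefl _) (ses_dimvec s)) euler_addr. Qed.

Lemma iso_defect M N : iso M N -> defect d M = defect d N.
Proof. by move/iso_dim=> e; apply: euler_ext => // i; rewrite /dimvec e. Qed.

Lemma defect_is0 M : rep_is0 M -> defect d M = 0.
Proof.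
by move=> z; rewrite /defect -(euler0r d); apply: euler_ext => // i; rewrite /dimvec z.
Qed.

(** Induction on the total dimension; it stands in for decomposing the submodules of [M] into
    indecomposables. *)
Lemma sub_indec_ind M (Pr : rep k Q -> Prop) :
  (forall N, rep_is0 N -> Pr N) ->
  (forall N A B, iso N (rsum A B) -> ~ rep_is0 A -> ~ rep_is0 B -> Pr A -> Pr B -> Pr N) ->
  (forall N (f : gm N M), mono f -> indecomposable N -> Pr N) ->
  forall N (f : gm N M), mono f -> Pr N.
Proof.
move=> P0 PD Pi N; have [n] := ubnP (\sum_i rdim N i)%N.
elim: n N => // n IH N; rewrite ltnS => sN f mf.
have [z|nz] := classic (rep_is0 N); first exact: P0.
have [ind|ni] := classic (indecomposable N); first exact: Pi mf ind.
have [A [B [i nA nB]]] := not_indec nz ni.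
have [h [mh _]] := iso_sym i.
have dimN : (\sum_i rdim N i = \sum_i rdim A i + \sum_i rdim B i)%N.
  by rewrite -big_split; apply: eq_bigr => j _; rewrite (iso_dim i).
have pos (X : rep k Q) : ~ rep_is0 X -> (0 < \sum_i rdim X i)%N.
  by move=> /not_is0[j hj]; rewrite (bigD1 j) //=; lia.
have [pA pB] := (pos _ nA, pos _ nB).
apply: (PD N A B) => //.
  apply: (IH A _ (gcomp (@inl _ _ A B) (gcomp h f))); first lia.
  by apply: mono_comp (mono_inl _ _) (mono_comp mh mf).
apply: (IH B _ (gcomp (@inr _ _ A B) (gcomp h f))); first lia.
by apply: mono_comp (mono_inr _ _) (mono_comp mh mf).
Qed.

Lemma mono_hd_pos N M (f : gm N M) : mono f -> ~ rep_is0 N -> hd N M <> 0%N.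
Proof.
move=> [hf mf] /not_is0[i hi]; apply: (hd_pos hf (i := i)) => e.
by have := mf i; rewrite e /row_free mxrank0; lia.
Qed.

Lemma preproj_tf M : indecomposable M -> preprojective M -> tf M.
Proof.
move=> ind pM; have h N (f : gm N M) : mono f -> indecomposable N -> defect d N < 0.
  move=> mf iN; apply: defect_preproj => //; apply: NNPP => np.
  by apply: (mono_hd_pos mf iN.1); apply: hd_nonpreproj_preproj.
move=> N f mf; move: N f mf; apply: sub_indec_ind => // [N A B i nA nB hA hB _|N f mf iN _].
  by rewrite (iso_defect i) (ses_defect (ses_inl A B)); have := hA nA; have := hB nB; lia.
exact: h mf iN.
Qed.

Lemma regular_rg M : indecomposable M -> regular M -> rg M.
Proof.
move=> ind rM; split; first exact/regular_defect.
move=> N f mf; move: N f mf; apply: sub_indec_ind => [N z|N A B i nA nB hA hB|N f mf iN].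
- by rewrite defect_is0.
- by rewrite (iso_defect i) (ses_defect (ses_inl A B)); lia.
apply: defect_nonpreinj => // pN; apply: (mono_hd_pos mf iN.1).
exact: hd_preinj_nonpreinj pN ind rM.2.
Qed.

End Trichotomy.

(** * Regular modules and modules of defect -1 *)

Section Classes.
Variables (k : finFieldType) (Q : quiver) (d : 'I_(nvert Q) -> int).
Hypotheses (acy : acyclic Q) (td : tame_data d).
Implicit Types M N X Y A B C I K L R S T U V : rep k Q.
Notation defect := (defect d).
Notation rg := (rg d).
Notation tf := (tf d).

Lemma rg_sub M N (f : gm N M) : rg M -> mono f -> defect N = 0 -> rg N.
Proof.
move=> [_ h] mf e; split=> // X g mg; exact: h (mono_comp mg mf).
Qed.

Lemma rg_quo_ge M Y (p : gm M Y) : rg M -> epi p -> 0 <= defect Y.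
Proof.
move=> [e h] ep; have [K [j s]] := ker_epi_ses ep; have := ses_defect d s.
by rewrite e; have [mj _ _] := s; have := h _ _ mj; lia.
Qed.

Lemma rg_quo M Y (p : gm M Y) : rg M -> epi p -> defect Y = 0 -> rg Y.
Proof.
move=> rM ep e; split=> // X j mj; have [C [q s]] := cok_mono_ses mj.
have [_ eq _] := s; have := rg_quo_ge rM (epi_comp ep eq).
by have := ses_defect d s; lia.
Qed.

Lemma iso_rg M N : iso M N -> rg M -> rg N.
Proof.
move=> i [e h]; split; first by rewrite -(iso_defect _ i).
have [f [mf _]] := iso_sym i; move=> X g mg; exact: h (mono_comp mg mf).
Qed.

Lemma is0_rg M : rep_is0 M -> rg M.
Proof.
move=> z; split; first exact: defect_is0.
by move=> N f mf; rewrite defect_is0 // => i; have := mono_dim i mf; rewrite z; lia.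
Qed.

Lemma tf_sub M N (f : gm N M) : tf M -> mono f -> tf N.
Proof. by move=> h mf X g mg; apply: h (mono_comp mg mf). Qed.

Lemma img_nz M N I (f : gm M N) (p : gm M I) (j : gm I N) l :
  f l = p l *m j l -> f l <> 0 -> ~ rep_is0 I.
Proof. by move=> e nz z; apply: nz; rewrite e (is0_mxr p) ?mul0mx. Qed.

Lemma hd_rg_tf M N : rg M -> tf N -> hd M N = 0%N.
Proof.
move=> rM tN; apply/hd_eq0 => f hf i; apply: NNPP => nz.
have [I [p [j [ep mj e]]]] := img_ex hf.
have := tN _ _ mj (img_nz (e i) nz); have := rg_quo_ge rM ep; lia.
Qed.

Lemma rg_img M N I (p : gm M I) (j : gm I N) : rg M -> rg N -> epi p -> mono j -> rg I.
Proof.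
move=> rM rN ep mj; apply: (rg_sub rN mj).
have := rg_quo_ge rM ep; have := rN.2 _ _ mj; lia.
Qed.

(* The simple objects of the category of regular modules. *)
Definition smp S := [/\ rg S, ~ rep_is0 S
  & forall N (f : gm N S), mono f -> defect N = 0 -> rep_is0 N \/ epi f].

Definition dimtot M := (\sum_i rdim M i)%N.

Lemma dimtot_gt0 M : ~ rep_is0 M -> (0 < dimtot M)%N.
Proof. by move=> /not_is0[j hj]; rewrite /dimtot (bigD1 j) //=; lia. Qed.

Lemma ses_dimtot A B C (f : gm A B) (g : gm B C) : ses f g ->
  dimtot B = (dimtot A + dimtot C)%N.
Proof. by move=> s; rewrite /dimtot -big_split; apply: eq_bigr => i _; rewrite (ses_dim i s). Qed.

Lemma ses_is0r_epi A B C (f : gm A B) (g : gm B C) : ses f g -> rep_is0 C -> epi f.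
Proof.
by move=> s z; have [mf _ _] := s; apply: mono_dim_epi => // i; rewrite (ses_dim i s) z addn0.
Qed.
Lemma ses_is0l_mono A B C (f : gm A B) (g : gm B C) : ses f g -> rep_is0 A -> mono g.
Proof.
by move=> s z; have [_ eg _] := s; apply: epi_dim_mono => // i; rewrite (ses_dim i s) z.
Qed.

Lemma smp_sub_ex M : rg M -> ~ rep_is0 M -> exists S (f : gm S M), mono f /\ smp S.
Proof.
have [n] := ubnP (dimtot M); elim: n M => // n IH M; rewrite ltnS => lM rM nz.
have [sM|ns] := classic (smp M); first by exists M, (@gid _ _ M); split=> //; apply: mono_id.
have [N [f [mf e [nzN nf]]]] : exists N (f : gm N M),
    [/\ mono f, defect N = 0 & ~ rep_is0 N /\ ~ epi f].
  apply: NNPP => h; apply: ns; split=> // N f mf e; apply: NNPP => /not_or_and[a b].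
  by apply: h; exists N, f.
have [C [q s]] := cok_mono_ses mf.
have nzC : ~ rep_is0 C by move=> z; apply/nf/(ses_is0r_epi s z).
have [|||S [g [mg sS]]] := IH N; [|exact: rg_sub mf e|by []|].
  by have := ses_dimtot s; have := dimtot_gt0 nzC; lia.
by exists S, (gcomp g f); split=> //; apply: mono_comp.
Qed.

Lemma smp_quo_ex M : rg M -> ~ rep_is0 M -> exists S (p : gm M S), epi p /\ smp S.
Proof.
have [n] := ubnP (dimtot M); elim: n M => // n IH M; rewrite ltnS => lM rM nz.
have [sM|ns] := classic (smp M); first by exists M, (@gid _ _ M); split=> //; apply: epi_id.
have [N [f [mf e [nzN nf]]]] : exists N (f : gm N M),
    [/\ mono f, defect N = 0 & ~ rep_is0 N /\ ~ epi f].
  apply: NNPP => h; apply: ns; split=> // N f mf e; apply: NNPP => /not_or_and[a b].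
  by apply: h; exists N, f.
have [C [q s]] := cok_mono_ses mf; have [_ eq _] := s.
have nzC : ~ rep_is0 C by move=> z; apply/nf/(ses_is0r_epi s z).
have rC : rg C by apply: (rg_quo rM eq _); have := ses_defect d s; rewrite e rM.1; lia.
have [|||S [g [mg sS]]] := IH C; [|by []|by []|].
  by have := ses_dimtot s; have := dimtot_gt0 nzN; lia.
by exists S, (gcomp q g); split=> //; apply: epi_comp.
Qed.

Lemma smp_epi M S (f : gm M S) i : rg M -> smp S -> hom f -> f i <> 0 -> epi f.
Proof.
move=> rM [rS nz sS] hf nf; have [I [p [j [ep mj e]]]] := img_ex hf.
have rI := rg_img rM rS ep mj.
have [z|ej] := sS _ _ mj rI.1; first by have := img_nz (e i) nf.
by have := epi_comp ep ej => -[_ h]; split=> // l; rewrite e; apply: h.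
Qed.

Lemma smp_mono M S (f : gm S M) i : rg M -> smp S -> hom f -> f i <> 0 -> mono f.
Proof.
move=> rM [rS nz sS] hf nf; have [I [p [j [ep mj e]]]] := img_ex hf.
have rI := rg_img rS rM ep mj; have [K [l s]] := ker_epi_ses ep; have [ml _ _] := s.
have eK : defect K = 0 by have := ses_defect d s; rewrite rI.1 rS.1; lia.
have [z|el] := sS _ _ ml eK.
  by have [_ h] := mono_comp (ses_is0l_mono s z) mj; split=> // v; rewrite e; apply: h.
exfalso; apply: (img_nz (e i) nf) => v.
have := ses_dim v s; have := epi_dim v el; lia.
Qed.

Lemma smp_indec S : smp S -> indecomposable S.
Proof.
move=> [rS nz sS]; split=> // A B /risoP/iso_sym[f [mf ef]].
have mA := mono_comp (mono_inl A B) mf; have mB := mono_comp (mono_inr A B) mf.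
have e := ses_defect d (ses_inl A B).
rewrite (iso_defect d (ex_intro _ f (conj mf ef))) rS.1 in e.
have hA := rS.2 _ _ mA; have hB := rS.2 _ _ mB.
have [zA|eA] := sS _ _ mA ltac:(lia); first by left.
right=> i; have := epi_dim i eA; have := mono_dim i mf; rewrite /=; lia.
Qed.

Lemma iso_smp M N : iso M N -> smp M -> smp N.
Proof.
move=> i [rM nz sM]; split; first exact: iso_rg i rM.
  by move=> z; apply: nz => l; rewrite (iso_dim i).
have [f [mf ef]] := iso_sym i; move=> X g mg e.
have [z|eg] := sM _ _ (mono_comp mg mf) e; [by left | right].
apply: mono_dim_epi => // l; rewrite -(iso_dim i); exact: epi_dim eg.
Qed.

Lemma tf_projrep i : tf (projrep k i).
Proof.
move=> N f mf nz; apply: defect_proj => //; apply/(tau_is0 acy) => X.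
by apply/eqP; rewrite -leqn0 -(ed_projrep acy i X) (ed_mono acy X mf).
Qed.

Lemma rg_noproj M : rg M -> noproj M.
Proof. by move=> rM i; apply: hd_rg_tf => //; apply: tf_projrep. Qed.

Lemma rg_tau_nz M : rg M -> ~ rep_is0 M -> ~ rep_is0 (tau M).
Proof.
move=> rM nz z; have := defect_proj acy td nz z; rewrite rM.1; lia.
Qed.

Lemma rg_tau M : rg M -> indecomposable M -> rg (tau M) /\ indecomposable (tau M).
Proof.
move=> rM ind; have ti := tau_indec acy ind (rg_tau_nz rM ind.1).
split=> //; apply: regular_rg => //; apply/(regular_defect acy td) => //.
by rewrite (defect_tau acy td (rg_noproj rM)) rM.1.
Qed.

(* The preprojective modules playing the role of line bundles. *)
Definition LB L := tf L /\ defect L = -1.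

Lemma LB_nz L : LB L -> ~ rep_is0 L.
Proof. by move=> [_ e] z; rewrite defect_is0 in e. Qed.

Lemma LB_indec L : LB L -> indecomposable L.
Proof.
move=> lL; have [tL e] := lL; split; first exact: LB_nz.
move=> A B /risoP i; have [f [mf _]] := iso_sym i; apply: NNPP => /not_or_and[nA nB].
have := tL _ _ (mono_comp (mono_inl A B) mf) nA.
have := tL _ _ (mono_comp (mono_inr A B) mf) nB.
have := ses_defect d (ses_inl A B); rewrite -(iso_defect d i) e; lia.
Qed.

Lemma LB_preproj L : LB L -> preprojective L.
Proof.
move=> lL; apply: (preproj_defect acy td (LB_indec lL)); have [_ ->] := lL; lia.
Qed.

Lemma LB_intro L : indecomposable L -> defect L = -1 -> LB L.
Proof.
move=> ind e; split=> //; apply: preproj_tf => //; apply: (preproj_defect acy td ind).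
rewrite e; lia.
Qed.

Lemma LB_sub L K (j : gm K L) : LB L -> mono j -> defect K = -1 -> LB K.
Proof. by move=> [tL _] mj e; split=> //; apply: tf_sub tL mj. Qed.

(** A nonzero kernel and a nonzero image would both have defect at most -1, while the two defects
    sum to -1. *)
Lemma LB_mono L N (f : gm L N) i : LB L -> tf N -> hom f -> f i <> 0 -> mono f.
Proof.
move=> [tL eL] tN hf nf; have [I [p [j [ep mj e]]]] := img_ex hf.
have [K [l s]] := ker_epi_ses ep; have [ml _ _] := s.
have [z|nz] := classic (rep_is0 K).
  by have [_ h] := mono_comp (ses_is0l_mono s z) mj; split=> // v; rewrite e; apply: h.
have := tL _ _ ml nz; have := tN _ _ mj (img_nz (e i) nf); have := ses_defect d s.
rewrite eL; lia.
Qed.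

(** The kernel is nonzero and the image lies in a regular module, so the defect -1 can only split as
    -1 for the kernel and 0 for the image. *)
Lemma LB_rg_img L R (f : gm L R) i : LB L -> rg R -> hom f -> f i <> 0 ->
  ~ mono f -> exists I (p : gm L I) (j : gm I R) K (l : gm K L),
    [/\ ses l p, mono j, rg I, LB K & (forall i, f i = p i *m j i)].
Proof.
move=> lL rR hf nf nm; have [I [p [j [ep mj e]]]] := img_ex hf.
have [K [l s]] := ker_epi_ses ep; have [ml _ _] := s.
have nz : ~ rep_is0 K.
  move=> z; apply: nm; have [_ h] := mono_comp (ses_is0l_mono s z) mj.
  by split=> // v; rewrite e; apply: h.
have := lL.1 _ _ ml nz; have := rR.2 _ _ mj; have := ses_defect d s; rewrite lL.2 => e1 e2 e3.
have eI : defect I = 0 by lia.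
exists I, p, j, K, l; split=> //; first exact: rg_sub mj eI.
apply: LB_sub lL ml _; lia.
Qed.

Lemma LB_tau L : LB L -> ~ rep_is0 (tau L) -> LB (tau L).
Proof.
move=> lL nz; apply: LB_intro; first exact: tau_indec (LB_indec lL) nz.
by rewrite (defect_tau acy td (indec_noproj acy (LB_indec lL) nz)) lL.2.
Qed.

Lemma ed_LB_rg L R : LB L -> rg R -> ed L R = 0%N.
Proof.
move=> lL rR; rewrite -auslander_reiten //.
have [z|nz] := classic (rep_is0 (tau L)); first exact: hd_is0r.
apply: hd_rg_tf => //; exact: (LB_tau lL nz).1.
Qed.

(** Applying [tau] reduces to projective [M]. There Hom(M, d_rep) has dimension 1, and composing
    with a nonzero [v] embeds End(M) in it because nonzero endomorphisms are invertible. *)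
Lemma hd_LB L : LB L -> hd L L = 1%N.
Proof.
move=> lL; have := LB_preproj lL; have := LB_indec lL; move: (lL.2) => {lL}.
move=> e ind pL; move: L ind pL e; apply: (preproj_ind acy) => [M ind z e|M ind np ti _ IH e].
  have lM := LB_intro ind e; have h1 := hd_proj_d acy td z; rewrite e in h1.
  have [|v hv [i vi]] := @hd_neq0 _ _ M (d_rep k d); first lia.
  have le : (hd M M <= hd M (d_rep k d))%N.
    apply: (@hd_le_inj _ _ _ _ _ _ (fun f => gcomp f v)).
    - by move=> c f f' h eh j; rewrite /gcomp eh mulmxDl scalemxAl.
    - by move=> f hf; apply: hom_comp hv.
    move=> f hf f0 j; apply: NNPP => fj.
    have mf := LB_mono lM lM.1 hf fj; have ef := mono_dim_epi mf (fun=> leqnn _).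
    apply: vi; apply: (row_full_inj (ef.2 i)); by rewrite mulmx0; apply: f0.
  have : hd M M <> 0%N by move/hd_id_eq0; apply: ind.1.
  lia.
by rewrite (hd_tau acy _ np) IH // (defect_tau acy td).
Qed.

(** The value is at most dim End = 1, and it is nonzero since isotropic vectors are multiples of [d]
    and have defect 0. *)
Lemma LB_q L : LB L -> euler (dimvec L) (dimvec L) = 1.
Proof.
move=> lL; have h := hd_ed L L; rewrite (hd_LB lL) in h.
have q0 := tits_ge0 td (dimvec L).
have : euler (dimvec L) (dimvec L) <> 0; last by lia.
move/(tits_eq0 td)=> [t et]; have := lL.2.
by rewrite /Defs.defect (euler_ext (frefl _) et) euler_scaler (euler_dd td); lia.
Qed.

End Classes.

(** * Duality of the regular classes *)

Section DualClasses.
Variables (k : finFieldType) (Q : quiver) (d : 'I_(nvert Q) -> int).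
Hypotheses (td : tame_data d).
Implicit Types M N : rep k Q.

Lemma epi_of_mono_dual (N : rep k (qop Q)) M (f : gm N (rdual M)) :
  mono f -> @epi k Q M (rdual' N) (fun i => (f i)^T).
Proof.
move=> [hf mf]; split=> [a|i]; last by rewrite /row_full mxrank_tr; exact: mf.
by have := hf a; rewrite /= => /(congr1 trmx); rewrite !trmx_mul trmxK.
Qed.

Lemma epi_of_mono_dual' N (X : rep k (qop Q)) (f : gm N (rdual' X)) :
  mono f -> @epi k (qop Q) X (rdual N) (fun i => (f i)^T).
Proof.
move=> [hf mf]; split=> [a|i]; last by rewrite /row_full mxrank_tr; exact: mf.
by have := hf a; rewrite /= => /(congr1 trmx); rewrite !trmx_mul trmxK.
Qed.

Lemma defect_dual' (X : rep k (qop Q)) : defect d (rdual' X) = - @defect k (qop Q) d X.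
Proof. by rewrite -[in RHS](rdual'K X) (defect_dual td) opprK. Qed.

Lemma rg_dual M : rg d M -> @rg k (qop Q) d (rdual M).
Proof.
move=> rM; split; first by rewrite (defect_dual td) rM.1 oppr0.
move=> N f /epi_of_mono_dual/(rg_quo_ge rM); rewrite defect_dual'; lia.
Qed.

Lemma rg_dual' (X : rep k (qop Q)) : @rg k (qop Q) d X -> @rg k Q d (rdual' X).
Proof.
move=> rX; split; first by rewrite defect_dual' rX.1 oppr0.
move=> N f /epi_of_mono_dual'/(rg_quo_ge rX); rewrite (defect_dual td); lia.
Qed.

Lemma smp_dual M : smp d M -> @smp k (qop Q) d (rdual M).
Proof.
move=> [rM nz sM]; split=> //; first exact: rg_dual.
move=> N f mf e; have ep := epi_of_mono_dual mf.
have [K [j s]] := ker_epi_ses ep; have [mj _ _] := s.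
have eK : defect d K = 0.
  by have := ses_defect d s; rewrite defect_dual' rM.1 e; lia.
have [z|ej] := sM _ _ mj eK.
  right; apply: mono_dim_epi => // i; exact: (mono_dim (i : 'I_(nvert Q)) (ses_is0l_mono s z)).
by left=> i; have := @ses_dim k Q _ _ _ _ _ i s; have := @epi_dim k Q _ _ _ i ej; rewrite /=; lia.
Qed.

Lemma smp_dual' (X : rep k (qop Q)) : @smp k (qop Q) d X -> @smp k Q d (rdual' X).
Proof.
move=> [rM nz sM]; split=> //; first exact: rg_dual'.
move=> N f mf e; have ep := epi_of_mono_dual' mf.
have [K [j s]] := ker_epi_ses ep; have [mj _ _] := s.
have eK : @defect k (qop Q) d K = 0.
  by have := @ses_defect k (qop Q) d _ _ _ _ _ s; rewrite (defect_dual td) rM.1 e; lia.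
have [z|ej] := sM _ _ mj eK.
  right; apply: mono_dim_epi => // i; exact: (@mono_dim k (qop Q) _ _ _ i (ses_is0l_mono s z)).
by left=> i; have := @ses_dim k (qop Q) _ _ _ _ _ i s; have := @epi_dim k (qop Q) _ _ _ i ej; rewrite /=; lia.
Qed.

Lemma indec_dual' (X : rep k (qop Q)) : indecomposable X -> indecomposable (rdual' X).
Proof.
case=> nz h; split=> // N L /risoP/iso_dual; rewrite rdual'K rsum_dual => /iso_sym/risoP.
by move/h.
Qed.

End DualClasses.

(** * The Auslander-Reiten translate of a regular simple *)

Section Tubes.
Variables (k : finFieldType) (Q : quiver) (d : 'I_(nvert Q) -> int).
Hypotheses (acy : acyclic Q) (td : tame_data d).
Implicit Types M N X Y A B C F I K L R S T U V Z : rep k Q.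
Notation defect := (defect d).
Notation rg := (rg d).
Notation smp := (smp d).
Let acy' := acyclic_op acy.
Let td' := tame_data_op td.

Lemma rg_tauinv M : rg M -> indecomposable M -> rg (tauinv M) /\ indecomposable (tauinv M).
Proof.
move=> rM ind; have [r i] := rg_tau acy' td' (rg_dual td rM) (indec_dual ind).
by split; [exact: rg_dual' td _ r | exact: indec_dual'].
Qed.

Lemma ed_tauinv M X : rg M -> hd X M = ed (tauinv M) X.
Proof.
move=> rM; rewrite -hd_dual (hd_ed_tau acy' _ (rg_noproj acy' td' (rg_dual td rM))).
by rewrite -[RHS]ed_dual /tauinv rdual'K.
Qed.

Lemma dim_tauinv M : rg M -> dimvec (tauinv M) =1 @cox k (qop Q) (dimvec M).
Proof. by move=> rM; apply: (dim_tau (rg_noproj acy' td' (rg_dual td rM))). Qed.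

Lemma coxK x : @cox k (qop Q) (@cox k Q x) =1 x.
Proof.
move=> i; change (- @euler (qop Q) (@cox k Q x) (dimvec (@projrep k (qop Q) i)) = x i).
by rewrite euler_op euler_cox // opprK -euler_op euler_projrep.
Qed.

(** A regular simple submodule [F] of [tau T] yields, by Auslander-Reiten, a nonzero map
    [tauinv F -> T], which is onto. The dimension vector of [T] is the inverse Coxeter image of that
    of [tau T], so nothing is left for the quotient [Y]. *)
Lemma smp_tau T : smp T -> smp (tau T).
Proof.
move=> sT; have [rT nzT _] := sT.
have [rU iU] := rg_tau acy td rT (smp_indec sT).
have [F [j [mj sF]]] := smp_sub_ex rU iU.1; have [rF nzF _] := sF.
have : hd F (tau T) <> 0%N by apply: mono_hd_pos mj nzF.
rewrite auslander_reiten // -hd_tauinv // => /hd_neq0[f hf [i fi]].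
have ef := smp_epi (rg_tauinv rF (smp_indec sF)).1 sT hf fi.
have [Y [p s]] := cok_mono_ses mj; have [_ ep _] := s.
have rY : rg Y by apply: (rg_quo rU ep); have := ses_defect d s; rewrite rU.1 rF.1; lia.
have zY : rep_is0 (tauinv Y).
  move=> l; have := dim_tauinv rY l; have := dim_tauinv rF l; have := epi_dim l ef.
  have := coxK (dimvec T) l.
  rewrite -(@cox_ext k (qop Q) _ _ (dim_tau (rg_noproj acy td rT)) l).
  rewrite (@cox_ext k (qop Q) _ _ (ses_dimvec s) l) cox_add /dimvec /=; lia.
have {}zY : rep_is0 Y.
  by apply: hd_id_eq0; rewrite ed_tauinv // -hd_tauinv // hd_is0r.
apply: iso_smp sF; exists j; split=> //; exact: ses_is0r_epi s zY.
Qed.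

End Tubes.

(** * Extensions of uniserial regular modules by regular simples *)

Section Uniserial.
Variables (k : finFieldType) (Q : quiver) (d : 'I_(nvert Q) -> int).
Hypotheses (acy : acyclic Q) (td : tame_data d).
Implicit Types M N X Y A B C F I K L R S T U V Z : rep k Q.
Notation defect := (defect d).
Notation rg := (rg d).
Notation smp := (smp d).
Let acy' := acyclic_op acy.
Let td' := tame_data_op td.

Lemma smp_tauinv S : smp S -> smp (tauinv S).
Proof. by move=> /(smp_dual td)/(smp_tau acy' td')/(smp_dual' td). Qed.

(** If all maps [A -> tau C] extend, the dimensions of Hom(-, tau C) add up. They are those of
    Ext^1(C, -), so the dimensions of Hom(C, -) add up too and the identity of [C] lifts. *)
Lemma ar_section A V C (f : gm A V) (g : gm V C) : ses f g ->
  (forall h : gm A (tau C), hom h ->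
     exists2 h' : gm V (tau C), hom h' & forall i, f i *m h' i = h i) ->
  exists2 s : gm C V, hom s & forall i, s i *m g i = 1%:M.
Proof.
move=> s ext; have [mf eg z] := s.
have [_ [_ /(_ ext)]] := hd_extend (tau C) mf.1 eg z; rewrite !auslander_reiten // => le.
have [_ [l _]] := hd_lift C mf eg.1 z.
have [|t ht et] := l _ (@gid _ _ C) (@hom_id _ _ C); last by exists t.
have := ses_eulr C s; lia.
Qed.

Lemma ar_retraction A V C (f : gm A V) (g : gm V C) : ses f g ->
  (forall h : gm (tauinv A) C, hom h ->
     exists2 h' : gm (tauinv A) V, hom h' & forall i, h' i *m g i = h i) ->
  exists2 r : gm V A, hom r & forall i, f i *m r i = 1%:M.
Proof.
move=> s lft; have [mf eg z] := s.
have [_ [_ /(_ lft)]] := hd_lift (tauinv A) mf eg.1 z; rewrite !hd_tauinv // => le.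
have [_ [l _]] := hd_extend A mf.1 eg z.
have [|t ht et] := l _ (@gid _ _ A) (@hom_id _ _ A); last by exists t.
have := ses_eull A s; lia.
Qed.

(* [M] is uniserial in the category of regular modules; subobjects are
   represented by monomorphisms into [M], compared by row spaces. *)
Definition chain M := forall A B (f : gm A M) (g : gm B M), mono f -> mono g ->
  defect A = 0 -> defect B = 0 ->
  (forall i, f i <= g i)%MS \/ (forall i, g i <= f i)%MS.

Lemma rg_ker M N K (f : gm M N) (j : gm K M) : rg M -> rg N -> hom f -> mono j ->
  (forall i, (j i :=: kermx (f i))%MS) -> defect K = 0.
Proof.
move=> rM rN hf mj e; have [I [p [l [ep ml E]]]] := img_ex hf.
have s : ses j p.
  split=> // i; apply: eqmx_trans (e i) _; apply/eqmxP/andP; split; apply/sub_kermxP.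
    by apply: (row_free_inj (ml.2 i)); rewrite /= mul0mx -mulmxA -E mulmx_ker.
  by rewrite E mulmxA mulmx_ker mul0mx.
have := ses_defect d s; rewrite rM.1 (rg_img rM rN ep ml).1; lia.
Qed.

Lemma epi_right A B C (f : gm A B) (g : gm B C) : hom g -> epi (gcomp f g) -> epi g.
Proof.
move=> hg [_ e]; split=> // i; rewrite -sub1mx.
by apply: submx_trans (submxMl (f i) (g i)); rewrite sub1mx; apply: e.
Qed.

Lemma mono_left A B C (f : gm A B) (g : gm B C) : hom f -> mono (gcomp f g) -> mono f.
Proof.
move=> hf [_ e]; split=> // i; have /row_freeP[D eD] := e i.
by apply/row_freeP; exists (g i *m D); rewrite mulmxA.
Qed.

Lemma retraction_of_section A B C (f : gm A B) (g : gm B C) (s : gm C B) :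
  ses f g -> hom s -> (forall i, s i *m g i = 1%:M) ->
  exists2 r : gm B A, hom r & forall i, f i *m r i = 1%:M.
Proof.
move=> z hs e; have [mf eg ez] := z.
pose h : gm B B := gadd (@gid _ _ B) (gscale (-1) (gcomp g s)).
have hh : hom h by apply/hom_add/hom_scale/hom_comp => //; [exact: hom_id | exact: eg.1].
have [|r hr er] := fac_mono mf hh.
  move=> i; rewrite ez; apply/sub_kermxP.
  by rewrite /h /gadd /gscale /gid /gcomp scaleN1r mulmxBl mul1mx -mulmxA e mulmx1 subrr.
exists r => // i; apply: (row_free_inj (mf.2 i)); rewrite /= mul1mx -mulmxA -er.
rewrite /h /gadd /gscale /gid /gcomp scaleN1r mulmxBr mulmx1 mulmxA.
by rewrite (ses_comp0 i z) mul0mx subr0.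
Qed.

Lemma section_of_retraction A B C (f : gm A B) (g : gm B C) (r : gm B A) :
  ses f g -> hom r -> (forall i, f i *m r i = 1%:M) ->
  exists2 s : gm C B, hom s & forall i, s i *m g i = 1%:M.
Proof.
move=> z hr e; have [mf eg ez] := z.
pose h : gm B B := gadd (@gid _ _ B) (gscale (-1) (gcomp r f)).
have hh : hom h by apply/hom_add/hom_scale/hom_comp => //; [exact: hom_id | exact: mf.1].
have [|s hs es] := fac_epi eg hh.
  move=> i; rewrite -ez; apply/sub_kermxP.
  by rewrite /h /gadd /gscale /gid /gcomp scaleN1r mulmxBr mulmx1 mulmxA e mul1mx subrr.
exists s => // i; apply: (row_full_inj (eg.2 i)); rewrite mulmx1 mulmxA -es.
rewrite /h /gadd /gscale /gid /gcomp scaleN1r mulmxBl mul1mx -mulmxA.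
by rewrite (ses_comp0 i z) mulmx0 subr0.
Qed.

(** Let [A] be a proper regular submodule not contained in [U]. Then [A] maps onto [T], and [U] onto
    [W = V / A]. A nonzero map from [U] to the simple [tau T] has a kernel which, [U] being
    uniserial, contains that of [U -> W]. So it factors through [W], hence extends to [V], and the
    sequence splits. *)
Lemma chain_top U V T (f : gm U V) (g : gm V T) :
  ses f g -> rg U -> chain U -> rg V -> smp T ->
  chain V \/ exists2 s : gm T V, hom s & forall i, s i *m g i = 1%:M.
Proof.
move=> s rU cU rV sT; have [mf eg z] := s; have [rT _ _] := sT.
have [|ns] := classic (exists2 s : gm T V, hom s & forall i, s i *m g i = 1%:M); first by right.
left; have sub A (a : gm A V) : mono a -> defect A = 0 -> (forall i, a i <= f i)%MS \/ epi a.
  move=> ma eA; have rA := rg_sub rV ma eA; apply: NNPP => /not_or_and[na nea].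
  have [i ai] : exists i, a i *m g i <> 0.
    apply: NNPP => n; apply: na => i; rewrite z; apply/sub_kermxP.
    by apply: NNPP => m; apply: n; exists i.
  have ag : epi (gcomp a g) := smp_epi rA sT (hom_comp ma.1 eg.1) ai.
  have [W [p sp]] := cok_mono_ses ma; have [_ ep zp] := sp.
  have rW : rg W by apply: (rg_quo rV ep); have := ses_defect d sp; rewrite eA rV.1; lia.
  have nzW : ~ rep_is0 W by move=> z0; apply/nea/(ses_is0r_epi sp z0).
  have efp : epi (gcomp f p).
    split; first exact: hom_comp mf.1 ep.1.
    move=> j; rewrite -sub1mx; apply: submx_trans (_ : p j <= _)%MS.
      by rewrite sub1mx; apply: ep.2.
    have /submxP[X eX] : (g j <= gcomp a g j)%MS by apply: submx_full; apply: ag.2.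
    have /submxP[Y eY] : (1%:M - X *m a j <= f j)%MS.
      rewrite z; apply/sub_kermxP; by rewrite mulmxBl mul1mx -mulmxA -/(gcomp a g j) -eX subrr.
    have e1 : 1%:M = Y *m f j + X *m a j by rewrite -eY subrK.
    rewrite -[X in (X <= _)%MS]mul1mx e1 mulmxDl -[X *m a j *m _]mulmxA (ses_comp0 j sp).
    by rewrite mulmx0 addr0 -mulmxA submxMl.
  apply: ns; apply: (ar_section s) => h hh.
  have [h0|/not_all_ex_not[j hj]] := classic (forall i, h i = 0).
    exists (fun i => 0); first exact: hom0.
    by move=> l; rewrite mulmx0 h0.
  have sT' := smp_tau acy td sT; have [rT' nT' _] := sT'.
  have eh := smp_epi rU sT' hh hj.
  have [K [ka [mk ek]]] := ker_ex efp.1.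
  have [K' [kb [mk' ek']]] := ker_ex hh.
  have eK := rg_ker rU rW efp.1 mk ek; have eK' := rg_ker rU rT' hh mk' ek'.
  have le : forall i, (kermx (gcomp f p i) <= kermx (h i))%MS.
    case: (cU _ _ _ _ mk mk' eK eK') => l' i'; first by rewrite -ek -ek'.
    (* With the opposite inclusion, [U -> W] factors through a map [tau T -> W], which is nonzero
       and so injective: the kernels coincide. *)
    have [|th hth eth] := fac_epi eh efp.1.
      by move=> v; rewrite -ek' -ek.
    have [v hv] : exists v, th v <> 0.
      apply: NNPP => n; apply: nzW => v; apply/eqP; rewrite -leqn0.
      have := efp.2 v; rewrite /row_full eth (_ : th v = 0) ?mulmx0 ?mxrank0; first lia.
      by apply: NNPP => m; apply: n; exists v.
    have mth := smp_mono rW sT' hth hv.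
    apply/sub_kermxP; apply: (row_free_inj (mth.2 i')).
    by rewrite /= mul0mx -mulmxA -eth mulmx_ker.
  have [h' hh' eh'] := fac_epi efp hh le.
  exists (gcomp p h'); first exact: hom_comp ep.1 hh'.
  by move=> v; rewrite /gcomp mulmxA -/(gcomp f p v) -eh'.
move=> A B a b ma mb eA eB.
have [la|ea] := sub _ _ ma eA; last by right=> i; apply: submx_full; apply: ea.2.
have [lb|eb] := sub _ _ mb eB; last by left=> i; apply: submx_full; apply: eb.2.
have [a' ha' Ea] := fac_mono mf ma.1 la; have [b' hb' Eb] := fac_mono mf mb.1 lb.
have ma' : mono a' by apply: (mono_left (g := f)) => //; split=> [|i]; rewrite /gcomp;
   [exact: hom_comp ha' mf.1 | rewrite -Ea; apply: ma.2].
have mb' : mono b' by apply: (mono_left (g := f)) => //; split=> [|i]; rewrite /gcomp;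
   [exact: hom_comp hb' mf.1 | rewrite -Eb; apply: mb.2].
by case: (cU _ _ _ _ ma' mb' eA eB) => l; [left|right] => i; rewrite Ea Eb; apply: submxMr.
Qed.

(** Dual to [chain_top]: a nonzero regular submodule [A] not containing [S] embeds in [U]. A nonzero
    map [tauinv S -> U] is injective with simple image, which lies in that of [A] by uniseriality;
    so the map lifts to [V]. *)
Lemma chain_socle S V U (f : gm S V) (g : gm V U) :
  ses f g -> smp S -> rg V -> rg U -> chain U ->
  chain V \/ exists2 s : gm U V, hom s & forall i, s i *m g i = 1%:M.
Proof.
move=> s sS rV rU cU; have [mf eg z] := s; have [rS _ _] := sS.
have [|ns] := classic (exists2 s : gm U V, hom s & forall i, s i *m g i = 1%:M); first by right.
left; have sub A (a : gm A V) : mono a -> defect A = 0 -> rep_is0 A \/ (forall i, f i <= a i)%MS.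
  move=> ma eA; have rA := rg_sub rV ma eA; apply: NNPP => /not_or_and[nzA nfa].
  have [W [p sp]] := cok_mono_ses ma; have [_ ep zp] := sp.
  have rW : rg W by apply: (rg_quo rV ep); have := ses_defect d sp; rewrite eA rV.1; lia.
  have [i fi] : exists i, f i *m p i <> 0.
    apply: NNPP => n; apply: nfa => i; rewrite zp; apply/sub_kermxP.
    by apply: NNPP => m; apply: n; exists i.
  have mfp : mono (gcomp f p) := smp_mono rW sS (hom_comp mf.1 ep.1) fi.
  have mag : mono (gcomp a g).
    split; first exact: hom_comp ma.1 eg.1.
    move=> j; rewrite -kermx_eq0 -submx0; apply/rV_subP=> v /sub_kermxP.
    rewrite /gcomp mulmxA => /sub_kermxP; rewrite -z => /submxP[w ew].
    have w0 : w *m gcomp f p j = 0.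
      by rewrite /gcomp mulmxA -ew -mulmxA (ses_comp0 j sp) mulmx0.
    have {}w0 : w = 0 by apply: (row_free_inj (mfp.2 j)); rewrite /= mul0mx.
    have : v = 0 by apply: (row_free_inj (ma.2 j)); rewrite /= ew w0 !mul0mx.
    by move->; rewrite sub0mx.
  apply: ns.
  suff [r hr er] : exists2 r : gm V S, hom r & forall i, f i *m r i = 1%:M.
    exact: section_of_retraction s hr er.
  apply: (ar_retraction s) => h hh.
  have [h0|/not_all_ex_not[j hj]] := classic (forall i, h i = 0).
    exists (fun i => 0); first exact: hom0.
    by move=> l; rewrite mul0mx h0.
  have sT' := smp_tauinv sS; have [rT' nT' _] := sT'.
  have mh := smp_mono rU sT' hh hj.
  have le : forall i, (h i <= gcomp a g i)%MS.
    case: (cU _ _ _ _ mh mag rT'.1 eA) => // l'.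
    have [y hy ey] := fac_mono mh mag.1 l'.
    have [v yv] : exists v, y v <> 0.
      have [v hv] := not_is0 nzA; exists v => y0.
      by have := mag.2 v; rewrite ey y0 mul0mx /row_free mxrank0; lia.
    have ey' := smp_epi rA sT' hy yv.
    by move=> i'; rewrite ey (eqmxMfull _ (ey'.2 i')).
  have [h' hh' eh'] := fac_mono mag hh le.
  exists (gcomp h' a); first exact: hom_comp hh' ma.1.
  by move=> v; rewrite /gcomp -mulmxA -/(gcomp a g v) -eh'.
move=> A B a b ma mb eA eB.
have [zA|fa] := sub _ _ ma eA; first by left=> i; rewrite (is0_mx a i zA) sub0mx.
have [zB|fb] := sub _ _ mb eB; first by right=> i; rewrite (is0_mx b i zB) sub0mx.
have [I [p [j [ep mj e]]]] := img_ex (hom_comp ma.1 eg.1).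
have [I' [p' [j' [ep' mj' e']]]] := img_ex (hom_comp mb.1 eg.1).
have eI := (rg_img (rg_sub rV ma eA) rU ep mj).1.
have eI' := (rg_img (rg_sub rV mb eB) rU ep' mj').1.
have key X Y J J' (x : gm X V) (y : gm Y V) (px : gm X J) (jx : gm J U) (py : gm Y J') (jy : gm J' U) :
    (forall i, gcomp x g i = px i *m jx i) -> (forall i, gcomp y g i = py i *m jy i) ->
    epi py -> (forall i, f i <= y i)%MS -> (forall i, jx i <= jy i)%MS -> forall i, (x i <= y i)%MS.
  move=> ex ey epy fy l i.
  have /submxP[w ew] : (gcomp x g i <= gcomp y g i)%MS.
    rewrite ex ey (eqmxMfull _ (epy.2 i)); apply: submx_trans (l i); exact: submxMl.
  have : (x i - w *m y i <= y i)%MS.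
    apply: submx_trans (fy i); rewrite z; apply/sub_kermxP.
    by rewrite mulmxBl -mulmxA -/(gcomp x g i) -/(gcomp y g i) ew subrr.
  by move=> h; rewrite -[x i](subrK (w *m y i)) addmx_sub // submxMl.
case: (cU _ _ _ _ mj mj' eI eI') => l; [left|right].
  exact: key e e' ep' fb l.
exact: key e' e ep fa l.
Qed.

End Uniserial.

Lemma max_nat_ex (Pr : nat -> Prop) n b : Pr n -> (forall m, Pr m -> (m <= b)%N) ->
  exists2 m, Pr m & forall l, Pr l -> (l <= m)%N.
Proof.
move=> Pn bd; have [t] := ubnP (b - n)%N; elim: t n Pn => // t IH n Pn; rewrite ltnS => lt.
have [h|/not_all_ex_not[m /(imply_to_and (Pr m))[Pm lm]]] := classic (forall l, Pr l -> (l <= n)%N).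
  by exists n.
by apply: (IH m Pm); have := bd _ Pm; move/negP: lm; lia.
Qed.

(** * Indecomposable regular modules are uniserial *)

Section Structure.
Variables (k : finFieldType) (Q : quiver) (d : 'I_(nvert Q) -> int).
Hypotheses (acy : acyclic Q) (td : tame_data d).
Implicit Types M N X Y A B C F I K L R S T U V W Z : rep k Q.
Notation defect := (defect d).
Notation rg := (rg d).
Notation smp := (smp d).
Notation chain := (chain d).

Lemma is0_chain M : rep_is0 M -> chain M.
Proof. by move=> z A B f g _ _ _ _; left=> i; rewrite (is0_mxr f i z) sub0mx. Qed.

Lemma iso_chain M N : iso M N -> chain M -> chain N.
Proof.
move=> i cM A B f g mf mg eA eB; have [h [mh eh]] := iso_sym i.
have [u hu [uh hu']] := inv_ex mh eh.
have e X (x : gm X N) l : x l = gcomp x h l *m u l by rewrite /gcomp -mulmxA uh mulmx1.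
by case: (cM _ _ _ _ (mono_comp mf mh) (mono_comp mg mh) eA eB) => l; [left|right] => j;
  rewrite (e _ f j) (e _ g j); apply: submxMr.
Qed.

Lemma smp_chain S : smp S -> chain S.
Proof.
move=> [rS _ sS] A B f g mf mg eA eB.
have [z|ef] := sS _ _ mf eA; first by left=> i; rewrite (is0_mx f i z) sub0mx.
by right=> i; apply: submx_full; apply: ef.2.
Qed.

(* [U] is a subquotient of [M] in the category of regular modules. *)
Definition subq M U := exists A (j : gm A M) (p : gm A U), [/\ mono j, epi p & defect A = 0].

Lemma subq_dim M U : subq M U -> (dimtot U <= dimtot M)%N.
Proof.
case=> A [j [p [mj ep _]]]; rewrite /dimtot; apply: leq_sum => i _.
exact: leq_trans (epi_dim i ep) (mono_dim i mj).
Qed.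

(** The preimage in [M] of the submodule [V] of the quotient [C] maps onto [V]. *)
Lemma subq_quo_sub M C V (c : gm M C) (v : gm V C) : rg M -> epi c -> defect C = 0 ->
  mono v -> defect V = 0 -> subq M V.
Proof.
move=> rM ec eC mv eV; have rC := rg_quo rM ec eC.
have [W [q s]] := cok_mono_ses mv; have [_ eq zq] := s.
have rW : rg W by apply: (rg_quo rC eq); have := ses_defect d s; rewrite eC eV; lia.
have ecq := epi_comp ec eq.
have [A [j [mj ej]]] := ker_ex ecq.1.
have eA := rg_ker rM rW ecq.1 mj ej.
have [|p hp E] := fac_mono mv (hom_comp mj.1 ec.1).
  move=> i; rewrite zq; apply/sub_kermxP; rewrite /gcomp -mulmxA.
  by apply/sub_kermxP; rewrite ej.
exists A, j, p; split=> //; split=> // i; rewrite -sub1mx.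
have /submxP[x ex] : (v i <= c i)%MS by apply: submx_full; apply: ec.2.
have /submxP[y ey] : (x <= j i)%MS.
  rewrite ej; apply/sub_kermxP; by rewrite /gcomp mulmxA -ex (ses_comp0 i s).
have -> : 1%:M = y *m p i.
  apply: (row_free_inj (mv.2 i)); rewrite /= mul1mx -mulmxA -E /gcomp mulmxA -ey; exact: ex.
exact: submxMl.
Qed.

Section Maximal.
Variables M U : rep k Q.
Hypotheses (rM : rg M) (rU : rg U) (cU : chain U) (nU : ~ rep_is0 U).
Hypothesis (sU : subq M U).
Hypothesis maxU : forall V, subq M V -> rg V -> chain V -> (dimtot V <= dimtot U)%N.

(** Take [A] of maximal dimension among the submodules of defect 0 that map onto [U]. If [A] is
    proper, enlarge it to [A'] by a regular simple [T]; the quotient [V] of [A'] by the kernel of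
    [A -> U] is an extension of [T] by [U]. Either [V] is uniserial, against the choice of [U], or
    it splits and [A'] maps onto [U], against the choice of [A]. *)
Lemma max_subq_quo : exists p : gm M U, epi p.
Proof.
pose Pr n := exists A (j : gm A M) (p : gm A U),
  [/\ mono j, epi p, defect A = 0 & dimtot A = n].
have [A0 [j0 [p0 [mj0 ep0 eA0]]]] := sU.
have Pr0 : Pr (dimtot A0) by exists A0, j0, p0.
have Prb m : Pr m -> (m <= dimtot M)%N.
  case=> A [j [_ [mj _ _ <-]]]; apply: leq_sum => i _; exact: mono_dim mj.
have [n [A [j [p [mj ep eA En]]]] maxA] := max_nat_ex Pr0 Prb.
have [C [c sc]] := cok_mono_ses mj; have [_ ec zc] := sc.
have [zC|nC] := classic (rep_is0 C).
  have [jv hjv [jjv _]] := inv_ex mj (ses_is0r_epi sc zC).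
  by exists (gcomp jv p); apply: epi_comp => //; split=> // i; apply/row_fullP; exists (j i).
exfalso.
have rC : rg C by apply: (rg_quo rM ec); have := ses_defect d sc; rewrite eA rM.1; lia.
have [T [t [mt sT]]] := smp_sub_ex rC nC; have [rT nT _] := sT.
have [C' [c' sc']] := cok_mono_ses mt; have [_ ec' zc'] := sc'.
have rC' : rg C' by apply: (rg_quo rC ec'); have := ses_defect d sc'; rewrite rC.1 rT.1; lia.
have hcc := hom_comp ec.1 ec'.1.
have [A' [j' [mj' ej']]] := ker_ex hcc.
have eA' := rg_ker rM rC' hcc mj' ej'; have rA' := rg_sub rM mj' eA'.
have [|q hq Eq] := fac_mono mt (hom_comp mj'.1 ec.1).
  move=> i; rewrite zc'; apply/sub_kermxP; rewrite /gcomp -mulmxA.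
  by apply/sub_kermxP; rewrite ej'.
have [|a ha Ea] := fac_mono mj' mj.1.
  move=> i; rewrite ej'; apply/sub_kermxP; by rewrite /gcomp mulmxA (ses_comp0 i sc) mul0mx.
have ma : mono a.
  by apply: (mono_left (g := j')) => //; split=> [|i]; [exact: hom_comp ha mj'.1 | rewrite /gcomp -Ea; apply: mj.2].
have aq i : a i *m q i = 0.
  apply: (row_free_inj (mt.2 i)); rewrite /= mul0mx -mulmxA -Eq /gcomp mulmxA -Ea.
  exact: ses_comp0 sc.
have eq : epi q.
  split=> // i; rewrite -sub1mx.
  have /submxP[x ex] : (t i <= c i)%MS by apply: submx_full; apply: ec.2.
  have /submxP[y ey] : (x <= j' i)%MS.
    rewrite ej'; apply/sub_kermxP; by rewrite /gcomp mulmxA -ex (ses_comp0 i sc').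
  have -> : 1%:M = y *m q i.
    apply: (row_free_inj (mt.2 i)); rewrite /= mul1mx -mulmxA -Eq /gcomp mulmxA -ey; exact: ex.
  exact: submxMl.
have saq : ses a q.
  split=> // i; apply/eqmxP/andP; split; first by apply/sub_kermxP.
  apply/rV_subP=> v /sub_kermxP v0.
  have /submxP[w ew] : (v *m j' i <= j i)%MS.
    rewrite zc; apply/sub_kermxP; by rewrite -mulmxA -/(gcomp j' c i) Eq mulmxA v0 mul0mx.
  have -> : v = w *m a i by apply: (row_free_inj (mj'.2 i)); rewrite /= ew -mulmxA -Ea.
  exact: submxMl.
have [B [b sb]] := ker_epi_ses ep; have [mb _ zb] := sb.
have [V [v sv]] := cok_mono_ses (mono_comp mb ma); have [_ ev zv] := sv.
have [|u hu Eu] := fac_epi ep (hom_comp ha ev.1).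
  move=> i; rewrite -zb; apply/sub_kermxP; rewrite /gcomp mulmxA -/(gcomp b a i).
  exact: ses_comp0 sv.
have [|w hw Ew] := fac_epi ev eq.1.
  move=> i; rewrite -zv; apply/sub_kermxP; by rewrite /gcomp -mulmxA aq mulmx0.
have eB : defect B = 0 by have := ses_defect d sb; rewrite eA rU.1; lia.
have eV : defect V = 0 by have := ses_defect d sv; rewrite eA' eB; lia.
have rV : rg V := rg_quo rA' ev eV.
have dV i : rdim V i = (rdim U i + rdim T i)%N.
  have := ses_dim i sv; have := ses_dim i saq; have := ses_dim i sb; lia.
have ew : epi w.
  by apply: (epi_right (f := v)) => //; split=> [|i]; [exact: hom_comp ev.1 hw | rewrite /gcomp -Ew; apply: eq.2].
have uw i : u i *m w i = 0.
  apply: (row_full_inj (ep.2 i)); rewrite mulmx0 mulmxA -Eu /gcomp -mulmxA -Ew; exact: aq.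
have suw : ses u w.
  have [K [kk sk]] := ker_epi_ses ew; have [mk _ zk] := sk.
  have [|r hr Er] := fac_mono mk hu.
    by move=> i; rewrite zk; apply/sub_kermxP.
  have mu : mono u.
    split=> // i; rewrite -kermx_eq0 -submx0; apply/rV_subP=> x /sub_kermxP x0.
    have /submxP[y ey] : (x <= p i)%MS by apply: submx_full; apply: ep.2.
    have : (y *m a i <= gcomp b a i)%MS.
      rewrite zv; apply/sub_kermxP; rewrite -mulmxA -/(gcomp a v i) Eu mulmxA -ey; exact: x0.
    case/submxP=> y' ey'; have : y = y' *m b i.
      by apply: (row_free_inj (ma.2 i)); rewrite /= ey' /gcomp mulmxA.
    by move=> yb; rewrite ey yb -mulmxA (ses_comp0 i sb) mulmx0 sub0mx.
  split=> // i; apply/eqmxP; rewrite -(geq_leqif (mxrank_leqif_eq _)); last by apply/sub_kermxP.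
  rewrite mxrank_ker; have /eqP -> := ew.2 i; have /eqP -> := mu.2 i.
  by rewrite dV addnK.
have dT := dimtot_gt0 nT; have dVt : dimtot V = (dimtot U + dimtot T)%N := ses_dimtot suw.
case: (chain_top acy td suw rU cU rV sT) => [cV|[s hs es]].
  have : (dimtot V <= dimtot U)%N by apply: maxU => //; exists A', j', v.
  lia.
have [r hr er] := retraction_of_section suw hs es.
have : (dimtot A' <= n)%N.
  apply: maxA; exists A', j', (gcomp v r); split=> //.
  apply: epi_comp => //; split=> // i; apply/row_fullP; by exists (u i).
have := ses_dimtot saq; lia.
Qed.

(** Take [C] of maximal dimension among the quotients of [M] through which [p] factors with a
    section [s : U -> C]. If [C] is not [M], a larger quotient [C'] covers it with regular simple
    kernel [T], and the preimage [V] of the image of [s] is an extension of [U] by [T]. Either [V]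
    is uniserial, against the choice of [U], or it splits and [s] lifts to [C']. *)
Lemma max_subq_split (p : gm M U) : epi p ->
  exists2 s : gm U M, hom s & forall i, s i *m p i = 1%:M.
Proof.
move=> ep.
pose Pr n := exists C (c : gm M C) (u : gm C U) (s : gm U C),
  [/\ epi c, hom u, hom s & [/\ forall i, s i *m u i = 1%:M,
   forall i, c i *m u i = p i, defect C = 0 & dimtot C = n]].
have Pr0 : Pr (dimtot U).
  exists U, p, (@gid _ _ U), (@gid _ _ U); split=> //; try exact: hom_id.
  by split=> //; [move=> i; rewrite mulmx1 | move=> i; rewrite mulmx1 | exact: rU.1].
have Prb m : Pr m -> (m <= dimtot M)%N.
  case=> C [c [_ [_ [ec _ _ [_ _ _ <-]]]]]; apply: leq_sum => i _; exact: epi_dim ec.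
have [n [C [c [u [s [ec hu hs [su cu eC En]]]]]] maxC] := max_nat_ex Pr0 Prb.
have rC := rg_quo rM ec eC.
have [K [ka sk]] := ker_epi_ses ec; have [mk _ zk] := sk.
have [zK|nK] := classic (rep_is0 K).
  have [cv hcv [ccv cvc]] := inv_ex (ses_is0l_mono sk zK) ec.
  exists (gcomp s cv); first exact: hom_comp.
  by move=> i; rewrite /gcomp -mulmxA -cu (mulmxA (cv i)) cvc mul1mx.
exfalso.
have eK : defect K = 0 by have := ses_defect d sk; rewrite rM.1 eC; lia.
have rK := rg_sub rM mk eK.
have [T [t [et sT]]] := smp_quo_ex rK nK; have [rT nT _] := sT.
have [Z [z sz]] := ker_epi_ses et; have [mz _ zz] := sz.
have eZ : defect Z = 0 by have := ses_defect d sz; rewrite eK rT.1; lia.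
have [C' [c' sc']] := cok_mono_ses (mono_comp mz mk); have [_ ec' zc'] := sc'.
have eC' : defect C' = 0 by have := ses_defect d sc'; rewrite rM.1 eZ; lia.
have rC' := rg_quo rM ec' eC'.
have [|e he Ee] := fac_epi ec' ec.1.
  by move=> i; rewrite -zc'; apply/sub_kermxP; rewrite /gcomp -mulmxA (ses_comp0 i sk) mulmx0.
have [|x hx Ex] := fac_epi et (hom_comp mk.1 ec'.1).
  move=> i; rewrite -zz; apply/sub_kermxP; rewrite /gcomp mulmxA; exact: ses_comp0 sc'.
have ee : epi e.
  by apply: (epi_right (f := c')) => //; split=> [|i]; [exact: hom_comp ec'.1 he | rewrite /gcomp -Ee; apply: ec.2].
have xe i : x i *m e i = 0.
  apply: (row_full_inj (et.2 i)); rewrite mulmx0 mulmxA -Ex /gcomp -mulmxA -Ee; exact: ses_comp0 sk.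
have mx : mono x.
  split=> // i; rewrite -kermx_eq0 -submx0; apply/rV_subP=> y /sub_kermxP y0.
  have /submxP[y1 ey] : (y <= t i)%MS by apply: submx_full; apply: et.2.
  have : (y1 *m ka i <= gcomp z ka i)%MS.
    rewrite zc'; apply/sub_kermxP; rewrite -mulmxA -/(gcomp ka c' i) Ex mulmxA -ey; exact: y0.
  case/submxP=> y' ey'; have : y1 = y' *m z i.
    by apply: (row_free_inj (mk.2 i)); rewrite /= ey' /gcomp mulmxA.
  by move=> yb; rewrite ey yb -mulmxA (ses_comp0 i sz) mulmx0 sub0mx.
have sxe : ses x e.
  split=> // i; apply/eqmxP; rewrite -(geq_leqif (mxrank_leqif_eq _)); last by apply/sub_kermxP.
  rewrite mxrank_ker; have /eqP -> := ee.2 i; have /eqP -> := mx.2 i.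
  have := ses_dim i sc'; have := ses_dim i sz; have := ses_dim i sk; lia.
(* [ker g] is the preimage in [C'] of the image of [s]. *)
pose g : gm C' C := gadd e (gscale (-1) (gcomp (gcomp e u) s)).
have hg : hom g by apply: hom_add => //; apply: hom_scale; apply: hom_comp => //; apply: hom_comp.
have gE i : g i = e i - e i *m u i *m s i by rewrite /g /gadd /gscale /gcomp scaleN1r.
have [V [v [mv ev]]] := ker_ex hg.
have eV := rg_ker rC' rC hg mv ev; have rV := rg_sub rC' mv eV.
pose y := gcomp v (gcomp e u).
have hy : hom y by apply: hom_comp mv.1 (hom_comp he hu).
have [|xx hxx Exx] := fac_mono mv hx.
  by move=> i; rewrite ev; apply/sub_kermxP; rewrite gE mulmxBr !mulmxA xe !mul0mx subrr.
have mxx : mono xx.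
  by apply: (mono_left (g := v)) => //; split=> [|i]; [exact: hom_comp hxx mv.1 | rewrite /gcomp -Exx; apply: mx.2].
have ve i : v i *m e i = v i *m e i *m u i *m s i.
  have : v i *m g i = 0 by apply/sub_kermxP; rewrite ev.
  by rewrite gE mulmxBr => /eqP; rewrite subr_eq0 => /eqP {1}->; rewrite !mulmxA.
have ey : epi y.
  split=> // i; rewrite -sub1mx.
  have /submxP[r er] : (s i <= e i)%MS by apply: submx_full; apply: ee.2.
  have /submxP[r' er'] : (r <= v i)%MS.
    rewrite ev; apply/sub_kermxP; rewrite gE mulmxBr !mulmxA -er su mul1mx subrr //.
  have -> : 1%:M = r' *m y i by rewrite /y /gcomp !mulmxA -er' -er su.
  exact: submxMl.
have sxy : ses xx y.
  split=> // i; apply/eqmxP/andP; split.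
    apply/sub_kermxP; rewrite /y /gcomp !mulmxA -Exx xe mul0mx //.
  apply/rV_subP=> r /sub_kermxP; rewrite /y /gcomp !mulmxA => r0.
  have : (r *m v i <= x i)%MS.
    have [_ _ ->] := sxe; apply/sub_kermxP; by rewrite -mulmxA ve !mulmxA r0 mul0mx.
  case/submxP=> r' er'.
  have -> : r = r' *m xx i by apply: (row_free_inj (mv.2 i)); rewrite /= er' -mulmxA -Exx.
  exact: submxMl.
have dT := dimtot_gt0 nT.
case: (chain_socle acy td sxy sT rV rU cU) => [cV|[r hr er]].
  have := maxU (subq_quo_sub rM ec' eC' mv eV) rV cV; have := ses_dimtot sxy; lia.
have : (dimtot C' <= n)%N.
  apply: maxC; exists C', c', (gcomp e u), (gcomp r v); split=> //; try exact: hom_comp.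
    exact: hom_comp hr mv.1.
  split=> // i; last by rewrite /gcomp mulmxA -Ee.
  by rewrite -er /y /gcomp !mulmxA.
have := ses_dimtot sxe; lia.
Qed.

End Maximal.

(* A uniserial regular subquotient of [M] of maximal dimension is a quotient of
   [M], and then a direct summand. *)
Theorem indec_chain M : rg M -> indecomposable M -> chain M.
Proof.
move=> rM ind.
pose Pr n := exists U, [/\ rg U, chain U, ~ rep_is0 U & subq M U /\ dimtot U = n].
have [S [j [mj sS]]] := smp_sub_ex rM ind.1; have [rS nS _] := sS.
have Pr0 : Pr (dimtot S).
  exists S; split=> //; first exact: smp_chain.
  split=> //; exists S, j, (@gid _ _ S); split=> //; [exact: epi_id | exact: rS.1].
have Prb m : Pr m -> (m <= dimtot M)%N by case=> U [_ _ _ [sU <-]]; exact: subq_dim.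
have [n [U [rU cU nU [sU En]]] maxU] := max_nat_ex Pr0 Prb.
have mU V : subq M V -> rg V -> chain V -> (dimtot V <= dimtot U)%N.
  move=> sV rV cV; rewrite En; have [z|nz] := classic (rep_is0 V).
    by rewrite /dimtot big1.
  by apply: maxU; exists V.
have [p ep] := max_subq_quo rM rU cU sU mU.
have [s hs es] := max_subq_split rM rU cU mU ep.
have [K [l z]] := ker_epi_ses ep.
case: (indec_rsum ind (split_section z hs es)) => // zK.
apply: iso_chain cU; apply: iso_sym; exists p; split=> //; exact: ses_is0l_mono z zK.
Qed.

End Structure.

(** * Existence of modules of defect -1 *)

Section Existence.
Variables (k : finFieldType) (Q : quiver) (d : 'I_(nvert Q) -> int).
Hypotheses (acy : acyclic Q) (td : tame_data d).
Implicit Types M N X Y A B C E L R : rep k Q.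
Notation defect := (defect d).
Notation rg := (rg d).
Notation LB := (LB d).

Lemma nonsplit_ex A B : ed A B <> 0%N ->
  exists X (f : gm B X) (g : gm X A), ses f g /\
    forall r : gm X B, hom r -> ~ (forall i, f i *m r i = 1%:M).
Proof.
move=> e0.
have [z zn] : exists z : 'rV[k]_(c1dim A B), ~~ (z <= cobound A B)%MS.
  apply: NNPP => n; apply: e0; apply/eqP; rewrite /ext1_dim mxrank_eq0.
  apply/eqP; rewrite -[cokermx _]mul1mx; apply/eqP; rewrite -submxE.
  by apply/rV_subP=> v _; apply: NNPP => /negP m; apply: n; exists v.
pose X : rep k Q := @Rep k Q (fun i => (rdim A i + rdim B i)%N)
   (fun a => block_mx (rmap A a) (comp1 z a) 0 (rmap B a)).
pose f : gm B X := fun i => row_mx 0 1%:M; pose g : gm X A := fun i => col_mx 1%:M 0.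
have fg i : f i *m g i = 0 by rewrite mul_row_col mulmx0 mul0mx addr0.
have mf : mono f.
  split=> [a|i]; last by apply/row_freeP; exists (col_mx 0 1%:M); rewrite mul_row_col mul0mx add0r mulmx1.
  by rewrite /f /= mul_mx_row mul_row_block !mulmx0 !mulmx1 !mul0mx !mul1mx !add0r.
have eg : epi g.
  split=> [a|i]; last by apply/row_fullP; exists (row_mx 1%:M 0); rewrite mul_row_col mul0mx addr0 mulmx1.
  by rewrite /g /= mul_block_col mul_col_mx !mulmx0 !mulmx1 !mul0mx !mul1mx !addr0.
exists X, f, g; split.
  split=> // i; apply/eqmxP; rewrite -(geq_leqif (mxrank_leqif_eq _)); last by apply/sub_kermxP.
  rewrite mxrank_ker; have /eqP -> := eg.2 i; have /eqP -> := mf.2 i.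
  by rewrite /= addKn.
move=> r hr er; move/negP: zn; apply.
have re i : r i = col_mx (usubmx (r i)) 1%:M.
  rewrite -[LHS]vsubmxK; congr col_mx.
  by have := er i; rewrite /f -{1}[r i]vsubmxK mul_row_col mul0mx add0r mul1mx.
(* The upper block of a retraction is a 0-cochain with coboundary [z]. *)
have -> : z = pk (fun i => usubmx (r i) : 'M[k]_(rdim A i, rdim B i)) *m cobound A B.
  apply: comp1_inj => a; rewrite mul_cobound pk1K !pkK.
  have h := hr a; rewrite (re (tgt a)) (re (src a)) /= mul_block_col mul_col_mx in h.
  by have [<- _] := eq_col_mx h; rewrite mulmx1 addrC addKr.
exact: submxMl.
Qed.

(** Left exactness bounds dim End of the middle term by that of the split extension. The bound is
    strict because the identity of [B] does not extend to [X]. *)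
Lemma generic_split A B X (f : gm B X) (g : gm X A) : ses f g ->
  (forall r : gm X B, hom r -> ~ (forall i, f i *m r i = 1%:M)) ->
  (hd X X < hd (rsum A B) (rsum A B))%N.
Proof.
move=> s ns; have [mf eg z] := s.
have [l1 _] := hd_lift X mf eg.1 z; have [l2 _] := hd_extend A mf.1 eg z.
have [l3 l4] := hd_extend B mf.1 eg z.
have : ~ (hd A B + hd B B <= hd X B)%N.
  by move/l4=> /(_ _ (@hom_id _ _ B))[r hr er]; apply: ns hr er.
rewrite hd_rsumr !hd_rsuml; lia.
Qed.

(** Descend on dim End among the modules of dimension vector [y]. If the module is [A] plus [B] with
    a nonzero Ext^1 between them, [generic_split] lowers dim End. Otherwise all terms of 1 = <A, A>
    + <B, B> + <A, B> + <B, A> are nonnegative, so one summand is isotropic, hence a multiple of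
    [d]; the mixed terms then force defect 0 on the other one, against the total -1. *)
Lemma LB_ex (y : 'I_(nvert Q) -> int) : (forall i, 0 <= y i) ->
  euler y y = 1 -> euler d y = -1 -> exists L, LB L /\ dimvec L =1 y.
Proof.
move=> y0 yq yd.
have [N0 eN0] : exists N, dimvec N =1 y.
  by exists (zero_rep k (fun i => `|y i|%N)) => i; rewrite /dimvec /=; have := y0 i; lia.
have [n] := ubnP (hd N0 N0); elim: n N0 eN0 => // n IH N eN; rewrite ltnS => hN.
have eq : euler (dimvec N) (dimvec N) = 1 by rewrite (euler_ext eN eN).
have ed' : defect N = -1 by rewrite /Defs.defect (euler_ext (frefl _) eN).
have nz : ~ rep_is0 N by move=> z; rewrite defect_is0 in ed'.
have [ind|ni] := classic (indecomposable N); first by exists N; split=> //; apply: LB_intro.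
have [A [B [i nA nB]]] := not_indec nz ni.
have hdN : hd N N = hd (rsum A B) (rsum A B) by rewrite (iso_hdl _ i) (iso_hdr _ i).
have eAB j : y j = dimvec A j + dimvec B j by rewrite -eN /dimvec (iso_dim i).
have [eAB0|nAB] := classic (ed A B = 0%N); last first.
  have [X [f [g [s ns]]]] := nonsplit_ex nAB; have := generic_split s ns.
  rewrite -hdN => lt; apply: (IH X); last lia.
  by move=> j; rewrite (ses_dimvec s) addrC eAB.
have [eBA0|nBA] := classic (ed B A = 0%N); last first.
  have [X [f [g [s ns]]]] := nonsplit_ex nBA; have := generic_split s ns.
  rewrite (iso_hdl _ (rsumC B A)) (iso_hdr _ (rsumC B A)) -hdN => lt; apply: (IH X); last lia.
  by move=> j; rewrite (ses_dimvec s) eAB.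
exfalso; have hAB := hd_ed A B; have hBA := hd_ed B A.
have q : euler y y = euler (dimvec A) (dimvec A) + euler (dimvec B) (dimvec B)
    + euler (dimvec A) (dimvec B) + euler (dimvec B) (dimvec A).
  by rewrite (euler_ext eAB eAB) !euler_addr !euler_addl; ring.
have dd : euler d y = euler d (dimvec A) + euler d (dimvec B).
  by rewrite (euler_ext (frefl _) eAB) euler_addr.
have rA := euler_rad td (dimvec A); have rB := euler_rad td (dimvec B).
have aux (U V : rep k Q) : euler (dimvec U) (dimvec U) = 0 ->
    0 <= euler (dimvec U) (dimvec V) -> 0 <= euler (dimvec V) (dimvec U) ->
    ~ rep_is0 U -> euler d (dimvec U) = 0 /\ euler d (dimvec V) = 0.
  move=> /(tits_eq0 td)[t et] h1 h2 /not_is0[j hj].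
  have t0 : 0 < t by have := et j; have := d_gt0 td j; rewrite /dimvec; nia.
  move: h1 h2; rewrite (euler_ext et (frefl _)) (euler_ext (frefl _) et).
  rewrite euler_scalel euler_scaler (euler_ext (frefl d) et) euler_scaler (euler_dd td).
  have := euler_rad td (dimvec V) => r h1 h2; split; first by rewrite mulr0.
  nia.
have qA := tits_ge0 td (dimvec A); have qB := tits_ge0 td (dimvec B).
have [zA|pA] : euler (dimvec A) (dimvec A) = 0 \/ 1 <= euler (dimvec A) (dimvec A) by lia.
  have [||//|a b] := aux A B zA; lia.
have [zB|pB] : euler (dimvec B) (dimvec B) = 0 \/ 1 <= euler (dimvec B) (dimvec B) by lia.
  have [||//|a b] := aux B A zB; lia.
lia.
Qed.

Lemma LB_shift L (t : int) : LB L -> (forall i, 0 <= dimvec L i + t * d i) ->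
  exists L', LB L' /\ forall i, dimvec L' i = dimvec L i + t * d i.
Proof.
move=> lL pos; apply: LB_ex => //.
  rewrite euler_addl !euler_addr !euler_scalel !euler_scaler (LB_q acy td lL).
  rewrite (euler_dd td) (euler_rad td); ring.
by rewrite euler_addr euler_scaler (euler_dd td) mulr0 addr0; apply: lL.2.
Qed.

Lemma hd_LB_rg L R : LB L -> rg R -> (hd L R)%:Z = euler (dimvec L) (dimvec R).
Proof. by move=> lL rR; rewrite -hd_ed (ed_LB_rg acy td lL rR) subr0. Qed.

Lemma hd_shift L L' R t : LB L -> LB L' -> rg R ->
  (forall i, dimvec L' i = dimvec L i + t * d i) -> hd L' R = hd L R.
Proof.
move=> lL lL' rR e; have := hd_LB_rg lL rR; have := hd_LB_rg lL' rR.
rewrite (euler_ext e (frefl _)) euler_addl euler_scalel.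
have : euler d (dimvec R) = 0 by exact: rR.1.
move=> ->; lia.
Qed.

(* Translating the dimension vector of [L] by a multiple of [d] changes no
   [hd L R] with [R] regular, so that maps [L -> R] may be assumed far from injective. *)
Lemma LB_big L (n : nat) : LB L -> exists L', [/\ LB L',
  forall R, rg R -> hd L' R = hd L R, forall i, (n < rdim L' i)%N
  & forall i, (`|d i| <= rdim L' i)%N].
Proof.
move=> lL; have [|L' [lL' e]] := LB_shift (t := n.+1%:Z) lL.
  by move=> i; have := d_gt0 td i; rewrite /dimvec; nia.
exists L'; split=> //.
- by move=> R rR; apply: hd_shift lL lL' rR e.
- by move=> i; have := e i; have := d_gt0 td i; rewrite /dimvec; nia.
- by move=> i; have := e i; have := d_gt0 td i; rewrite /dimvec; nia.
Qed.

End Existence.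

Lemma rank_inj_surj (k : fieldType) n m p q (A : 'M[k]_(p, n)) (B : 'M[k]_(q, m))
    (f : 'rV[k]_n -> 'rV[k]_m) :
  linear f -> (forall u : 'rV_n, (u <= A)%MS -> (f u <= B)%MS) ->
  (forall u : 'rV_n, (u <= A)%MS -> f u = 0 -> u = 0) -> (\rank B <= \rank A)%N ->
  forall v : 'rV_m, (v <= B)%MS -> exists2 u : 'rV_n, (u <= A)%MS & f u = v.
Proof.
move=> lf fAB finj le v vB.
have r : \rank (A *m lin1_mx f) = \rank A.
  apply/(mxrank_injP _); rewrite -submx0; apply/rV_subP=> u; rewrite sub_capmx => /andP[uA /sub_kermxP].
  by rewrite mul_rV_linear // => /(finj _ uA) ->; rewrite sub0mx.
have s : (A *m lin1_mx f <= B)%MS.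
  apply/rV_subP=> u /submxP[w ->]; rewrite mulmxA mul_rV_linear //.
  by apply: fAB; rewrite submxMl.
have : (B <= A *m lin1_mx f)%MS.
  by rewrite -(geq_leqif (mxrank_leqif_sup s)) r.
move/(submx_trans vB)/submxP=> [w ->]; exists (w *m A); first exact: submxMl.
by rewrite -mul_rV_linear // mulmxA.
Qed.

(** An injective linear map into a space of no larger dimension is onto. *)
Lemma hd_pre_surj (k : finFieldType) (Q : quiver) (B C X : rep k Q) (g : gm B C) :
  hom g -> (forall h : gm C X, hom h -> (forall i, g i *m h i = 0) -> forall i, h i = 0) ->
  (hd B X <= hd C X)%N ->
  forall h : gm B X, hom h -> exists2 h' : gm C X, hom h' & forall i, h i = g i *m h' i.
Proof.
move=> hg inj le h hh.
have [||||u /hom_comp0 hu e] := @rank_inj_surj _ _ _ _ _ (kermx (cobound C X)) (kermx (cobound B X))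
   (fun c => pk (gcomp g (comp0 c))) _ _ _ le (pk h).
- apply: (@pk_linear _ _ _ _ _ _ (fun f => gcomp g f)) => c f f' h' eh i.
  by rewrite /gcomp eh mulmxDr -scalemxAr.
- by move=> u /hom_comp0 hu; apply/hom_kermx; apply: hom_comp hg hu.
- by move=> u /hom_comp0 hu /pk_eq0 /(inj _ hu) e; rewrite -[u]comp0K; apply/pk_eq0.
- exact/hom_kermx.
by exists (comp0 u) => // i; rewrite -(pkK h) -e pkK.
Qed.

Lemma hd_pre_le (k : finFieldType) (Q : quiver) (B C X : rep k Q) (g : gm B C) :
  hom g -> (forall h : gm B X, hom h -> exists2 h' : gm C X, hom h' & forall i, h i = g i *m h' i) ->
  (hd B X <= hd C X)%N.
Proof.
move=> hg sj; set G := lin1_mx (fun c => pk (gcomp g (@comp0 _ _ C X c))).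
have lG : linear (fun c => pk (gcomp g (@comp0 _ _ C X c))).
  apply: (@pk_linear _ _ _ _ _ _ (fun f => gcomp g f)) => c f f' h' eh i.
  by rewrite /gcomp eh mulmxDr -scalemxAr.
apply: leq_trans (mxrankM_maxl (kermx (cobound C X)) G); apply/mxrankS/rV_subP=> v.
move=> /hom_comp0/sj[h hh e]; have /submxP[w ew] := proj2 (hom_kermx h) hh.
have -> : v = pk h *m G.
  rewrite mul_rV_linear //; apply: comp0_inj => i; rewrite pkK /gcomp pkK; exact: e.
by rewrite ew -mulmxA submxMl.
Qed.

(** * Powers of a module and divisibility of dimensions *)

Section Tensor.
Variable k : fieldType.

Lemma tensor_inj r n m (A B : 'M[k]_(r * n, m)) :
  (forall (c : 'rV_r) (u : 'rV_n), mxvec (c^T *m u) *m A = mxvec (c^T *m u) *m B) -> A = B.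
Proof.
move=> h; apply/row_matrixP=> x; case/mxvec_indexP: x => i j; rewrite !rowE.
have -> : delta_mx 0 (mxvec_index i j) = mxvec ((delta_mx 0 i : 'rV[k]_r)^T *m (delta_mx 0 j : 'rV[k]_n)).
  by rewrite trmx_delta mul_delta_mx mxvec_delta.
exact: h.
Qed.

Lemma mxvec_mulmxr r n m (x : 'M[k]_(r, n)) (B : 'M[k]_(n, m)) :
  mxvec x *m lin_mulmxr B = mxvec (x *m B).
Proof. by rewrite mul_vec_lin. Qed.

Lemma mxvec_mulmx r n (x : 'M[k]_(r, n)) (S : 'M[k]_r) :
  mxvec x *m lin_mulmx S = mxvec (S *m x).
Proof. by rewrite mul_vec_lin. Qed.

(** The [r] by [n] matrices form [n] copies of the simple module k^r over k[S]. A stable subspace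
    maps to some column nontrivially, hence onto k^r, and induction applies to the kernel of this
    map. *)
Lemma irred_dvdn r n p (S : 'M[k]_r) (A : 'M[k]_(p, r * n)) :
  (forall q (U : 'M_(q, r)), (U *m S <= U)%MS -> U = 0 \/ row_full U) ->
  (A *m lin_mulmx S^T <= A)%MS -> (r %| \rank A)%N.
Proof.
move=> irr; have [t] := ubnP (\rank A); elim: t p A => // t IH p A; rewrite ltnS => lt sA.
pose C c : 'M[k]_(r * n, r) := lin1_mx (fun u : 'rV_(r * n) => (col c (vec_mx u))^T).
have CE c x : mxvec x *m C c = (col c x)^T.
  rewrite mul_rV_linear ?mxvecK // => e u v.
  by rewrite !linearP /=; apply/rowP=> y; rewrite !mxE.
have CS c : lin_mulmx S^T *m C c = C c *m S.
  apply: tensor_inj => e u; rewrite !mulmxA mxvec_mulmx !CE.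
  by rewrite !tr_col trmx_mul trmxK row_mul.
have [A0|/eqP nA] := eqVneq A 0; first by rewrite A0 mxrank0 dvdn0.
have [c nc] : exists c, A *m C c <> 0.
  apply: NNPP => h; apply: nA; apply/row_matrixP=> x; rewrite row0 -[row x A]vec_mxK.
  suff -> : vec_mx (row x A) = 0 by rewrite linear0.
  apply/trmx_inj/row_matrixP=> c; rewrite -tr_col -CE vec_mxK -row_mul trmx0 row0.
  have -> : A *m C c = 0 by apply: NNPP => m; apply: h; exists c.
  by rewrite row0.
have [|//|full] := irr _ (A *m C c).
  by rewrite -mulmxA -CS mulmxA submxMr.
have := mxrank_mul_ker A (C c); have /eqP -> := full => <-.
rewrite dvdn_addr //; apply: IH.
  have := mxrank_mul_ker A (C c); have /eqP -> := full => e.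
  have r0 : (0 < r)%N.
    by case: (posnP r) => // r0; exfalso; apply: nc; apply/matrixP=> y [z hz]; exfalso; move: hz; rewrite r0.
  apply: leq_trans lt; rewrite -e -addn1 addnC leq_add2r //.
rewrite sub_capmx; apply/andP; split.
  by apply: submx_trans sA; rewrite submxMr // capmxSl.
apply/sub_kermxP; rewrite -mulmxA CS mulmxA.
have /sub_kermxP -> : (A :&: kermx (C c) <= kermx (C c))%MS by apply: capmxSr.
by rewrite mul0mx.
Qed.

End Tensor.

Section Power.
Variables (k : finFieldType) (Q : quiver) (d : 'I_(nvert Q) -> int).
Hypotheses (acy : acyclic Q) (td : tame_data d).
Implicit Types M N X Y A B C E L R : rep k Q.
Notation defect := (defect d).
Notation rg := (rg d).
Notation smp := (smp d).
Notation LB := (LB d).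
Notation tf := (tf d).

(* [M^r], an element of [(M^r)_i] being the [mxvec] of an [r] by [rdim M i] matrix. *)
Definition rpow r M : rep k Q :=
  @Rep k Q (fun i => (r * rdim M i)%N) (fun a => lin_mulmxr (rmap M a)).

Lemma defect_rpow r M : defect (rpow r M) = r%:Z * defect M.
Proof. by rewrite /Defs.defect -euler_scaler; apply: euler_ext => // i; rewrite /dimvec /= PoszM. Qed.

(** Induction on the list of maps: the image of one lies in [L], and the others are jointly
    injective on its kernel. *)
Lemma tf_joint r L X (p : 'I_r -> gm X L) (s : seq 'I_r) : tf L -> (forall c, hom (p c)) ->
  (forall i (u : 'rV_(rdim X i)), (forall c, c \in s -> u *m p c i = 0) -> u = 0) ->
  ~ rep_is0 X -> defect X < 0.
Proof.
move=> tL; elim: s X p => [|c s IH] X p hp inj nz.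
  exfalso; apply: nz => i; apply: (@one_eq0 k); apply/row_matrixP=> x; rewrite row0.
  by apply: (inj i).
have [I [q [j [eq mj e]]]] := img_ex (hp c).
have [K [l s']] := ker_epi_ses eq; have [ml _ zl] := s'.
have dI : rep_is0 I \/ defect I < 0.
  have [z|nI] := classic (rep_is0 I); [by left | right; exact: tL mj nI].
have := ses_defect d s'.
have [zK|nK] := classic (rep_is0 K).
  rewrite (defect_is0 d zK); case: dI => [zI|]; last lia.
  by exfalso; apply: nz => i; rewrite (ses_dim i s') zK zI.
have : defect K < 0.
  apply: (IH K (fun c => gcomp l (p c))) => //.
    by move=> c'; apply: hom_comp ml.1 (hp c').
  move=> i u hu; have : u *m l i = 0.
    apply: inj => c'; rewrite inE => /predU1P[->|cs]; last by rewrite -mulmxA; apply: hu.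
    by rewrite e -mulmxA (mulmxA (l i)) (ses_comp0 i s') mul0mx mulmx0.
  by move=> u0; apply: (row_free_inj (ml.2 i)); rewrite /= mul0mx.
by case: dI => [zI|]; rewrite ?(defect_is0 d zI); lia.
Qed.

Lemma tf_rpow r L : tf L -> tf (rpow r L).
Proof.
move=> tL X f mf nz.
pose R c i : 'M[k]_(r * rdim L i, rdim L i) :=
  lin1_mx (fun u : 'rV_(r * rdim L i) => row c (vec_mx u)).
have RE c i x : mxvec x *m R c i = row c x.
  by rewrite mul_rV_linear ?mxvecK // => e u v; rewrite !linearP.
have hR c : @hom _ _ (rpow r L) L (R c).
  move=> a; apply: tensor_inj => e u; rewrite !mulmxA mxvec_mulmxr !RE -row_mul //.
apply: (@tf_joint r L X (fun c => gcomp f (R c)) (enum 'I_r)) => //.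
  by move=> c; apply: hom_comp mf.1 (hR c).
move=> i u hu; apply: (row_free_inj (mf.2 i)); rewrite /= mul0mx.
rewrite -[u *m f i]vec_mxK; suff -> : vec_mx (u *m f i) = 0 by rewrite linear0.
apply/row_matrixP=> c; rewrite row0 -RE vec_mxK -mulmxA; apply: hu; exact: mem_enum.
Qed.

Lemma LB_smp_ker L E (g : gm L E) i : LB L -> smp E -> hom g -> g i <> 0 -> ~ mono g ->
  epi g /\ exists K (l : gm K L), ses l g /\ LB K.
Proof.
move=> lL [rE nE sE] hg gi nm.
have [I [p [j [K [l [s mj rI lK e]]]]]] := LB_rg_img lL rE hg gi nm.
have [ml ep zl] := s.
have [z|ej] := sE _ _ mj rI.1; first by have := img_nz (e i) gi.
have eg : epi g by split=> // v; rewrite e; have [_ h] := epi_comp ep ej; apply: h.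
split=> //; exists K, l; split=> //; split=> // v.
apply: eqmx_trans (zl v) _; apply/eqmxP/andP; split; apply/sub_kermxP.
  by rewrite e mulmxA mulmx_ker mul0mx.
by apply: (row_free_inj (mj.2 v)); rewrite /= mul0mx -mulmxA -e mulmx_ker.
Qed.

Lemma not_mono_dim M N (f : gm M N) : (exists i, rdim N i < rdim M i)%N -> ~ mono f.
Proof. by move=> [i h] mf; have := mono_dim i mf; lia. Qed.

Lemma i0_ex : exists i, d i = 1. Proof. by case: td. Qed.

(** In the exact sequence of [K], [L], [E] both [K] and [L] have Tits value 1, so <L, E> + <E, L> =
    <E, E>. A nonzero map [K -> E] would give the same for [K], although the two left sides differ
    by 2 <E, E>. Hence Hom(K, E) = 0 and <L, E> = <E, E>. The factor 2 in the size hypothesis keeps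
    both maps from being injective. *)
Lemma hd_LB_smp_pos L E : LB L -> smp E -> hd L E <> 0%N ->
  (forall i, (2 * rdim E i < rdim L i)%N) ->
  0 < euler (dimvec E) (dimvec E) -> hd L E = hd E E.
Proof.
move=> lL sE nz big qE; have [rE _ _] := sE; have [i0 _] := i0_ex.
have [g hg [i gi]] := hd_neq0 nz.
have [|eg [K [l [s lK]]]] := LB_smp_ker lL sE hg gi.
  by apply: not_mono_dim; exists i0; have := big i0; lia.
have rel M N (f : gm M N) (M' : rep k Q) (f' : gm M' M) : ses f' f -> LB M -> LB M' ->
    euler (dimvec M) (dimvec N) + euler (dimvec N) (dimvec M) = euler (dimvec N) (dimvec N).
  move=> s1 l1 l2; have := LB_q acy td l1.
  have := ses_dimvec s1 => e1; rewrite (euler_ext e1 e1) !euler_addr !euler_addl (LB_q acy td l2).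
  rewrite (euler_ext e1 (frefl (dimvec N))) (euler_ext (frefl (dimvec N)) e1).
  rewrite euler_addr euler_addl; lia.
have r1 := rel _ _ _ _ _ s lL lK.
have e1 := ses_dimvec s.
have hK := hd_LB_rg acy td lK rE; have hL := hd_LB_rg acy td lL rE.
have eL : euler (dimvec L) (dimvec E) = euler (dimvec K) (dimvec E) + euler (dimvec E) (dimvec E).
  by rewrite (euler_ext e1 (frefl _)) euler_addl.
have eL' : euler (dimvec E) (dimvec L) = euler (dimvec E) (dimvec K) + euler (dimvec E) (dimvec E).
  by rewrite (euler_ext (frefl _) e1) euler_addr.
have [hK0|nK] := classic (hd K E = 0%N).
  have := hd_ed E E; have := hd_epi E eg; lia.
exfalso; have [g' hg' [i' gi']] := hd_neq0 nK.
have [|eg' [K' [l' [s2 lK']]]] := LB_smp_ker lK sE hg' gi'.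
  by apply: not_mono_dim; exists i0; have := big i0; have := ses_dim i0 s; lia.
have := rel _ _ _ _ _ s2 lK lK'; lia.
Qed.

End Power.

(** [w] is a basis of a nonzero [T]-stable subspace of least dimension, and [S] is the matrix of [T]
    on it. *)
Lemma min_stable_ex (k : finFieldType) n (T : 'M[k]_n) : (0 < n)%N ->
  exists r (w : 'M[k]_(r, n)) (S : 'M[k]_r), [/\ (0 < r)%N, row_free w, w *m T = S *m w
    & forall q (U : 'M_(q, r)), (U *m S <= U)%MS -> U = 0 \/ row_full U].
Proof.
move=> n0; pose st (W : 'M[k]_n) := (W != 0) && (W *m T <= W)%MS.
have st1 : st 1%:M.
  rewrite /st submx1 andbT -mxrank_eq0 mxrank1; lia.
case: (arg_minnP (fun W : 'M[k]_n => \rank W) st1) => W /andP[nW sW] minW.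
pose w := row_base W; have fw : row_free w := row_base_free W.
have wW : (w :=: W)%MS := eq_row_base W.
have wT : (w *m T <= w)%MS by rewrite wW (eqmxMr _ wW).
exists (\rank W), w, (w *m T *m pinvmx w); split=> //.
- by rewrite lt0n mxrank_eq0.
- by rewrite mulmxKpV.
move=> q U sU; have [->|nU] := eqVneq U 0; [by left | right].
have sUw : (U *m w *m T <= U *m w)%MS.
  by rewrite -mulmxA -(mulmxKpV wT) mulmxA submxMr.
have : st (<<U *m w>>)%MS.
  rewrite /st -mxrank_eq0 genmxE mxrankMfree // mxrank_eq0 nU /=.
  by rewrite (eqmxMr _ (genmxE _)) genmxE.
move/minW; rewrite genmxE mxrankMfree // /row_full => le.
by rewrite eqn_leq le rank_leq_col.
Qed.

(** * Regular simples whose dimension vector is a multiple of delta *)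

Section Homogeneous.
Variables (k : finFieldType) (Q : quiver) (d : 'I_(nvert Q) -> int).
Hypotheses (acy : acyclic Q) (td : tame_data d).
Notation defect := (defect d).
Notation rg := (rg d).
Notation smp := (smp d).
Notation LB := (LB d).
Notation tf := (tf d).

Variables (L L' E : rep k Q) (a b : gm L' L) (m : nat).
Hypotheses (lL : LB L) (lL' : LB L') (sE : smp E).
Hypothesis dimL : forall i, dimvec L i = dimvec L' i + d i.
Hypothesis dimE : forall i, dimvec E i = m%:Z * d i.
Hypothesis m2 : (1 < m)%N.
Hypothesis big : forall i, (rdim E i < rdim L i)%N.
Hypotheses (ha : hom a) (hb : hom b).
Hypothesis indep : forall c, ~ (forall i, b i = c *: a i).
Hypothesis a_nz : exists i, a i <> 0.

Lemma hd_mult (M : rep k Q) : LB M -> hd M E = m.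
Proof.
clear m2 big dimL; move=> lM; have [rE _ _] := sE; have := hd_LB_rg acy td lM rE.
rewrite (euler_ext (frefl _) dimE) euler_scaler.
have := euler_rad td (dimvec M); have := lM.2; rewrite /Defs.defect => -> /esym.
by move/eqP; rewrite eqr_opp => /eqP ->; lia.
Qed.

Lemma homog_epi (v : gm L E) : hom v -> (exists i, v i <> 0) -> epi v.
Proof.
move=> hv [i vi]; have [i0 _] := i0_ex td.
by have [|] := LB_smp_ker lL sE hv vi => //; apply: not_mono_dim; exists i0.
Qed.

(** A nonzero [v] is onto. If it killed the image of [a], then [E] would be a quotient of the
    cokernel of [a], whose dimension vector [d] is too small since [m > 1]. *)
Lemma homog_inj (v : gm L E) : hom v -> (forall i, a i *m v i = 0) -> forall i, v i = 0.
Proof.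
move=> hv av i; apply: NNPP => vi; have ev := homog_epi hv (ex_intro _ i vi).
have [j aj] := a_nz; have ma := LB_mono lL' lL.1 ha aj.
have [C [p s]] := cok_mono_ses ma; have [_ ep zp] := s.
have [|v' hv' ev'] := fac_epi ep hv.
  by move=> l; rewrite -zp; apply/sub_kermxP.
have ev2 : epi v'.
  by apply: (epi_right (f := p)) => //; split=> [|l]; [exact: hom_comp ep.1 hv' | rewrite /gcomp -ev'; apply: ev.2].
have [i0 d0] := i0_ex td; have := epi_dim i0 ev2; have := ses_dim i0 s.
have := dimL i0; have := dimE i0; rewrite /dimvec d0; lia.
Qed.

(* [a] and [b] form a pencil [L' -> L].  Precomposition with [a] is bijective
   from Hom(L, E) to Hom(L', E), so that [b] gives an endomorphism [T] of
   Hom(L, E).  A minimal [T]-stable subspace, of dimension [r], is shown to be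
   everything: the defects of the kernel and image of [ph : L'^r -> L^r] are
   divisible by [r], hence [ph] is injective, and its cokernel is [E].  So [T] is
   induced by an endomorphism of [E], and by irreducibility any nonzero map
   [L -> E] generates Hom(L, E) over End(E). *)
Lemma homog_hd_le : (hd L E <= hd E E)%N.
Proof.
set KL := kermx (cobound L E).
have [B fB BK] : exists2 B : 'M[k]_(hd L E, c0dim L E), row_free B & (B :=: KL)%MS.
  by exists (row_base KL); [exact: row_base_free | exact: eq_row_base].
pose pre (x : gm L' L) := lin1_mx (fun c => pk (gcomp x (@comp0 _ _ L E c))).
have preE x c : c *m pre x = pk (gcomp x (comp0 c)).
  apply: mul_rV_linear; apply: (@pk_linear _ _ _ _ _ _ (fun f => gcomp x f)) => e f f' h' eh i.
  by rewrite /gcomp eh mulmxDr -scalemxAr.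
have homB (c : 'rV_(hd L E)) : hom (comp0 (c *m B)).
  by apply/hom_comp0; rewrite -/KL -BK submxMl.
have preK x (c : 'rV_(hd L E)) : hom x -> (c *m B *m pre x <= kermx (cobound L' E))%MS.
  by move=> hx; rewrite preE; apply/hom_kermx; apply: hom_comp hx (homB c).
have preK' x : hom x -> (B *m pre x <= kermx (cobound L' E))%MS.
  by move=> hx; apply/rV_subP=> u /submxP[c ->]; rewrite mulmxA; apply: preK.
have fa : row_free (B *m pre a).
  rewrite -kermx_eq0 -submx0; apply/rV_subP=> c /sub_kermxP.
  rewrite mulmxA preE => /pk_eq0/(homog_inj (homB c))/pk_eq0; rewrite comp0K => cB.
  have -> : c = 0 by apply: (row_free_inj fB); rewrite /= mul0mx.
  by rewrite sub0mx.
have Ka : (kermx (cobound L' E) <= B *m pre a)%MS.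
  rewrite -(geq_leqif (mxrank_leqif_sup (preK' _ ha))); have /eqP -> := fa.
  by rewrite -/(hd L' E) -/(hd L E) !hd_mult.
have /submxP[T eT] := submx_trans (preK' _ hb) Ka.
have n0 : (0 < hd L E)%N by rewrite hd_mult //; lia.
have [r [w [S [r0 fw wT irr]]]] := min_stable_ex T n0.
pose v (c : 'rV[k]_r) : gm L E := comp0 (c *m w *m B).
have hv c : hom (v c) by apply: homB.
have v0 c : (forall i, v c i = 0) -> c = 0.
  move/pk_eq0; rewrite comp0K => e; apply: (row_free_inj fw); apply: (row_free_inj fB).
  by rewrite /= e !mul0mx.
have ab c i : b i *m v c i = a i *m v (c *m S) i.
  have : pk (gcomp b (v c)) = pk (gcomp a (v (c *m S))).
    by rewrite -!preE -(mulmxA _ B) eT (mulmxA _ T) -(mulmxA c w) wT !mulmxA.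
  by move=> e; have := congr1 (fun x => comp0 x i) e; rewrite !pkK.
have vsum c i : v c i = \sum_j c 0 j *: v (delta_mx 0 j) i.
  rewrite /v {1}(row_sum_delta c) /comp0 !mulmx_suml submxrow_sum linear_sum /=.
  apply: eq_bigr => j _; rewrite -!scalemxAl.
  by rewrite -[RHS]linearZ; congr vec_mx; apply/rowP=> y; rewrite !mxE.
(* Evaluation: [c] tensor [u] goes to the value of the map [v c] at [u]. *)
pose ev : gm (rpow r L) E := fun i => lin1_mx (fun u : 'rV_(r * rdim L i) =>
  \sum_j row j (vec_mx u) *m v (delta_mx 0 j) i).
have evE i (c : 'rV_r) (u : 'rV_(rdim L i)) : mxvec (c^T *m u) *m ev i = u *m v c i.
  rewrite mul_rV_linear => [|e x y]; last first.
    rewrite scaler_sumr -big_split; apply: eq_bigr => j _.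
    by rewrite !linearP /= mulmxDl -scalemxAl.
  rewrite mxvecK vsum mulmx_sumr; apply: eq_bigr => j _.
  rewrite row_mul (_ : row j c^T = (c 0 j)%:M) ?mul_scalar_mx -?scalemxAl -?scalemxAr //.
  by apply/rowP=> y; rewrite !mxE !ord1 eqxx mulr1n.
have hev : hom ev.
  move=> al; apply: tensor_inj => c u; rewrite !mulmxA mxvec_mulmxr -mulmxA !evE.
  by rewrite -!mulmxA (hv c al).
(* [c] tensor [u] goes to [c] tensor [u b] minus [c S] tensor [u a], which [ev] kills by [ab]. *)
pose ph : gm (rpow r L') (rpow r L) := fun i =>
  lin_mulmxr (b i) - lin_mulmx S^T *m lin_mulmxr (a i).
have phE i (c : 'rV_r) (u : 'rV_(rdim L' i)) : mxvec (c^T *m u) *m ph i =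
    mxvec (c^T *m (u *m b i)) - mxvec ((c *m S)^T *m (u *m a i)).
  by rewrite mulmxBr (mulmxA _ (lin_mulmx _)) mxvec_mulmx !mxvec_mulmxr trmx_mul !mulmxA.
have hph : hom ph.
  move=> al; apply: tensor_inj => c u; rewrite !mulmxA mxvec_mulmxr -mulmxA !phE.
  by rewrite mulmxBl !mxvec_mulmxr -!mulmxA ha hb.
have phev i : ph i *m ev i = 0.
  apply: tensor_inj => c u; rewrite mulmxA phE mulmxBl !evE -!mulmxA ab subrr.
  by rewrite mulmx0.
have phS i : lin_mulmx S^T *m ph i = ph i *m lin_mulmx S^T.
  apply: tensor_inj => c u; rewrite !mulmxA mxvec_mulmx mulmxA -trmx_mul !phE mulmxBl.
  by rewrite !mxvec_mulmx !mulmxA -!trmx_mul.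
have mph : mono ph.
  have [X0 [j0 [mj0 ej0]]] := ker_ex hph.
  have dv i : (r %| rdim X0 i)%N.
    have /eqP <- := mj0.2 i; rewrite ej0; apply: irred_dvdn irr _.
    by apply/sub_kermxP; rewrite -mulmxA phS mulmxA mulmx_ker mul0mx.
  have [I [p [j [ep mj e]]]] := img_ex hph.
  have s : ses j0 p.
    split=> // i; apply: eqmx_trans (ej0 i) _; apply/eqmxP/andP; split; apply/sub_kermxP.
      by apply: (row_free_inj (mj.2 i)); rewrite /= mul0mx -mulmxA -e mulmx_ker.
    by rewrite e mulmxA mulmx_ker mul0mx.
  have [z|nz] := classic (rep_is0 X0).
    by have [_ h] := mono_comp (ses_is0l_mono s z) mj; split=> // i; rewrite e; apply: h.
  exfalso; have dX := tf_rpow lL'.1 mj0 nz.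
  have [t et] : exists t, defect X0 = r%:Z * t.
    exists (defect (zero_rep k (fun i => (rdim X0 i %/ r)%N))).
    rewrite -euler_scaler; apply: euler_ext => // i; rewrite /dimvec /= -PoszM mulnC.
    by rewrite divnK.
  have eI := ses_defect d s; rewrite defect_rpow lL'.2 in eI.
  (* The defect of the kernel is negative and divisible by [r], and L'^r has defect [- r]; so the
     image has defect at least 0 and, lying in the torsion-free L^r, is zero. *)
  have zI : rep_is0 I.
    have tn : t <= -1 by rewrite et in dX; nia.
    apply: NNPP => nI; have := tf_rpow lL.1 mj nI; rewrite et in eI; nia.
  (* As [ph] vanishes, a single coordinate of it exhibits [b] as a multiple of [a]. *)
  suff : forall i, b i = S (Ordinal r0) (Ordinal r0) *: a i by apply: indep.
  move=> i; apply/row_matrixP=> x.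
  rewrite linearZ /= !rowE; set u := delta_mx 0 x; set c := delta_mx 0 (Ordinal r0) : 'rV[k]_r.
  have := phE i c u; rewrite e (is0_mxr p i zI) mul0mx mulmx0 => /eqP; rewrite eq_sym subr_eq0.
  move=> /eqP/(congr1 vec_mx); rewrite !mxvecK => /(congr1 (row (Ordinal r0))).
  rewrite !row_mul; have rc (c' : 'rV[k]_r) : row (Ordinal r0) c'^T = (c' 0 (Ordinal r0))%:M.
    by apply/rowP=> y; rewrite !mxE !ord1 eqxx mulr1n.
  by rewrite !rc !mul_scalar_mx /c -rowE !mxE !eqxx scale1r.
have eev : epi ev.
  split=> // i; rewrite -sub1mx.
  have e0 : epi (v (delta_mx 0 (Ordinal r0))).
    apply: homog_epi => //; apply: NNPP => n.
    have /v0/rowP/(_ (Ordinal r0)) : forall i, v (delta_mx 0 (Ordinal r0)) i = 0.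
      by move=> l; apply: NNPP => nl; apply: n; exists l.
    by rewrite !mxE !eqxx => /eqP; rewrite oner_eq0.
  apply: submx_trans (_ : v (delta_mx 0 (Ordinal r0)) i <= _)%MS.
    by rewrite sub1mx; apply: e0.2.
  by apply/row_subP=> x; rewrite rowE -evE submxMl.
have rm : (r <= hd L E)%N by have /eqP <- := fw; apply: rank_leq_col.
(* At [i0] the cokernel of [ph] has dimension [r] and maps onto the component of [E], of dimension
   [m]. *)
have mr : (m <= r)%N.
  have [i0 d0] := i0_ex td.
  have : (ph i0 <= kermx (ev i0))%MS by apply/sub_kermxP.
  move/mxrankS; rewrite mxrank_ker; have /eqP -> := eev.2 i0; have /eqP -> := mph.2 i0.
  have := dimL i0; have := dimE i0; have := big i0; rewrite /dimvec d0 /=; nia.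
rewrite (hd_mult lL) in rm *.
have em : r = m by apply/eqP; rewrite eqn_leq rm mr.
have sph i : (kermx (ev i) <= ph i)%MS.
  have s : (ph i <= kermx (ev i))%MS by apply/sub_kermxP.
  rewrite -(geq_leqif (mxrank_leqif_sup s)) mxrank_ker.
  have /eqP -> := eev.2 i; have /eqP -> := mph.2 i.
  have := dimL i; have := dimE i; have := d_gt0 td i; rewrite /dimvec /= em.
  have := big i; nia.
pose Th : gm (rpow r L) (rpow r L) := fun i => lin_mulmx S^T.
have hTh : hom Th.
  move=> al; apply: tensor_inj => c u; rewrite !mulmxA mxvec_mulmxr !mxvec_mulmx.
  by rewrite mxvec_mulmxr !mulmxA.
have [|th hth eth] := fac_epi eev (hom_comp hTh hev).
  move=> i; apply/sub_kermxP; have /submxP[D ->] := sph i.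
  by rewrite /gcomp !mulmxA -[D *m ph i *m _]mulmxA -phS -!mulmxA phev !mulmx0.
have vth c i : v c i *m th i = v (c *m S) i.
  apply/row_matrixP=> x; rewrite !rowE mulmxA -evE -mulmxA -eth /gcomp mulmxA mxvec_mulmx.
  by rewrite mulmxA -trmx_mul evE.
pose c0 : 'rV[k]_r := delta_mx 0 (Ordinal r0).
pose post := lin1_mx (fun x => pk (gcomp (v c0) (@comp0 _ _ E E x))).
have postE x : x *m post = pk (gcomp (v c0) (comp0 x)).
  apply: mul_rV_linear; apply: (@pk_linear _ _ _ _ _ _ (fun f => gcomp (v c0) f)) => e f f' h' eh i.
  by rewrite /gcomp eh mulmxDr -scalemxAr.
set J := kermx (cobound E E) *m post.
(* [U] consists of the [c] for which [v c] is [v c0] followed by an endomorphism of [E]; composing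
   with [th] shows that it is stable under [S]. *)
pose U := kermx (w *m B *m cokermx J).
have UP (c : 'rV_r) : (c <= U)%MS = (c *m w *m B <= J)%MS.
  rewrite [in RHS]submxE /U; move: (cokermx J) => Z; apply/idP/eqP => [/sub_kermxP <-|e].
    by rewrite !mulmxA.
  by apply/sub_kermxP; rewrite !mulmxA.
have Jhom (x : gm E E) : hom x -> (pk (gcomp (v c0) x) <= J)%MS.
  move=> hx; have /submxP[y ey] := proj2 (hom_kermx x) hx.
  have -> : pk (gcomp (v c0) x) = pk x *m post.
    by rewrite postE; apply: comp0_inj => i; rewrite !pkK /gcomp pkK.
  by rewrite ey -mulmxA submxMl.
case: (irr _ U).
- apply/rV_subP=> u /submxP[D ->]; rewrite mulmxA.
  have : (D *m U <= U)%MS by apply: submxMl.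
  move: (D *m U) => c; rewrite !UP => /submxP[y ey].
  have hy : hom (comp0 (y *m kermx (cobound E E))) by apply/hom_comp0; apply: submxMl.
  have -> : c *m S *m w *m B = pk (gcomp (v c0) (gcomp (comp0 (y *m kermx (cobound E E))) th)).
    apply: comp0_inj => i; rewrite pkK -/(v (c *m S) i) -vth /gcomp mulmxA; congr (_ *m _).
    by rewrite /v ey /J mulmxA postE pkK.
  by apply: Jhom; apply: hom_comp.
- move=> U0; exfalso.
  have : (c0 <= U)%MS.
    rewrite UP (_ : c0 *m w *m B = pk (gcomp (v c0) (@gid _ _ E))); first by apply/Jhom/hom_id.
    by apply: comp0_inj => i; rewrite pkK /gcomp mulmx1.
  rewrite U0 submx0 => /eqP/rowP/(_ (Ordinal r0)); rewrite !mxE !eqxx => /eqP.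
  by rewrite oner_eq0.
move=> fU; rewrite -em; have /eqP <- := fw; rewrite -(mxrankMfree w fB).
apply: leq_trans (mxrankM_maxl (kermx (cobound E E)) post); apply: mxrankS.
apply/row_subP=> x; rewrite rowE mulmxA -UP; exact: submx_full.
Qed.

End Homogeneous.

(** * Maps from modules of defect -1 to uniserial regular modules *)

Section Torsion.
Variables (k : finFieldType) (Q : quiver) (d : 'I_(nvert Q) -> int).
Hypotheses (acy : acyclic Q) (td : tame_data d).
Implicit Types M N X Y A B C E L R : rep k Q.
Notation defect := (defect d).
Notation rg := (rg d).
Notation smp := (smp d).
Notation LB := (LB d).
Notation chain := (chain d).

Lemma hd_indep M N : (1 < hd M N)%N -> exists a b : gm M N,
  [/\ hom a, hom b, exists i, a i <> 0 & forall c, ~ (forall i, b i = c *: a i)].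
Proof.
move=> h2; have [|a ha na] := @hd_neq0 _ _ M N; first lia.
have [b hb nb] : exists2 b : gm M N, hom b & forall c, ~ (forall i, b i = c *: a i).
  apply: NNPP => n; suff : (hd M N <= 1)%N by lia.
  apply: leq_trans (rank_leq_row (pk a)); apply/mxrankS/rV_subP=> v /hom_comp0 hv.
  have [c ec] : exists c, forall i, comp0 v i = c *: a i.
    apply: NNPP => nc; apply: n; exists (comp0 v) => // c e; apply: nc; by exists c.
  suff -> : v = c *: pk a by apply: scalemx_sub.
  by apply: comp0_inj => i; rewrite -[c *: pk a]addr0 comp0_lin pkK ec /comp0 submxrow0 linear0 addr0.
by exists a, b.
Qed.

Lemma rdim_le_dimtot M i : (rdim M i <= dimtot M)%N.
Proof. by rewrite /dimtot (bigD1 i) //= leq_addr. Qed.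

(* If the Tits form is positive on [dimvec E] this is a count of dimensions; if
   it vanishes, [dimvec E] is a multiple of [d] and [homog_hd_le] applies. *)
Theorem hd_LB_smp L E : LB L -> smp E -> hd L E <> 0%N -> hd L E = hd E E.
Proof.
move=> lL sE nz; have [rE nE _] := sE; have [i0 d0] := i0_ex td.
have [L' [lL' eL' big bd]] := LB_big acy td (2 * dimtot E) lL.
rewrite -(eL' E rE) in nz *.
have big2 i : (2 * rdim E i < rdim L' i)%N.
  by apply: leq_ltn_trans (big i); rewrite leq_mul2l rdim_le_dimtot.
have [p|q0] : 0 < euler (dimvec E) (dimvec E) \/ euler (dimvec E) (dimvec E) = 0.
- have := tits_ge0 td (dimvec E); lia.
- exact: (hd_LB_smp_pos acy td).
have [g hg [i gi]] := hd_neq0 nz.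
have [|eg _] := LB_smp_ker lL' sE hg gi.
  by apply: not_mono_dim; exists i0; have := big2 i0; lia.
have le1 := hd_epi E eg.
have [t et] := tits_eq0 td q0.
have t0 : 0 < t.
  have [j hj] := not_is0 nE; have := et j; have := d_gt0 td j; rewrite /dimvec; nia.
have dE j : dimvec E j = `|t|%N%:Z * d j by rewrite et; lia.
apply/eqP; rewrite eqn_leq le1 andbT.
have [m1|m2] : (`|t| = 1)%N \/ (1 < `|t|)%N by lia.
  rewrite (hd_mult acy td sE dE lL') m1 lt0n; apply/eqP => /hd_id_eq0; exact: nE.
(* The pencil comes from [L2] of dimension vector that of [L'] minus [d]: dim Hom(L2, L') is at
   least <L', L'> - <d, L'> = 1 + 1. *)
have [|L2 [lL2 e2]] := LB_shift acy td (t := -1) lL'.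
  by move=> j; have := bd j; have := d_gt0 td j; rewrite /dimvec; lia.
have h2 : (1 < hd L2 L')%N.
  have := hd_ed L2 L'; rewrite (euler_ext e2 (frefl _)) euler_addl euler_scalel (LB_q acy td lL').
  have := lL'.2; rewrite /Defs.defect => ->; lia.
have [a [b [ha hb na ind]]] := hd_indep h2.
apply: (homog_hd_le acy td lL' lL2 sE _ dE m2 _ ha hb ind na).
- by move=> j; rewrite e2; lia.
- by move=> j; have := big2 j; lia.
Qed.

Lemma chain_sub M N (f : gm N M) : mono f -> chain M -> chain N.
Proof.
move=> mf cM A B g h mg mh eA eB.
have back X Y (x : gm X N) (y : gm Y N) : (forall i, gcomp x f i <= gcomp y f i)%MS ->
    forall i, (x i <= y i)%MS.
  move=> l i; have /submxP[w ew] := l i.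
  have -> : x i = w *m y i by apply: (row_free_inj (mf.2 i)); rewrite /= -mulmxA; exact: ew.
  exact: submxMl.
by case: (cM _ _ _ _ (mono_comp mg mf) (mono_comp mh mf) eA eB) => l; [left|right];
  apply: back.
Qed.

Lemma smp_endo E (th : gm E E) i : smp E -> hom th -> th i <> 0 -> mono th.
Proof. by move=> sE hth thi; have [rE _ _] := sE; apply: (smp_mono rE sE hth thi). Qed.

(* Two epimorphisms from [L] onto a uniserial regular module have the same
   kernel: they agree up to an automorphism on the top, and then by induction. *)
Lemma LB_chain_ker R L (p q : gm L R) : LB L -> rg R -> chain R -> epi p -> epi q ->
  forall i, (kermx (p i) <= kermx (q i))%MS.
Proof.
have [n] := ubnP (dimtot R); elim: n R L p q => // n IH R L p q; rewrite ltnS.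
move=> lR lL rR cR ep eq; have [z|nz] := classic (rep_is0 R).
  by move=> i; rewrite (is0_mxr p i z) (is0_mxr q i z).
have [E [e [ee sE]]] := smp_quo_ex rR nz; have [rE nE _] := sE.
have [Z [z sz]] := ker_epi_ses ee; have [mz _ zz] := sz.
have eZ : defect Z = 0 by have := ses_defect d sz; rewrite rR.1 rE.1; lia.
have epe := epi_comp ep ee; have eqe := epi_comp eq ee.
have [v hv] := not_is0 nE.
have nzp : gcomp p e v <> 0.
  by move=> h; have := epe.2 v; rewrite h /row_full mxrank0; lia.
have nzq : gcomp q e v <> 0.
  by move=> h; have := eqe.2 v; rewrite h /row_full mxrank0; lia.
have hLE := hd_LB_smp lL sE (hd_pos epe.1 nzp).
have [||th hth eth] := @hd_pre_surj _ _ L E E _ epe.1 _ _ _ eqe.1.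
- by move=> h _ h0 i; apply: (row_full_inj (epe.2 i)); rewrite mulmx0.
- by rewrite hLE.
have mth : mono th.
  by apply: (@smp_endo _ _ v) => // h; apply: nzq; rewrite eth h mulmx0.
have [W [w sw]] := ker_epi_ses epe; have [mw _ zw] := sw.
have lW : LB W.
  by apply: (LB_sub lL mw); have := ses_defect d sw; rewrite lL.2 rE.1; lia.
have zq i : (kermx (gcomp q e i) <= w i)%MS.
  rewrite zw; apply/sub_kermxP; apply: (row_free_inj (mth.2 i)).
  by rewrite /= mul0mx -mulmxA -eth mulmx_ker.
have wqe i : w i *m gcomp q e i = 0 by rewrite eth mulmxA (ses_comp0 i sw) mul0mx.
have [|p' hp' ep'] := fac_mono mz (hom_comp mw.1 ep.1).
  by move=> i; rewrite zz; apply/sub_kermxP; rewrite /gcomp -mulmxA; apply: (ses_comp0 i sw).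
have [|q' hq' eq'] := fac_mono mz (hom_comp mw.1 eq.1).
  by move=> i; rewrite zz; apply/sub_kermxP; rewrite /gcomp -mulmxA; apply: wqe.
have onto (x : gm L R) (x' : gm W Z) : epi x -> hom x' ->
    (forall i, gcomp w x i = x' i *m z i) -> (forall i, kermx (gcomp x e i) <= w i)%MS -> epi x'.
  move=> ex hx' ex' kx; split=> // i; rewrite -sub1mx.
  have /submxP[y ey] : (z i <= x i)%MS by apply: submx_full; apply: ex.2.
  have /submxP[y' ey'] : (y <= w i)%MS.
    apply: submx_trans (kx i); apply/sub_kermxP; by rewrite /gcomp mulmxA -ey (ses_comp0 i sz).
  have -> : 1%:M = y' *m x' i.
    apply: (row_free_inj (mz.2 i)); rewrite /= mul1mx -mulmxA -ex' /gcomp mulmxA -ey'; exact: ey.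
  exact: submxMl.
have ep2 : epi p' by apply: (onto p) => // i; rewrite zw.
have eq2 : epi q' by apply: (onto q).
have lZ : (dimtot Z < n)%N.
  have := ses_dimtot sz; have := dimtot_gt0 nE; lia.
have rZ := rg_sub rR mz eZ.
have := IH Z W p' q' lZ lW rZ (chain_sub mz cR) ep2 eq2 => H i.
apply/rV_subP=> u /sub_kermxP u0.
have /submxP[y ey] : (u <= w i)%MS.
  by rewrite zw; apply/sub_kermxP; rewrite /gcomp mulmxA u0 mul0mx.
have y0 : y *m q' i = 0.
  apply/sub_kermxP; apply: submx_trans (H i); apply/sub_kermxP.
  apply: (row_free_inj (mz.2 i)); rewrite /= mul0mx -mulmxA -ep' /gcomp mulmxA -ey; exact: u0.
apply/sub_kermxP; by rewrite ey -mulmxA -/(gcomp w q i) eq' mulmxA y0 mul0mx.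
Qed.

Section Top.
Variables (Y E : rep k Q) (e : gm Y E).
Hypotheses (rY : rg Y) (cY : chain Y) (ee : epi e) (sE : smp E).

(** The image of [f] is comparable with the kernel of [e]. If it is not contained in that kernel, it
    contains it and maps onto [E], so it is everything. *)
Lemma top_dichotomy A (f : gm A Y) : rg A -> hom f ->
  (forall i, f i *m e i = 0) \/ epi f.
Proof.
move=> rA hf; have [rE _ _] := sE.
have [h|/not_all_ex_not[v hv]] := classic (forall i, f i *m e i = 0); [by left | right].
have efe : epi (gcomp f e) := smp_epi rA sE (hom_comp hf ee.1) hv.
have [Z [z sz]] := ker_epi_ses ee; have [mz _ zz] := sz.
have eZ : defect Z = 0 by have := ses_defect d sz; rewrite rY.1 rE.1; lia.
have [I [p [j [ep mj ej]]]] := img_ex hf.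
have rI := rg_img rA rY ep mj.
have zj : forall i, (z i <= j i)%MS.
  case: (cY mz mj eZ rI.1) => // l; exfalso; apply: hv.
  rewrite ej -mulmxA; have /sub_kermxP -> : (j v <= kermx (e v))%MS by rewrite -zz.
  by rewrite mulmx0.
have fj i : (f i :=: j i)%MS by rewrite ej; apply: eqmxMfull; apply: ep.2.
split=> // i; rewrite -sub1mx.
have /submxP[x ex] : (e i <= gcomp f e i)%MS by apply: submx_full; apply: efe.2.
have : (1%:M - x *m f i <= f i)%MS.
  rewrite fj; apply: submx_trans (zj i); rewrite zz; apply/sub_kermxP.
  by rewrite mulmxBl mul1mx -mulmxA -/(gcomp f e i) -ex subrr.
by move=> h; rewrite -[1%:M](subrK (x *m f i)) addmx_sub // submxMl.
Qed.

(** Compare the kernel of [th] with that of [e]. If it is the smaller one, [g] lands in the kernel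
    of [e]; otherwise [th] factors through an embedding of [E], and again [g] vanishes on the
    top. *)
Lemma top_faithful X (g : gm X Y) (v : 'I_(nvert Q)) : hom g -> g v *m e v <> 0 ->
  forall th : gm Y Y, hom th -> (forall i, g i *m th i = 0) -> forall i, th i = 0.
Proof.
move=> hg gv th hth g0 i; apply: NNPP => thi; have [rE _ _] := sE.
have [Z [z sz]] := ker_epi_ses ee; have [mz _ zz] := sz.
have eZ : defect Z = 0 by have := ses_defect d sz; rewrite rY.1 rE.1; lia.
have [K [l [ml el]]] := ker_ex hth; have eK := rg_ker rY rY hth ml el.
case: (cY ml mz eK eZ) => le.
  apply: gv; apply/sub_kermxP; rewrite -zz; apply: submx_trans (le v); rewrite el.
  exact/sub_kermxP.
have [|t ht et] := fac_epi ee hth.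
  by move=> j; rewrite -zz -el.
have mt : mono t by apply: (smp_mono (i := i) rY sE ht) => t0; apply: thi; rewrite et t0 mulmx0.
by apply: gv; apply: (row_free_inj (mt.2 v)); rewrite /= mul0mx -mulmxA -et.
Qed.

(** After translation by multiples of [d] the module is too large to embed in [Y], so each map that
    is nonzero on the top is onto. All these maps have the same kernel by [LB_chain_ker], hence
    factor through one of them. *)
Lemma hd_LB_chain L : LB L -> hd L E <> 0%N -> (hd L Y <= hd Y Y)%N.
Proof.
move=> lL nz; have [rE nE _] := sE.
have [L' [lL' eL' big _]] := LB_big acy td (dimtot Y) lL.
rewrite -(eL' E rE) in nz; rewrite -(eL' Y rY).
have [Z [z sz]] := ker_epi_ses ee; have [mz _ zz] := sz.
have eZ : defect Z = 0 by have := ses_defect d sz; rewrite rY.1 rE.1; lia.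
have [g0 hg0 [v gv]] := hd_neq0 nz.
have [g hg eg] := lift_ed acy sz (ed_LB_rg acy td lL' (rg_sub rY mz eZ)) hg0.
have top (h : gm L' Y) : hom h -> h v *m e v <> 0 -> epi h.
  move=> hh hv; have hi : h v <> 0 by move=> h0; apply: hv; rewrite h0 mul0mx.
  have [|I [p [j [K [l [s mj rI lK ej]]]]]] := LB_rg_img lL' rY hh hi.
    apply: not_mono_dim; exists v; apply: leq_ltn_trans (big v); exact: rdim_le_dimtot.
  have [_ ep _] := s; case: (top_dichotomy rI mj.1) => [j0|ej'].
    by exfalso; apply: hv; rewrite ej -mulmxA j0 mulmx0.
  by split=> // i; rewrite ej; have [_ H] := epi_comp ep ej'; apply: H.
have gv' : g v *m e v <> 0 by rewrite eg.
have epg := top g hg gv'.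
have fac (h : gm L' Y) : hom h -> h v *m e v <> 0 ->
    exists2 t : gm Y Y, hom t & forall i, h i = g i *m t i.
  move=> hh hv; apply: fac_epi => //; apply: LB_chain_ker => //; exact: top.
apply: (hd_pre_le hg) => h hh.
have [h0|h1] := classic (h v *m e v = 0); last exact: fac.
(* A map that vanishes on the top at [v] is treated by adding [g]. *)
have [|t ht et] := fac (gadd h g) (hom_add hh hg).
  by rewrite /gadd mulmxDl h0 add0r.
exists (gadd t (gscale (-1) (@gid _ _ Y))).
  by apply/hom_add/hom_scale/hom_id.
move=> i; rewrite /gadd /gscale /gid scaleN1r mulmxBr mulmx1 -et /gadd addrK //.
Qed.

(** Precomposition with [g] is injective on End(Y) by [top_faithful], and Hom(L, Y) is no larger.
    This reaches [L] itself, where [g] may be injective. *)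
Lemma LB_top_fac L (g : gm L Y) v : LB L -> hom g -> g v *m e v <> 0 ->
  forall h : gm L Y, hom h -> exists2 t : gm Y Y, hom t & forall i, h i = g i *m t i.
Proof.
move=> lL hg gv; apply: hd_pre_surj => //; first exact: top_faithful hg gv.
apply: hd_LB_chain => //; apply: (hd_pos (hom_comp hg ee.1) gv).
Qed.

End Top.

End Torsion.

(** * Null roots of the extended Dynkin diagrams *)

Section ExtendedDynkin.

(** The contribution of the edge [e] to the sum of [v] over the neighbours of [i]. *)
Definition ends (v : nat -> nat) (i : nat) (e : nat * nat) : nat :=
  ((e.1 == i) * v e.2 + (e.2 == i) * v e.1)%N.

(* The last clause says that a vector which is proportional to [v] along every
   edge is proportional to [v]. *)
Definition null_root N (es : seq (nat * nat)) (v : nat -> nat) : Prop :=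
  [/\ forall i, (0 < v i)%N, forall i, (i < N)%N -> (2 * v i = \sum_(e <- es) ends v i e)%N
    & exists r, [/\ (r < N)%N, v r = 1%N & forall z : nat -> int,
      (forall e, e \in es -> (v e.2)%:Z * z e.1 = (v e.1)%:Z * z e.2) ->
      forall i, (i < N)%N -> z i = (v i)%:Z * z r]].

Lemma sum_iota_eq m l (F : nat -> nat) j :
  (\sum_(t <- iota m l) (t == j) * F t = (m <= j < m + l) * F j)%N.
Proof.
rewrite -mem_iota; have [jm|nj] := boolP (j \in iota m l).
  by rewrite (bigD1_seq j) ?iota_uniq //= eqxx big1 ?addn0 // => t /negPf ->.
rewrite big_seq big1 // => t tm; case: eqP => // e; by rewrite -e tm in nj.
Qed.

Lemma sum_path_ends v i m l :
  (\sum_(e <- [seq (t, t.+1) | t <- iota m l]) ends v i e =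
   (m <= i < m + l) * v i.+1 + (m < i <= m + l) * v i.-1)%N.
Proof.
rewrite big_map /ends /= big_split /= (sum_iota_eq m l (fun t => v t.+1)); congr (_ + _)%N.
case: i => [|i]; first by rewrite big1.
rewrite -(sum_iota_eq m l v i); apply: eq_bigr => t _; by rewrite eqSS.
Qed.

Lemma null_root_A n : (0 < n)%N ->
  null_root n.+1 [seq (i, (i.+1 %% n.+1)%N) | i <- iota 0 n.+1] (fun=> 1%N).
Proof.
move=> n0.
have -> : [seq (i, (i.+1 %% n.+1)%N) | i <- iota 0 n.+1]
    = [seq (i, i.+1) | i <- iota 0 n] ++ [:: (n, 0%N)].
  rewrite -addn1 iotaD map_cat addn1 /= modnn; congr (_ ++ _).
  by apply/eq_in_map => i; rewrite mem_iota => h; rewrite modn_small.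
split=> // [i li|].
  by rewrite big_cat sum_path_ends big_seq1 /ends /=; lia.
exists 0%N; split=> // z hz; elim=> [|i IH] li; first by rewrite mul1r.
rewrite mul1r -[RHS]mul1r -(IH (ltnW li)); have := hz (i, i.+1); rewrite /= !mul1r => <- //.
by rewrite mem_cat map_f // mem_iota.
Qed.

Definition rootD n (i : nat) : nat := if (i < 2)%N || (n - 2 < i)%N then 1 else 2.

Lemma null_root_D n : (4 <= n)%N ->
  null_root n.+1 ([:: (0, 2); (1, 2); (n - 2, n - 1); (n - 2, n)]%N
                     ++ [seq (i, i.+1) | i <- iota 2 (n - 4)]) (rootD n).
Proof.
move=> n4; set v := rootD n.
have v0 i : (i < 2)%N -> v i = 1%N by rewrite /v /rootD => ->.
have vm i : (2 <= i <= n - 2)%N -> v i = 2%N by rewrite /v /rootD; case: ifP => //; lia.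
have vn i : (n - 2 < i)%N -> v i = 1%N by rewrite /v /rootD => ->; rewrite orbT.
have [e0 e1 e2] : [/\ v 0%N = 1%N, v 1%N = 1%N & v 2%N = 2%N] by split; [exact: v0 | exact: v0 | apply: vm; lia].
have [e3 e4 e5] : [/\ v (n - 2)%N = 2%N, v (n - 1)%N = 1%N & v n = 1%N].
  by split; [apply: vm | apply: vn | apply: vn]; lia.
split=> [i|i li|]; first by rewrite /v /rootD; case: ifP.
  rewrite big_cat sum_path_ends !big_cons big_nil /ends /= e0 e1 e2 e3 e4 e5.
  have -> : ((2 <= i < 2 + (n - 4)) * v i.+1 = (2 <= i < 2 + (n - 4)) * 2)%N.
    by case: (boolP (2 <= i < 2 + (n - 4))%N) => h; rewrite ?mul0n // (vm i.+1) //; lia.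
  have -> : ((2 < i <= 2 + (n - 4)) * v i.-1 = (2 < i <= 2 + (n - 4)) * 2)%N.
    by case: (boolP (2 < i <= 2 + (n - 4))%N) => h; rewrite ?mul0n // (vm i.-1) //; lia.
  have [l|g] := boolP (i < 2)%N; first by rewrite v0 //; lia.
  have [l2|g2] := boolP (n - 2 < i)%N; first by rewrite vn //; lia.
  rewrite (vm i); lia.
exists 0%N; split=> // z hz.
have h1 := hz (0, 2)%N; have h2 := hz (1, 2)%N.
have h3 := hz (n - 2, n - 1)%N; have h4 := hz (n - 2, n)%N.
move: h1 h2 h3 h4; rewrite !inE !eqxx !orbT /= e0 e1 e2 e3 e4 e5 => h1 h2 h3 h4.
have {}h1 := h1 isT; have {}h2 := h2 isT; have {}h3 := h3 isT; have {}h4 := h4 isT.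
have mid i : (2 <= i <= n - 2)%N -> z i = 2 * z 0%N.
  elim: i => // i IH li; have [i1|i2] : i = 1%N \/ (2 <= i)%N by lia.
    by rewrite i1; lia.
  have := hz (i, i.+1); rewrite mem_cat map_f ?orbT; last by rewrite mem_iota; lia.
  move=> /(_ isT) /=; rewrite !vm ?(IH _); lia.
move=> i li; have [l|g] := boolP (i < 2)%N.
  rewrite v0 //; have [->|->] : i = 0%N \/ i = 1%N by lia.
    lia.
  lia.
have [l2|g2] := boolP (n - 2 < i)%N; last by rewrite (vm i) ?(mid i) //; lia.
have := mid (n - 2)%N; rewrite vn //.
have [->|->] : i = (n - 1)%N \/ i = n by lia.
  lia.
lia.
Qed.

Lemma null_root_explicit N es (s : seq nat) r :
  size s = N -> all (leq 1) s -> (r < N)%N -> nth 1%N s r = 1%N ->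
  all (fun i => 2 * nth 1 s i == \sum_(e <- es) ends (nth 1 s) i e)%N (iota 0 N) ->
  (forall z : nat -> int,
      (forall e, e \in es -> (nth 1 s e.2)%:Z * z e.1 = (nth 1 s e.1)%:Z * z e.2) ->
      forall i, (i < N)%N -> z i = (nth 1 s i)%:Z * z r) ->
  null_root N es (nth 1%N s).
Proof.
move=> sN ps lr e1 h hz; split; last by exists r.
- move=> i; have [l|g] := ltnP i (size s); last by rewrite nth_default.
  by move/allP: ps; apply; apply: mem_nth.
by move=> i li; move/allP: h => /(_ i); rewrite mem_iota => /(_ li)/eqP.
Qed.

Lemma ext_dynkin_null_root N es : ext_dynkin N es -> exists v, null_root N es v.
Proof.
case=> [n n0|n n4|||]; first by exists (fun=> 1%N); apply: null_root_A.
- by exists (rootD n); apply: null_root_D.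
(* The coefficients of the null root, listed by vertex; the vertex passed to [null_root_explicit] is
   the end of an arm, with coefficient 1. *)
- exists (nth 1%N [:: 3; 2; 1; 2; 1; 2; 1]%N).
  apply: (@null_root_explicit _ _ _ 2%N) => //.
    by rewrite /= !big_cons !big_nil.
  move=> z hz.
  have h1 := hz (0, 1)%N isT; have h2 := hz (1, 2)%N isT; have h3 := hz (0, 3)%N isT.
  have h4 := hz (3, 4)%N isT; have h5 := hz (0, 5)%N isT; have h6 := hz (5, 6)%N isT.
  move: h1 h2 h3 h4 h5 h6; rewrite /= => h1 h2 h3 h4 h5 h6.
  by do 7! [case=> [_ /=|]; first lia].
- exists (nth 1%N [:: 4; 2; 3; 2; 1; 3; 2; 1]%N).
  apply: (@null_root_explicit _ _ _ 4%N) => //.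
    by rewrite /= !big_cons !big_nil.
  move=> z hz.
  have h1 := hz (0, 1)%N isT; have h2 := hz (0, 2)%N isT; have h3 := hz (2, 3)%N isT.
  have h4 := hz (3, 4)%N isT; have h5 := hz (0, 5)%N isT; have h6 := hz (5, 6)%N isT.
  have h7 := hz (6, 7)%N isT.
  move: h1 h2 h3 h4 h5 h6 h7; rewrite /= => h1 h2 h3 h4 h5 h6 h7.
  by do 8! [case=> [_ /=|]; first lia].
exists (nth 1%N [:: 6; 3; 4; 2; 5; 4; 3; 2; 1]%N).
apply: (@null_root_explicit _ _ _ 8%N) => //.
  by rewrite /= !big_cons !big_nil.
move=> z hz.
have h1 := hz (0, 1)%N isT; have h2 := hz (0, 2)%N isT; have h3 := hz (2, 3)%N isT.
have h4 := hz (0, 4)%N isT; have h5 := hz (4, 5)%N isT; have h6 := hz (5, 6)%N isT.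
have h7 := hz (6, 7)%N isT; have h8 := hz (7, 8)%N isT.
move: h1 h2 h3 h4 h5 h6 h7 h8; rewrite /= => h1 h2 h3 h4 h5 h6 h7 h8.
by do 9! [case=> [_ /=|]; first lia].
Qed.

Lemma ends_uedge v i e : ends v i (uedge e) = ends v i e.
Proof. by rewrite /ends /uedge /=; case: (leqP e.1 e.2) => h; lia. Qed.

Lemma tame_tame_data (Q : quiver) : tame Q -> exists d : 'I_(nvert Q) -> int, tame_data d.
Proof.
case=> N [es [/ext_dynkin_null_root[v [v0 deg [r [lr vr con]]]] [sg [tau st ts] pe]]].
exists (fun i => (v (val (sg i)))%:Z); split.
- by move=> i; have := v0 (val (sg i)); lia.
- by exists (tau (Ordinal lr)); rewrite ts /= vr.
- move=> i; have := deg _ (ltn_ord (sg i)).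
  under eq_bigr => e _ do rewrite -ends_uedge.
  rewrite -(big_map uedge xpredT (ends v (val (sg i)))) -(perm_big _ pe) big_map /= big_enum /=.
  move=> h; rewrite -PoszM h (big_morph Posz PoszD (erefl _)); apply: eq_bigr => a _.
  rewrite ends_uedge /ends /= !val_eqE !(inj_eq (can_inj st)); lia.
move=> z hz.
pose z' n := oapp (fun j : 'I_N => z (tau j)) 0 (insub n).
have zE i : z' (val (sg i)) = z i by rewrite /z' valK /= st.
have {}con : forall n, (n < N)%N -> z' n = (v n)%:Z * z' r.
  apply: con => e ee.
  have : uedge e \in [seq uedge e | e <- es] by apply: map_f.
  rewrite -(perm_mem pe) => /mapP[a _]; rewrite /uedge /=.
  have := hz a; rewrite -!zE => h.
  case: (leqP e.1 e.2) => l1; case: (leqP (sg (src a)) (sg (tgt a))) => l2 [e1 e2];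
    rewrite e1 e2; (exact: h || exact: esym h).
by move=> i j; rewrite -!zE (con _ (ltn_ord (sg i))) (con _ (ltn_ord (sg j))); ring.
Qed.

(** [delta] is a positive multiple of the vector [d] read off from the diagram, and [d] is itself an
    imaginary root below it. *)
Lemma min_root_tame_data (Q : quiver) (delta : 'I_(nvert Q) -> int) :
  tame Q -> min_pos_imaginary_root delta -> tame_data delta.
Proof.
move=> /tame_tame_data[d td] [[p [i ni] q0] mn].
have [t et] := tits_eq0 td q0.
have t0 : 0 < t.
  by have := p i; have := d_gt0 td i; move: ni; rewrite et; nia.
suff -> : delta = d by [].
apply: functional_extensionality => j; symmetry; apply: mn.
  split=> [l||]; first by have := d_gt0 td l; lia.
    by exists i; have := d_gt0 td i; lia.
  exact: euler_dd td.
by move=> l; rewrite et; have := d_gt0 td l; nia.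
Qed.

End ExtendedDynkin.

(** * Exact sequences in block form *)

Section HallNumber.
Variables (k : finFieldType) (Q : quiver) (d : 'I_(nvert Q) -> int).
Hypotheses (acy : acyclic Q) (td : tame_data d).
Implicit Types M N A B C I K U V X Y Z : rep k Q.
Notation defect := (defect d).
Notation rg := (rg d).
Notation smp := (smp d).
Notation LB := (LB d).
Notation chain := (chain d).

Lemma chain_uniq M A B (f : gm A M) (g : gm B M) : chain M -> mono f -> mono g ->
  defect A = 0 -> defect B = 0 -> (forall i, rdim A i = rdim B i) ->
  forall i, (f i :=: g i)%MS.
Proof.
move=> cM mf mg eA eB e i.
have rk : \rank (f i) = \rank (g i) by have /eqP -> := mf.2 i; have /eqP -> := mg.2 i.
case: (cM _ _ _ _ mf mg eA eB) => l.
  by apply/eqmxP; rewrite -(geq_leqif (mxrank_leqif_eq (l i))) rk.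
by apply: eqmx_sym; apply/eqmxP; rewrite -(geq_leqif (mxrank_leqif_eq (l i))) rk.
Qed.

Lemma iso_mono_img M A B (f : gm A M) (g : gm B M) : mono f -> mono g ->
  (forall i, (f i :=: g i)%MS) -> iso A B.
Proof.
move=> mf mg e; have [|h hh eh] := fac_mono mg mf.1; first by move=> i; rewrite e.
have mh : mono h.
  by apply: (mono_left (g := g)) => //; split=> [|i]; [exact: hom_comp hh mg.1 | rewrite /gcomp -eh; apply: mf.2].
exists h; split=> //; apply: mono_dim_epi => // i.
by have /eqP <- := mg.2 i; rewrite -e; have /eqP -> := mf.2 i.
Qed.

Lemma iso_epi_ker M A B (f : gm M A) (g : gm M B) : epi f -> epi g ->
  (forall i, (kermx (f i) :=: kermx (g i))%MS) -> iso A B.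
Proof.
move=> ef eg e; have [|h hh eh] := fac_epi ef eg.1; first by move=> i; rewrite e.
have eph : epi h.
  by apply: (epi_right (f := f)) => //; split=> [|i]; [exact: hom_comp ef.1 hh | rewrite /gcomp -eh; apply: eg.2].
exists h; split=> //; apply: epi_dim_mono => // i.
have /eqP := ef.2 i; have /eqP := eg.2 i.
have : \rank (kermx (f i)) = \rank (kermx (g i)) by rewrite e.
rewrite !mxrank_ker; have := rank_leq_row (f i); have := rank_leq_row (g i); lia.
Qed.

Section Sequence.
Variables P P' R R' R'' : rep k Q.
Hypotheses (lP : LB P) (lP' : LB P') (rR : rg R) (rR' : rg R') (rR'' : rg R'').

(* In block form the component [R -> P'] of [f] vanishes since Hom(R, P') = 0,
   and [f11] is injective since a nonzero map into a torsion-free module is. *)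
Lemma ses_blocks (f : gm (rsum P R) (rsum P' R')) (g : gm (rsum P' R') R'') : ses f g ->
  exists (f11 : gm P P') (f12 : gm P R') (f22 : gm R R') (g1 : gm P' R'') (g2 : gm R' R''),
  [/\ mono f11, hom f12, mono f22 & [/\ hom g1, hom g2,
      forall i, g i = col_mx (g1 i) (g2 i),
      forall i, f i = col_mx (row_mx (f11 i) (f12 i)) (row_mx 0 (f22 i))
    & (forall i, (f22 i :=: kermx (g2 i))%MS)]].
Proof.
move=> s; have [mf eg z] := s.
have [fP [fR [hP hR eF]]] := rout_ex mf.1.
have [f11 [f12 [h11 h12 eP]]] := rin_ex hP; have [f21 [f22 [h21 h22 eR]]] := rin_ex hR.
have [g1 [g2 [hg1 hg2 eG]]] := rout_ex eg.1.
have f21_0 : forall i, f21 i = 0 by apply: (hd_eq0 R P').1 => //; exact: hd_rg_tf rR lP'.1.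
have eRi i : fR i = row_mx 0 (f22 i) by rewrite eR f21_0.
have m22 : mono f22.
  have mR : mono fR.
    have := mono_comp (mono_inr P R) mf => -[_ h]; split=> // i; have := h i.
    by rewrite /gcomp eF mul_row_col mul0mx mul1mx add0r.
  split=> // i; have /row_freeP[D eD] := mR.2 i; apply/row_freeP; exists (dsubmx D).
  by rewrite -eD eRi -{2}[D]vsubmxK mul_row_col mul0mx add0r.
have [v nv] : exists v, f11 v <> 0.
  apply: NNPP => n; have f0 i : f11 i = 0 by apply: NNPP => m; apply: n; exists i.
  have [|h hh eh] := fac_epi eg (hom_prl P' R').
    move=> i; rewrite -z; apply/sub_kermxP; rewrite eF eP f0 eRi mul_col_mx !mul_row_col.
    by rewrite mulmx1 mulmx0 !mulmx0 !mul0mx !addr0 col_mx0.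
  have h0 : forall i, h i = 0 by apply: (hd_eq0 R'' P').1 => //; exact: hd_rg_tf rR'' lP'.1.
  apply: (LB_nz lP') => i; apply: (@one_eq0 k).
  by rewrite -(inl_prl P' R' i) eh h0 mulmx0 mulmx0.
have m11 := LB_mono lP lP'.1 h11 nv.
have fE i : f i = col_mx (row_mx (f11 i) (f12 i)) (row_mx 0 (f22 i)).
  by rewrite eF eP eRi.
have e22 i : (f22 i :=: kermx (g2 i))%MS.
  apply/eqmxP/andP; split.
    apply/sub_kermxP; have := ses_comp0 i s; rewrite fE eG mul_col_mx !mul_row_col mul0mx add0r.
    by move/eqP; rewrite col_mx_eq0 => /andP[_ /eqP].
  apply/rV_subP=> y /sub_kermxP y0.
  have : (row_mx 0 y <= f i)%MS.
    by rewrite z; apply/sub_kermxP; rewrite eG mul_row_col mul0mx y0 addr0.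
  case/submxP=> x; rewrite -[x]hsubmxK fE mul_row_col !mul_mx_row mulmx0 add_row_mx addr0.
  move/eq_row_mx=> [x0 ->].
  have -> : lsubmx x = 0 by apply: (row_free_inj (m11.2 i)); rewrite /= mul0mx -x0.
  by rewrite mul0mx add0r submxMl.
by exists f11, f12, f22, g1, g2.
Qed.

(** [q] followed by [g1] factors through the image of [g2] and lifts to a map [P -> R'] because
    Ext^1(P, R) = 0; minus this lift is the off-diagonal block of [f]. *)
Lemma ses_of_blocks (q : gm P P') (r : gm R R') (g1 : gm P' R'') (g2 : gm R' R'') :
  hom g1 -> hom g2 -> mono q -> mono r -> (forall i, (r i :=: kermx (g2 i))%MS) ->
  (forall i, q i *m g1 i <= g2 i)%MS -> (forall i, row_full (col_mx (g1 i) (g2 i))) ->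
  (forall i, rdim P' i + rdim R' i = rdim P i + rdim R i + rdim R'' i)%N ->
  exists f : gm (rsum P R) (rsum P' R'), ses f (rout g1 g2).
Proof.
move=> h1 h2 mq mr er sub full dims.
have [I [p [j [ep mj ej]]]] := img_ex h2.
have sr : ses r p.
  split=> // i; apply: eqmx_trans (er i) _; apply/eqmxP/andP; split; apply/sub_kermxP.
    by apply: (row_free_inj (mj.2 i)); rewrite /= mul0mx -mulmxA -ej mulmx_ker.
  by rewrite ej mulmxA mulmx_ker mul0mx.
have [|s hs es] := fac_mono mj (hom_comp mq.1 h1).
  by move=> i; apply: submx_trans (sub i) _; rewrite ej submxMl.
have [s' hs' es'] := lift_ed acy sr (ed_LB_rg acy td lP rR) hs.
pose f : gm (rsum P R) (rsum P' R') :=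
  rout (rin q (gscale (-1) s')) (rin (fun i => 0) r).
have hf : hom f.
  by apply: hom_rout; apply: hom_rin => //; [exact: mq.1 | exact: hom_scale | exact: hom0 | exact: mr.1].
have eg : epi (rout g1 g2) by split=> //; apply: hom_rout.
have fg i : f i *m rout g1 g2 i = 0.
  rewrite /f /rout /rin /gscale mul_col_mx !mul_row_col mul0mx add0r.
  have -> : r i *m g2 i = 0 by apply/sub_kermxP; rewrite er.
  by rewrite -scalemxAl scaleN1r ej mulmxA es' -es /gcomp subrr col_mx0.
have mf : mono f.
  split=> // i; rewrite -kermx_eq0 -submx0; apply/rV_subP=> x /sub_kermxP.
  rewrite -[x]hsubmxK /f /rout /rin mul_row_col !mul_mx_row mulmx0 add_row_mx addr0.
  move/eqP; rewrite row_mx_eq0 => /andP[/eqP x1 /eqP].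
  have -> : lsubmx x = 0 by apply: (row_free_inj (mq.2 i)); rewrite /= mul0mx.
  rewrite mul0mx add0r => x2.
  have -> : rsubmx x = 0 by apply: (row_free_inj (mr.2 i)); rewrite /= mul0mx.
  by rewrite row_mx0 sub0mx.
exists f; split=> // i; apply/eqmxP; rewrite -(geq_leqif (mxrank_leqif_eq _)); last by apply/sub_kermxP.
rewrite mxrank_ker; have /eqP -> := eg.2 i; have /eqP -> := mf.2 i.
by rewrite /= dims addnK.
Qed.

Lemma ses_split_iff : short_exact (rsum P R) (rsum P' R') R'' <->
   exists R1 R2 : rep k Q,
     [/\ short_exact R R' R1, short_exact P P' R2 & short_exact R1 R'' R2].
Proof.
split.
  move/short_exactP=> [f [g s]]; have [mf eg z] := s.
  have [f11 [f12 [f22 [g1 [g2 [m11 h12 m22 [hg1 hg2 eG fE e22]]]]]]] := ses_blocks s.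
  have [R1 [p1 s1]] := cok_mono_ses m22; have [R2 [p2 s2]] := cok_mono_ses m11.
  have [_ ep1 z1] := s1; have [_ ep2 z2] := s2.
  exists R1, R2; split; [by apply/short_exactP; exists f22, p1 | by apply/short_exactP; exists f11, p2 |].
  have [|u hu eu] := fac_epi ep1 hg2; first by move=> i; rewrite -z1 e22.
  have [|w hw ew] := fac_epi eg (hom_comp (hom_prl P' R') ep2.1).
    move=> i; rewrite -z; apply/sub_kermxP; rewrite /gcomp mulmxA fE mul_col_mx !mul_row_col.
    by rewrite !mulmx1 !mulmx0 !addr0 mul_col_mx (ses_comp0 i s2) mul0mx col_mx0.
  have uw i : u i *m w i = 0.
    apply: (row_full_inj (ep1.2 i)); rewrite mulmx0 mulmxA -eu.
    have : inr P' R' i *m (g i *m w i) = 0 by rewrite -ew /gcomp mulmxA inr_prl mul0mx.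
    by rewrite mulmxA eG mul_row_col mul0mx mul1mx add0r.
  have mu : mono u.
    split=> // i; rewrite -kermx_eq0 -submx0; apply/rV_subP=> x /sub_kermxP x0.
    have /submxP[y ey] : (x <= p1 i)%MS by apply: submx_full; apply: ep1.2.
    have : (y <= f22 i)%MS by rewrite e22; apply/sub_kermxP; rewrite eu mulmxA -ey.
    by rewrite z1 => /sub_kermxP y0; rewrite ey y0 sub0mx.
  have epw : epi w.
    apply: (epi_right (f := g)) => //; split=> [|i]; first exact: hom_comp eg.1 hw.
    by rewrite /gcomp -ew; have [_ h] := epi_comp (epi_prl P' R') ep2; apply: h.
  apply/short_exactP; exists u, w; split=> // i.
  apply/eqmxP; rewrite -(geq_leqif (mxrank_leqif_eq _)); last by apply/sub_kermxP.
  rewrite mxrank_ker; have /eqP -> := epw.2 i; have /eqP -> := mu.2 i.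
  have := ses_dim i s; have := ses_dim i s1; have := ses_dim i s2; rewrite /=; lia.
case=> R1 [R2 [/short_exactP[r [p1 s1]] /short_exactP[q [p2 s2]] /short_exactP[u [w s3]]]].
have [mr ep1 z1] := s1; have [mq ep2 z2] := s2; have [mu ew z3] := s3.
have rR1 : rg R1 by apply: (rg_quo rR' ep1); have := ses_defect d s1; rewrite rR.1 rR'.1; lia.
have [g1 hg1 eg1] := lift_ed acy s3 (ed_LB_rg acy td lP' rR1) ep2.1.
have hg2 := hom_comp ep1.1 mu.1.
have [||||f sf] := @ses_of_blocks q r g1 (gcomp p1 u) hg1 hg2 mq mr.
- move=> i; apply: eqmx_trans (z1 i) _; apply/eqmxP/andP; split; apply/sub_kermxP.
    by rewrite /gcomp mulmxA mulmx_ker mul0mx.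
  by apply: (row_free_inj (mu.2 i)); rewrite /= mul0mx -mulmxA mulmx_ker.
- move=> i; rewrite /gcomp (eqmxMfull _ (ep1.2 i)) z3; apply/sub_kermxP.
  by rewrite -mulmxA eg1 (ses_comp0 i s2).
- move=> i; rewrite -sub1mx.
  have /submxP[x ex] : (w i <= p2 i)%MS by apply: submx_full; apply: ep2.2.
  have : (1%:M - x *m g1 i <= gcomp p1 u i)%MS.
    rewrite /gcomp (eqmxMfull _ (ep1.2 i)) z3; apply/sub_kermxP.
    by rewrite mulmxBl mul1mx -mulmxA eg1 -ex subrr.
  case/submxP=> y ey; rewrite -[1%:M](subrK (x *m g1 i)) ey addrC -mul_row_col.
  exact: submxMl.
- move=> i; have := ses_dim i s1; have := ses_dim i s2; have := ses_dim i s3; lia.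
by apply/short_exactP; exists f, (rout g1 (gcomp p1 u)).
Qed.

End Sequence.

(** The normal form [<<_>>] turns equality of kernels as subspaces into equality of families, which
    is the encoding that [hall] counts. *)
Definition kerfun M N (g : gm M N) : {dffun forall i, 'M[k]_(rdim M i)} :=
  [ffun i => <<kermx (g i)>>%MS].

Definition hall_set M N L := [set U : {dffun forall i, 'M[k]_(rdim L i)} |
      [&& [forall i, <<U i>>%MS == U i], stable U,
          riso (subrep U) N & riso (quorep U) M]].

Lemma kerfunE M N (g : gm M N) i : (kerfun g i :=: kermx (g i))%MS.
Proof. by rewrite ffunE; apply: genmxE. Qed.

Lemma kerfun_eq M N N' (g : gm M N) (g' : gm M N') :
  (forall i, (kermx (g i) :=: kermx (g' i))%MS) -> kerfun g = kerfun g'.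
Proof. by move=> e; apply/ffunP=> i; rewrite !ffunE; apply/eq_genmx/e. Qed.

Lemma kerfun_inj M N N' (g : gm M N) (g' : gm M N') :
  kerfun g = kerfun g' -> forall i, (kermx (g i) :=: kermx (g' i))%MS.
Proof.
move=> e i; have := kerfunE g i; rewrite e => h.
exact: eqmx_trans (eqmx_sym h) (kerfunE g' i).
Qed.

Lemma hall_setP M N L (U : {dffun forall i, 'M[k]_(rdim L i)}) :
  U \in hall_set M N L <-> exists (f : gm N L) (g : gm L M), ses f g /\ U = kerfun g.
Proof.
split.
  rewrite inE => /and4P[/forallP can /forallP st /risoP iN /risoP iM].
  have sU : stab (fun i => U i) by move=> a; apply: st.
  have [h [mh eh]] := iso_sym iN; have [t [mt et]] := iM.
  have epq := quo_proj_epi sU; have mi := sub_inc_mono sU.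
  have E i : (kermx (gcomp (quo_proj U) t i) :=: U i)%MS.
    apply: eqmx_trans (quo_projK _ i); apply/eqmxP/andP; split; apply/sub_kermxP.
      by apply: (row_free_inj (mt.2 i)); rewrite /= mul0mx -mulmxA mulmx_ker.
    by rewrite /gcomp mulmxA mulmx_ker mul0mx.
  exists (gcomp h (sub_inc U)), (gcomp (quo_proj U) t); split.
    split; [exact: mono_comp | exact: epi_comp |].
    move=> i; apply: eqmx_trans (eqmx_sym (E i)); rewrite /gcomp.
    exact: eqmx_trans (eqmxMfull _ (eh.2 i)) (eq_row_base _).
  by apply/ffunP=> i; rewrite ffunE (eq_genmx (E i)); apply/esym/eqP/can.
case=> f [g [[mf eg z] ->]].
have E := kerfunE g.
have sU : stab (fun i => kerfun g i).
  by move=> a; rewrite E (eqmxMr _ (E _)); apply: (stab_ker eg.1).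
rewrite inE; apply/and4P; split.
- by apply/forallP=> i; rewrite ffunE genmx_id.
- by apply/forallP=> a; apply: sU.
- apply/risoP; apply: (iso_mono_img (sub_inc_mono sU) mf) => i.
  apply: eqmx_trans (eq_row_base _) _; apply: eqmx_trans (E i) (eqmx_sym (z i)).
apply/risoP; apply: (iso_epi_ker (quo_proj_epi sU) eg) => i.
exact: eqmx_trans (quo_projK _ i) (E i).
Qed.

End HallNumber.

(** * Counting the submodules *)

Section HallCount.
Variables (k : finFieldType) (Q : quiver) (d : 'I_(nvert Q) -> int).
Hypotheses (acy : acyclic Q) (td : tame_data d).
Variables P P' R R' R'' : rep k Q.
Hypotheses (lP : LB d P) (lP' : LB d P') (rR : rg d R) (rR' : rg d R') (rR'' : rg d R'').
Hypotheses (cR' : chain d R') (cR'' : chain d R'').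
Implicit Types A B C : rep k Q.

Lemma ker_comp_mono A B C (p : gm A B) (j : gm B C) i : mono j ->
  (kermx (gcomp p j i) :=: kermx (p i))%MS.
Proof.
move=> mj; apply/eqmxP/andP; split; apply/sub_kermxP; last by rewrite /gcomp mulmxA mulmx_ker mul0mx.
by apply: (row_free_inj (mj.2 i)); rewrite /= mul0mx -mulmxA mulmx_ker.
Qed.

(* The submodules counted are the kernels of [(h, b) : P' + R' -> R''], with [b] a
   fixed cokernel of [R -> R'] and [h] arbitrary. *)
Lemma hall_iso (f : gm (rsum P R) (rsum P' R')) (g : gm (rsum P' R') R'') : ses f g ->
  iso P P' -> hall R'' (rsum P R) (rsum P' R') = #|rhom P R''|.
Proof.
move=> s iP; have [q [mq eq]] := iP; have [q' hq' [qq' q'q]] := inv_ex mq eq.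
have dims i : rdim R' i = (rdim R i + rdim R'' i)%N.
  by have := ses_dim i s; have := iso_dim iP i; rewrite /=; lia.
have epi2 (r : gm R R') (g2 : gm R' R'') : hom g2 -> mono r ->
    (forall i, (r i :=: kermx (g2 i))%MS) -> epi g2.
  move=> h2 mr er; split=> // i; rewrite /row_full; apply/eqP.
  have : \rank (r i) = \rank (kermx (g2 i)) by rewrite er.
  rewrite mxrank_ker; have /eqP -> := mr.2 i; have := dims i; have := rank_leq_row (g2 i); lia.
have [_ [_ [r [_ [b [_ _ mr [_ hb _ _ er]]]]]]] := ses_blocks lP lP' rR rR'' s.
have eb := epi2 r b hb mr er.
(* [q'] identifies [P'] with [P], so that the first component ranges over Hom(P, R''). *)
pose F (h : gmap P R'') := kerfun (rout (gcomp q' (fam h)) b).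
have Finj : {in rhom P R'' &, injective F}.
  move=> h h' _ _ /kerfun_inj e; apply/ffunP=> i.
  have full A (x : gm A R'') : (x i <= b i)%MS by apply: submx_full; apply: eb.2.
  have /submxP[w ew] := full _ (gcomp q' (fam h)).
  (* These rows of the first kernel also lie in the second, which forces the two maps to agree. *)
  have : (row_mx 1%:M (- w) <= kermx (rout (gcomp q' (fam h')) b i))%MS.
    by rewrite -e; apply/sub_kermxP; rewrite mul_row_col mul1mx mulNmx -ew subrr.
  move/sub_kermxP; rewrite mul_row_col mul1mx mulNmx -ew => /eqP; rewrite subr_eq0 => /eqP.
  by move/(congr1 (mulmx (q i))); rewrite /gcomp !mulmxA qq' !mul1mx.
have <- : #|hall_set R'' (rsum P R) (rsum P' R')| = hall R'' (rsum P R) (rsum P' R') by [].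
rewrite -(card_in_imset Finj); apply: eq_card => U; apply/idP/imsetP.
  move/hall_setP=> [f' [g' [s' ->]]].
  have [_ [_ [r' [g1 [g2 [_ _ mr' [h1 h2 eg' _ er']]]]]]] := ses_blocks lP lP' rR rR'' s'.
  have rr := chain_uniq cR' mr mr' rR.1 rR.1 (fun i => erefl).
  have ker2 i : (kermx (b i) :=: kermx (g2 i))%MS.
    exact: eqmx_trans (eqmx_sym (er i)) (eqmx_trans (rr i) (er' i)).
  (* [t] is the automorphism of [R''] that takes [g2] to the fixed [b]. *)
  have [|t ht et] := fac_epi (epi2 r' g2 h2 mr' er') eb.1; first by move=> i; rewrite ker2.
  have ept : epi t.
    apply: (epi_right (f := g2)) => //; split=> [|i]; first exact: hom_comp.
    by rewrite /gcomp -et; apply: eb.2.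
  have mt : mono t by apply: epi_dim_mono.
  exists (unfam (gcomp q (gcomp g1 t))).
    by apply/rhomP/unfam_hom/hom_comp; [exact: mq.1 | exact: hom_comp].
  apply: kerfun_eq => i.
  have -> : rout (gcomp q' (fam (unfam (gcomp q (gcomp g1 t))))) b i = gcomp g' t i.
    rewrite /rout /gcomp /fam unfamE mulmxA q'q mul1mx eg' mul_col_mx et //.
  exact: eqmx_sym (ker_comp_mono _ _ mt).
case=> h /rhomP hh ->; apply/hall_setP.
have [|||f' s'] := @ses_of_blocks _ _ d acy td _ _ _ _ _ lP rR q r (gcomp q' (fam h)) b
    (hom_comp hq' hh) hb mq mr er.
- by move=> i; apply: submx_full; apply: eb.2.
- move=> i; rewrite -sub1mx -addsmxE; apply: submx_trans (addsmxSr _ _).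
  by rewrite sub1mx; apply: eb.2.
- exact: (fun i => ses_dim i s).
by exists f', (rout (gcomp q' (fam h)) b).
Qed.

(** The pair [(g1, g2)] is onto. If [g1] vanished on the top [E], then [g2] would not, so it would
    be onto by [top_dichotomy]; then [P] and [P'] would have equal dimensions and [f11] would be an
    isomorphism. *)
Lemma block_top (E : rep k Q) (e : gm R'' E) : epi e -> smp d E -> ~ iso P P' ->
  forall (f : gm (rsum P R) (rsum P' R')) (g : gm (rsum P' R') R'')
    (f11 : gm P P') (r : gm R R') (g1 : gm P' R'') (g2 : gm R' R''),
  ses f g -> mono f11 -> hom g2 -> mono r -> (forall i, (r i :=: kermx (g2 i))%MS) ->
  (forall i, g i = col_mx (g1 i) (g2 i)) -> exists v, g1 v *m e v <> 0.
Proof.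
move=> ee sE niso f g f11 r g1 g2 s m11 h2 mr er eG; have [_ eg _] := s; have [_ nE _] := sE.
apply: NNPP => n; have z1 i : g1 i *m e i = 0 by apply: NNPP => h; apply: n; exists i.
case: (top_dichotomy rR'' cR'' ee sE rR' h2) => [z2|e2].
  have [v hv] := not_is0 nE; apply: hv; have /eqP <- := ee.2 v.
  suff -> : e v = 0 by rewrite mxrank0.
  by apply: (row_full_inj (eg.2 v)); rewrite mulmx0 eG mul_col_mx z1 z2 col_mx0.
apply: niso; exists f11; split=> //; apply: mono_dim_epi => // i.
have := ses_dim i s; have /eqP := e2.2 i; have /eqP := mr.2 i; rewrite er mxrank_ker /=.
have := rank_leq_row (g2 i); lia.
Qed.

(* With [(a, b)] one quotient map and [b = j p] the factorization of [b] through the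
   cokernel [p] of [f], the submodules counted are the kernels of [(a, j al p)] for
   the automorphisms [al] of [coker f]. *)
Lemma hall_not_iso (f0 : gm (rsum P R) (rsum P' R')) (g0 : gm (rsum P' R') R'') : ses f0 g0 ->
  ~ iso P P' -> forall f : gmap R R', rmono f ->
  hall R'' (rsum P R) (rsum P' R') = aut_card (coker f).
Proof.
move=> s niso f /rmonoP mf; have [_ eg0 _] := s.
have [q [f12 [r [a [b [mq _ mr [ha hb eab fE er]]]]]]] := ses_blocks lP lP' rR rR'' s.
pose p : gm R' (coker f) := quo_proj (fun i => <<f i>>%MS).
have ep : epi p := quo_proj_epi (stab_img mf.1).
have kp i : (kermx (p i) :=: f i)%MS := eqmx_trans (quo_projK _ i) (genmxE _).
have sp : ses (fam f) p by split=> // i; apply: eqmx_sym.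
have rC : rg d (coker f).
  by apply: (rg_quo rR' ep); have := ses_defect d sp; rewrite rR.1 rR'.1; lia.
(* Every embedding of [R] in the uniserial [R'] has the same image as [f], so the maps with such a
   kernel factor through [p]. *)
have through (r' : gm R R') (g2 : gm R' R'') : mono r' -> hom g2 ->
    (forall i, (r' i :=: kermx (g2 i))%MS) ->
    exists2 j : gm (coker f) R'', mono j & forall i, g2 i = p i *m j i.
  move=> mr' h2 er'; have rr := chain_uniq cR' mf mr' rR.1 rR.1 (fun i => erefl).
  have ker2 i : (kermx (p i) :=: kermx (g2 i))%MS.
    exact: eqmx_trans (kp i) (eqmx_trans (rr i) (er' i)).
  have [|j hj ej] := fac_epi ep h2; first by move=> i; rewrite ker2.
  exists j => //; split=> // i; rewrite -kermx_eq0 -submx0; apply/rV_subP=> x /sub_kermxP x0.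
  have /submxP[y ey] : (x <= p i)%MS by apply: submx_full; apply: ep.2.
  have : (y <= kermx (g2 i))%MS by apply/sub_kermxP; rewrite ej mulmxA -ey.
  by rewrite -ker2 => /sub_kermxP y0; rewrite ey y0 sub0mx.
have [j mj ej] := through r b mr hb er.
have nz : ~ rep_is0 R''.
  move=> z; apply: niso; exists q; split=> //; apply: mono_dim_epi => // i.
  by have := ses_dim i s; have := mono_dim i mr; rewrite z /=; lia.
have [E [e [ee sE]]] := smp_quo_ex rR'' nz.
have [v av] := block_top ee sE niso s mq hb mr er eab.
pose G (al : gmap (coker f) (coker f)) := rout a (gcomp (gcomp p (fam al)) j).
pose F al := kerfun (G al).
pose Au := [set al : gmap (coker f) (coker f) | rmono al && repi al].
have Gses al : al \in Au -> exists f', @ses _ _ (rsum P R) _ _ f' (G al).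
  rewrite inE => /andP[/rmonoP ml /repiP el].
  have jG i : (gcomp (gcomp p (fam al)) j i :=: b i)%MS.
    rewrite ej; apply: eqmx_trans (eqmxMfull _ _) (eqmx_sym (eqmxMfull _ (ep.2 i))).
    by have [_ h] := epi_comp ep el; apply: h.
  have hG := hom_comp (hom_comp ep.1 ml.1) mj.1.
  apply: (@ses_of_blocks _ _ d acy td _ _ _ _ _ lP rR q (fam f) a _ ha hG mq mf).
  - move=> i; apply: eqmx_sym; apply: eqmx_trans (ker_comp_mono _ _ mj) _.
    exact: eqmx_trans (ker_comp_mono _ _ ml) (kp i).
  - move=> i; rewrite jG; have := ses_comp0 i s; rewrite fE eab mul_col_mx !mul_row_col.
    move/eqP; rewrite col_mx_eq0 => /andP[/eqP h _].
    by move/eqP: h; rewrite addr_eq0 => /eqP ->; rewrite -mulNmx submxMl.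
  - move=> i; have := eg0.2 i; rewrite eab -!sub1mx -!addsmxE.
    by rewrite (adds_eqmx (eqmx_refl _) (jG i)).
  - exact: (fun i => ses_dim i s).
have Finj : {in Au &, injective F}.
  move=> al be /Gses[fa sa] /Gses[fb sb] /kerfun_inj eK.
  have [_ ea _] := sa; have [_ eb _] := sb.
  (* Equal kernels give an endomorphism [th] of [R''] with [a] followed by [th] equal to [a]; by
     [top_faithful] it is the identity. *)
  have [|th hth eth] := fac_epi ea eb.1; first by move=> i; rewrite eK.
  have eth' i : a i = a i *m th i /\
      gcomp (gcomp p (fam be)) j i = gcomp (gcomp p (fam al)) j i *m th i.
    by have := eth i; rewrite /G /rout mul_col_mx => /eq_col_mx.
  have th1 i : th i = 1%:M.
    apply/eqP; rewrite -subr_eq0 -scaleN1r; apply/eqP.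
    apply: (top_faithful rR'' cR'' ee sE ha av (hom_add hth (hom_scale _ (@hom_id _ _ R'')))) => l.
    by rewrite /gadd /gscale /gid scaleN1r mulmxBr mulmx1 -(eth' l).1 subrr.
  apply/ffunP=> i; have := (eth' i).2; rewrite th1 mulmx1 /gcomp => /(row_free_inj (mj.2 i)).
  by move/(row_full_inj (ep.2 i)).
have -> : aut_card (coker f) = #|Au| by [].
have <- : #|hall_set R'' (rsum P R) (rsum P' R')| = hall R'' (rsum P R) (rsum P' R') by [].
rewrite -(card_in_imset Finj); apply: eq_card => U; apply/idP/imsetP; last first.
  case=> al /Gses[f' s'] ->; apply/hall_setP; by exists f', (G al).
move/hall_setP=> [f' [g' [s' ->]]].
have [q' [_ [r' [g1 [g2 [mq' _ mr' [h1 h2 eg' _ er']]]]]]] := ses_blocks lP lP' rR rR'' s'.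
have [w gw] := block_top ee sE niso s' mq' h2 mr' er' eg'.
have [t ht et] := LB_top_fac acy td rR'' cR'' ee sE lP' h1 gw ha.
have ept : epi t.
  case: (top_dichotomy rR'' cR'' ee sE rR'' ht) => // t0.
  by exfalso; apply: av; rewrite et -mulmxA t0 mulmx0.
have mt : mono t by apply: epi_dim_mono.
have [|j' mj' ej'] := through r' (gcomp g2 t) mr' (hom_comp h2 ht).
  by move=> i; apply: eqmx_trans (er' i) (eqmx_sym (ker_comp_mono _ _ mt)).
(* Uniseriality of [R''] gives [j'] and [j] the same image, so they differ by an automorphism [al]
   of the cokernel. *)
have jj := chain_uniq cR'' mj' mj rC.1 rC.1 (fun i => erefl).
have [|al hal eal] := fac_mono mj mj'.1; first by move=> i; rewrite jj.
have mal : mono al.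
  apply: (mono_left (g := j)) => //; split=> [|i]; first exact: hom_comp hal mj.1.
  by rewrite /gcomp -eal; apply: mj'.2.
exists (unfam al).
  rewrite inE; apply/andP; split; [exact/rmonoP/unfam_mono | apply/repiP/unfam_epi].
  exact: mono_dim_epi.
apply: kerfun_eq => i.
have -> : G (unfam al) i = gcomp g' t i.
  rewrite /G /rout /gcomp /fam unfamE -mulmxA -eal -ej' eg' mul_col_mx -et //.
exact: eqmx_sym (ker_comp_mono _ _ mt).
Qed.

End HallCount.

(** The cokernel R'/R is taken for every monomorphism [f : R -> R']; the first equivalence supplies
    one whenever the sequence exists. *)
Theorem proposition5p4 (k : finFieldType) (Q : quiver)
    (Q_tame : tame Q) (Q_acyclic : acyclic Q)
    (delta : 'I_(nvert Q) -> int) (delta_min : min_pos_imaginary_root delta)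
    (P P' R R' R'' : rep k Q)
    (P_ind : indecomposable P) (P_prep : preprojective P)
    (P_def : defect delta P = -1)
    (P'_ind : indecomposable P') (P'_prep : preprojective P')
    (P'_def : defect delta P' = -1)
    (R_reg : rep_is0 R \/ indecomposable R /\ regular R)
    (R'_reg : rep_is0 R' \/ indecomposable R' /\ regular R')
    (R''_reg : rep_is0 R'' \/ indecomposable R'' /\ regular R'') :
  (short_exact (rsum P R) (rsum P' R') R'' <->
   exists R1 R2 : rep k Q,
     [/\ short_exact R R' R1, short_exact P P' R2 & short_exact R1 R'' R2]) /\
  (short_exact (rsum P R) (rsum P' R') R'' ->
   (riso P P' -> hall R'' (rsum P R) (rsum P' R') = #|rhom P R''|) /\
   (~ riso P P' -> forall f : gmap R R', rmono f ->
      hall R'' (rsum P R) (rsum P' R') = aut_card (coker f))).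
Proof.
have td := min_root_tame_data Q_tame delta_min.
have lP := LB_intro Q_acyclic td P_ind P_def; have lP' := LB_intro Q_acyclic td P'_ind P'_def.
have reg (M : rep k Q) : rep_is0 M \/ indecomposable M /\ regular M -> rg delta M /\ chain delta M.
  case=> [z|[ind rM]]; first by split; [exact: is0_rg | exact: is0_chain].
  have r := regular_rg Q_acyclic td ind rM; split=> //; exact: (indec_chain Q_acyclic td r ind).
have [rR _] := reg R R_reg; have [rR' cR'] := reg R' R'_reg; have [rR'' cR''] := reg R'' R''_reg.
split; first exact: (ses_split_iff Q_acyclic td lP lP' rR rR' rR'').
move/short_exactP=> [f [g s]]; split.
  by move/risoP; apply: (hall_iso Q_acyclic td lP lP' rR rR'' cR' s).
move=> n; have {}n : ~ iso P P' by move/risoP.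
by apply: (hall_not_iso Q_acyclic td lP lP' rR rR' rR'' cR' cR'' s n).
Qed.
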